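(* Let $N$ be a positive integer, $i\in\{0,1,\ldots,N-1\}$, and let $(a_n)_{n\ge 0}$, $(b_n)_{n\ge0}$ be Jacobi parameters. Suppose that $$\lim_{j\to\infty}a_{jN+i-1}=\infty,\qquad \lim_{j\to\infty}\big(a_{(j+1)N+i-1}-a_{jN+i-1}\big)=0.$$ Let $\sigma\in\{-1,1\}$, put $R_n(x)=a_{n+N-1}\big(X_n(x)-\sigma\operatorname{Id}\big)$, and let $$\Lambda^i=\Big\{x\in\mathbb{R}:\lim_{j\to\infty}\operatorname{discr}R_{jN+i}(x)\text{ exists and is negative}\Big\}.$$ Suppose that $K\subset\Lambda^i$ is a compact interval with non-empty interior such that $$\big(X_{jN+i}:j\in\mathbb{N}\big),\ \big(R_{jN+i}:j\in\mathbb{N}\big)\in\mathcal{D}_1\big(K,\operatorname{GL}(2,\mathbb{R})\big).$$ Then there are $M\ge1$ and a continuous real-valued function $\eta$ on $K$ such that $$\lim_{n\to\infty}\sup_{x\in K}\bigg|\sqrt{a_{nN+i-1}}\,p_{nN+i}(x)-\sqrt{\frac{2\big|[\mathcal{R}_i(x)]_{2,1}\big|}{\pi\mu'(x)\sqrt{-h_i(x)}}}\,\sin\Big(\sum_{j=M+1}^{n}\theta_j(x)+\eta(x)\Big)\bigg|=0,$$ where $$h_i(x)=\lim_{n\to\infty}\operatorname{discr}R_{nN+i}(x),\qquad \mathcal{R}_i(x)=\lim_{n\to\infty}R_{nN+i}(x),\qquad \theta_j(x)=\arccos\bigg(\frac{\operatorname{tr}X_{jN+i}(x)}{2\sqrt{\det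 X_{jN+i}(x)}}\bigg)$$ (with $M$ such that $\theta_j$ is well defined on $K$ for all $j>M$).
   Context: $\mathbb{N}=\{1,2,\ldots\}$, $\mathbb{N}_0=\mathbb{N}\cup\{0\}$. Jacobi parameters are real sequences $(a_n)_{n\ge0}$, $(b_n)_{n\ge0}$ with $a_n>0$ for all $n$. The associated polynomials are $p_0(x)=1$, $p_1(x)=\frac{x-b_0}{a_0}$, $xp_n(x)=a_np_{n+1}(x)+b_np_n(x)+a_{n-1}p_{n-1}(x)$ for $n\ge1$. By Favard's theorem there is a probability measure on $\mathbb{R}$ for which $(p_n)$ is orthonormal; when it is unique (as is the case under the present hypotheses, which imply the Carleman condition $\sum_n1/a_n=\infty$) it is denoted $\mu$. Under the present hypotheses $\mu$ is absolutely continuous on $K$ with a continuous positive density, denoted $\mu'$. For $n\ge1$, $B_n(x)=\begin{pmatrix}0&1\\-\frac{a_{n-1}}{a_n}&\frac{x-b_n}{a_n}\end{pmatrix}$ and $X_n(x)=\prod_{j=n}^{n+N-1}B_j(x)=B_{n+N-1}(x)\cdots B_{n+1}(x)B_n(x)$. For a $2\times2$ matrix $Y$, $[Y]_{k,l}$ denotes its $(k,l)$ entry and $\operatorname{discr}Y=(\operatorname{tr}Y)^2-4\det Y$. $\operatorname{GL}(2,\mathbb{R})$ is the set of real invertible $2\times2$ matrices with the spectral norm. For compact $K\subset\mathbb{R}$, a sequence of mappings $Y_n:K\to\operatorname{GL}(2,\mathbb{R})$ belongs to $\mathcal{D}_1(K,\operatorname{GL}(2,\mathbb{R}))$ if $\sum_n\sup_{x\in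 K}\|Y_{n+1}(x)-Y_n(x)\|<\infty$. *)

(* Defs.v *)
From HB Require Import structures.
From mathcomp Require Import all_boot all_order all_algebra.
From mathcomp Require Import all_classical all_reals all_analysis.

Set Implicit Arguments.
Unset Strict Implicit.
Unset Printing Implicit Defensive.

Import Order.TTheory GRing.Theory Num.Theory.
Import numFieldNormedType.Exports.

Local Open Scope classical_set_scope.
Local Open Scope ring_scope.

Section JacobiParameters.
Context {R : realType}.
Implicit Types (a b : nat -> R) (n N i j : nat) (x sigma : R).

Fixpoint jacobi_poly a b n : {poly R} :=
  match n with
  | 0 => 1
  | 1 => (a 0)^-1 *: ('X - (b 0)%:P)
  | (m.+1 as k).+1 =>
      (a k)^-1 *: (('X - (b k)%:P) * jacobi_poly a b k
                   - a m *: jacobi_poly a b m)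
  end.

Definition orthonormality_measure a b (mu : probability (measurableTypeR R) R) :=
  forall m n,
    mu.-integrable setT
      (EFin \o (fun x => (jacobi_poly a b m).[x] * (jacobi_poly a b n).[x])) /\
    (\int[mu]_x ((jacobi_poly a b m).[x] * (jacobi_poly a b n).[x])%:E
     = ((m == n)%:R : R)%:E)%E.

(* The condition on A `<=` K says both that the restriction of mu to K is
   absolutely continuous and that w is its density; the values of w outside K
   are irrelevant. *)
Definition continuous_positive_density
    (mu : probability (measurableTypeR R) R) (K : set R) (w : R -> R) :=
  [/\ {within K, continuous w},
      forall x, K x -> 0 < w x &
      forall A : set (measurableTypeR R), measurable A -> A `<=` K ->
        (mu A = \int[lebesgue_measure]_(x in A) (w x)%:E)%E].

(* B_n; it is only meaningful for n >= 1. *)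
Definition transfer_mx a b n x : 'M[R]_2 :=
  \matrix_(k < 2, l < 2)
    if k == 0 then (if l == 0 then 0 else 1)
    else (if l == 0 then - (a n.-1 / a n) else (x - b n) / a n).

(* X_n = B_(n+N-1) ... B_(n+1) B_n: the list is reversed because \prod
   multiplies from left to right. *)
Definition Nstep_mx a b N n x : 'M[R]_2 :=
  \prod_(j <- rev (iota n N)) transfer_mx a b j x.

Definition scaled_mx a b N sigma n x : 'M[R]_2 :=
  a (n + N).-1 *: (Nstep_mx a b N n x - sigma%:M).

Definition discr (Y : 'M[R]_2) : R := (\tr Y) ^+ 2 - 4 * \det Y.

Definition Lambda a b N sigma i : set R :=
  [set x | exists l : R,
     discr (scaled_mx a b N sigma (j * N + i) x) @[j --> \oo] --> l /\ l < 0].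

Definition limit_mx a b N sigma i x : 'M[R]_2 :=
  lim (scaled_mx a b N sigma (n * N + i) x @[n --> \oo]).

Definition limit_discr a b N sigma i x : R :=
  lim (discr (scaled_mx a b N sigma (n * N + i) x) @[n --> \oo]).

Definition theta_arg a b N i j x : R :=
  \tr (Nstep_mx a b N (j * N + i) x) /
  (2 * Num.sqrt (\det (Nstep_mx a b N (j * N + i) x))).

Definition theta a b N i j x : R := acos (theta_arg a b N i j x).

(* acos and Num.sqrt are total functions: this records that theta j x is
   computed from arguments in their proper domains. *)
Definition theta_well_defined a b N i j x :=
  0 < \det (Nstep_mx a b N (j * N + i) x) /\ -1 <= theta_arg a b N i j x <= 1.

End JacobiParameters.

Section D1.
Context {R : realType}.

Definition euclidean_norm n (v : 'cV[R]_n) : R :=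
  Num.sqrt (\sum_(k < n) v k 0 ^+ 2).

(* The canonical norm on matrices is the maximum norm; this is the operator norm
   induced by the Euclidean norm. *)
Definition spectral_norm n (A : 'M[R]_n) : R :=
  sup [set euclidean_norm (A *m v) | v in [set v | euclidean_norm v <= 1]].

(* The class D_1(K, GL(2, R)) for sequences indexed by n = 1, 2, ...; the
   value Y 0 is ignored. *)
Definition D1 (K : set R) (Y : nat -> R -> 'M[R]_2) :=
  (forall n x, (0 < n)%N -> K x -> Y n x \in unitmx) /\
  (\sum_(1 <= n <oo)
     ereal_sup [set (spectral_norm (Y n.+1 x - Y n x))%:E | x in K] < +oo)%E.

End D1.

(* Main.v *)
Require Import Defs.
From HB Require Import structures.
From mathcomp Require Import all_boot all_order all_algebra.
From mathcomp Require Import all_classical all_reals all_analysis.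
From mathcomp Require Import ring lra.
From mathcomp Require Import complex measurable_realfun.
(** Write n_j = jN + i, al_j = a_(n_j - 1), v_j = (p_(n_j - 1)(x), p_(n_j)(x))
    and R_j for the rescaled matrix of index n_j. Two mechanisms carry the
    proof; both rest on the quadratic form Q_j(v) = det [v, R_j v], which is
    definite, uniformly on K for large j, because its discriminant is that of R_j.

    Growth and phase. As v_(j+1) = X_j v_j, as X_j commutes with R_j and as
    det X_j = al_j / al_(j+1), one has al_(j+1) Q_j(v_(j+1)) = al_j Q_j(v_j).
    Replacing Q_j by Q_(j+1) costs a relative error of the order of
    sup |R_(j+1) - R_j|, which is summable: al_j Q_j(v_j) converges uniformly to
    a continuous function g without zeros (turan_limit). In the same way, the
    linear form al_j^(1/2) ell_j(v_j), with ell_j a complex left eigenvector of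
    R_j, is multiplied by exp(i theta_j) up to a summable error (eigen_step,
    eigen_perturbation). Undoing the rotations gives a uniform limit whose
    squared modulus is [R]_(2,1) g (unwound_limit, limit_sqr), and whose
    argument has a continuous choice on K (argument_lift). The imaginary part of
    ell_j(v_j) being a multiple of p_(n_j), this yields the sine asymptotics with
    an amplitude expressed by g (sine_asymptotics). The phase of the theorem
    contains theta_n as well, so it is the phase of the next term of the sequence;
    consecutive terms agree in the limit up to the factor sigma
    (next_almost_equal), and a sign only shifts eta by pi.

    Density. It remains to prove that mu has the density
    w = (- h)^(1/2) / (2 pi |g|) on K. For a complex tau in the upper half-plane
    the density Im tau / (pi a_n |p_(n+1) + tau p_n|^2) makes p_0, ..., p_n
    orthonormal (boundary_density_orthonormal): all zeros of p_(n+1) + tau p_n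
    are in the lower half-plane, so the integrals needed come from explicit
    primitives of rational functions. For the tau that makes |p_(n+1) + tau p_n|^2
    a multiple of the limit of the forms Q_j at x_0, these densities are close to w(x_0)
    near x_0 (local_density_K). Two measures with the same first moments have
    nearly the same Poisson integrals, the error at z being controlled by
    sum_(k <= n) |p_k(z)|^2, which tends to infinity by Carleman's condition
    (poisson_compare, cchristoffel_lower). Hence the Poisson integral of mu
    converges to pi w, locally uniformly (poisson_mu_local), and mu has no atoms
    in K (no_atom); differentiating the distribution function of mu gives the
    density (density_of_local_poisson). *)

Set Implicit Arguments.
Unset Strict Implicit.
Unset Printing Implicit Defensive.
Import Order.TTheory GRing.Theory Num.Theory.
Import numFieldNormedType.Exports.
Local Open Scope classical_set_scope.
Local Open Scope ring_scope.

(** * Integrals over the real line from primitives *)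

Section IntegralLine.
Variable R : realType.
Implicit Types (f F : R -> R).
Let leb := @lebesgue_measure R.

Lemma is_derive_continuous f (g : R -> R) : (forall x : R, is_derive x 1 f (g x)) -> continuous f.
Proof.
move=> h x; apply: differentiable_continuous; apply/derivable1_diffP.
exact: ex_derive.
Qed.

Lemma ge0_FTC_line f F (l m : R) : (forall x, 0 <= f x) -> continuous f ->
  (forall x : R, is_derive x 1 F (f x)) ->
  F x @[x --> +oo] --> l -> F x @[x --> -oo] --> m ->
  (\int[leb]_x (f x)%:E = (l - m)%:E)%E.
Proof.
move=> f0 cf dF Fl Fm.
have cF : continuous F by exact: is_derive_continuous dF.
have mf : measurable_fun setT f by exact: continuous_measurable_fun.
have -> : [set: R] = `]-oo, 0] `|` `]0, +oo[.
  by rewrite -(setUv `]-oo, 0]) setCitvl.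
rewrite ge0_integral_setU//=; last 3 first.
- by apply/measurable_EFinP; exact: measurable_funTS.
- by move=> x _; rewrite lee_fin.
- apply/disj_setPS => x /= []; rewrite !in_itv/= andbT => x0.
  by rewrite ltNge x0.
rewrite integral_itv_obnd_cbnd; last first.
  by apply/measurable_EFinP; exact: measurable_funTS.
rewrite (@ge0_continuous_FTC2y _ f F 0 l)//; last 3 first.
- exact: continuous_subspaceT.
- exact/cvg_at_right_filter/cF.
- by move=> x _; rewrite derive1E; exact: derive_val.
rewrite -oppr0 ge0_integration_by_substitutionNy; last 2 first.
- exact: continuous_subspaceT.
- by move=> x _; exact: f0.
have dG (x : R) : is_derive x 1 (fun x => - F (- x)) (f (- x)).
  have := is_deriveN (@is_derive1_comp _ F -%R x _ _ (dF (- x)) (is_deriveNid _ _)).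
  by rewrite mulrN1 opprK.
rewrite (@ge0_continuous_FTC2y _ (f \o -%R) (fun x => - F (- x)) 0 (- m))//; last 5 first.
- by move=> x _; exact: f0.
- by apply: continuous_subspaceT => x; apply: continuous_comp; [exact: opp_continuous|exact: cf].
- by apply: cvgN; apply/cvgNy_compNP.
- have c : - F (- x) @[x --> (0 : R)] --> - F (- 0).
    exact: (is_derive_continuous dG).
  exact: cvg_at_right_filter c.
- by move=> x _; rewrite derive1E; exact: derive_val.
by rewrite /= -!EFinD oppr0; congr EFin; ring.
Qed.

Lemma cvgNy_atan : (@atan R) x @[x --> -oo] --> - (pi / 2).
Proof.
apply/cvgNy_compNP; rewrite (_ : _ \o _ = (fun x : R => - atan x)).
  by apply: cvgN; exact: cvgy_atan.
by apply/funext => x /=; rewrite atanN.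
Qed.

(** The majorant C / (1 + x^2), whose primitive C atan x has finite limits at both ends. *)
Lemma decay_majorant (C : R) : 0 <= C ->
  [/\ forall x : R, 0 <= C * (1 + x ^+ 2)^-1, continuous (fun x : R => C * (1 + x ^+ 2)^-1),
      forall x : R, is_derive x 1 (fun x => C * atan x) (C * (1 + x ^+ 2)^-1),
      (fun x : R => C * atan x) x @[x --> +oo] --> C * (pi / 2) &
      (fun x : R => C * atan x) x @[x --> -oo] --> C * - (pi / 2)].
Proof.
move=> C0; split.
- by move=> x; rewrite mulr_ge0// invr_ge0 addr_ge0// sqr_ge0.
- by move=> x; apply: cvgM; [exact: cvg_cst|exact: continuous_oneDsqrV].
- by move=> x; apply: is_derive_eq.
- by apply: cvgM; [exact: cvg_cst|exact: cvgy_atan].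
- by apply: cvgM; [exact: cvg_cst|exact: cvgNy_atan].
Qed.

Lemma decay_ge0 f (C : R) : (forall x, `|f x| <= C / (1 + x ^+ 2)) -> 0 <= C.
Proof. by move=> /(_ 0); rewrite expr0n addr0 divr1; exact: le_trans. Qed.

Lemma integrable_decay f (C : R) : continuous f ->
  (forall x, `|f x| <= C / (1 + x ^+ 2)) -> leb.-integrable setT (EFin \o f).
Proof.
move=> cf fC; have [g0 cg dG Gl Gm] := decay_majorant (decay_ge0 fC).
pose g (x : R) : R := C * (1 + x ^+ 2)^-1.
have intg : leb.-integrable setT (EFin \o g).
  apply/integrableP; split; first by apply/measurable_EFinP; exact: continuous_measurable_fun.
  under eq_integral => x _ do rewrite /= ger0_norm ?g0//.
  by rewrite (ge0_FTC_line g0 cg dG Gl Gm) ltry.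
apply: (le_integrable _ _ _ intg) => //.
  by apply/measurable_EFinP; exact: continuous_measurable_fun.
by move=> x _ /=; rewrite lee_fin (le_trans (fC x))// ler_norm.
Qed.

(** Adding the majorant of the decay makes the integrand nonnegative, which
    reduces the signed case to the nonnegative one. *)
Lemma FTC_line f F (C l m : R) : continuous f ->
  (forall x, `|f x| <= C / (1 + x ^+ 2)) ->
  (forall x : R, is_derive x 1 F (f x)) ->
  F x @[x --> +oo] --> l -> F x @[x --> -oo] --> m ->
  leb.-integrable setT (EFin \o f) /\
  (\int[leb]_x (f x)%:E = (l - m)%:E)%E.
Proof.
move=> cf fC dF Fl Fm; have [g0 cg dG Gl Gm] := decay_majorant (decay_ge0 fC).
pose g (x : R) : R := C * (1 + x ^+ 2)^-1.
have intf := integrable_decay cf fC.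
have intg : leb.-integrable setT (EFin \o g).
  by apply: (@integrable_decay _ C) => // x; rewrite ger0_norm ?g0.
split => //.
have h0 x : 0 <= (f \+ g) x.
  have := fC x; rewrite ler_norml => /andP[+ _]; rewrite /= /g; lra.
have ch : continuous (f \+ g) by move=> x; apply: cvgD; [exact: cf|exact: cg].
have := @ge0_FTC_line (f \+ g) (F \+ (fun x => C * atan x)) _ _ h0 ch
   (fun x => is_deriveD (dF x) (dG x)) (cvgD Fl Gl) (cvgD Fm Gm) => /(_ _ _).
under eq_integral do rewrite EFinD.
rewrite integralD// (ge0_FTC_line g0 cg dG Gl Gm) -(fineK (integrable_fin_num _ intf))// -EFinD => -[e].
by congr EFin; lra.
Qed.

End IntegralLine.

(** * Primitives of rational functions with poles in the lower half-plane *)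

Section ComplexPrimitive.
Variable R : realType.
Implicit Types (w z : R[i]) (f g F G : R -> R[i]).
Local Notation Re := complex.Re.
Local Notation Im := complex.Im.

Lemma ReD z w : Re (z + w) = Re z + Re w. Proof. by case: z w => [? ?] [? ?]. Qed.
Lemma ImD z w : Im (z + w) = Im z + Im w. Proof. by case: z w => [? ?] [? ?]. Qed.
Lemma ReN z : Re (- z) = - Re z. Proof. by case: z. Qed.
Lemma ImN z : Im (- z) = - Im z. Proof. by case: z. Qed.
Lemma ReM z w : Re (z * w) = Re z * Re w - Im z * Im w.
Proof. by case: z w => [? ?] [? ?]. Qed.
Lemma ImM z w : Im (z * w) = Re z * Im w + Im z * Re w.
Proof. by case: z w => [? ?] [? ?]. Qed.
Lemma complex_ext z w : Re z = Re w -> Im z = Im w -> z = w.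
Proof. by case: z w => [? ?] [? ?] /= -> ->. Qed.
Lemma ReV z : Re z^-1 = Re z / (Re z ^+ 2 + Im z ^+ 2).
Proof. by case: z. Qed.
Lemma ImV z : Im z^-1 = - (Im z / (Re z ^+ 2 + Im z ^+ 2)).
Proof. by case: z. Qed.

Definition cderiv F f := forall x : R,
  is_derive x 1 (fun t => Re (F t)) (Re (f x)) /\
  is_derive x 1 (fun t => Im (F t)) (Im (f x)).

Definition vanishing (u : R -> R) := u x @[x --> +oo] --> 0 /\ u x @[x --> -oo] --> 0.

Definition cvanishing F := vanishing (fun x => Re (F x)) /\ vanishing (fun x => Im (F x)).

(** The integral of f over the line is 0, witnessed by a primitive that vanishes at
    both ends. *)
Definition null_primitive f := exists2 F, cderiv F f & cvanishing F.

Lemma vanishingD (u v : R -> R) : vanishing u -> vanishing v -> vanishing (fun x => u x + v x).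
Proof. by move=> [u1 u2] [v1 v2]; split; rewrite -[0]addr0; exact: cvgD. Qed.
Lemma vanishingB (u v : R -> R) : vanishing u -> vanishing v -> vanishing (fun x => u x - v x).
Proof. by move=> [u1 u2] [v1 v2]; split; rewrite -[0]subr0; exact: cvgB. Qed.
Lemma vanishingM (u v : R -> R) : vanishing u -> vanishing v -> vanishing (fun x => u x * v x).
Proof. by move=> [u1 u2] [v1 v2]; split; rewrite -[0](mulr0 0); exact: cvgM. Qed.
Lemma vanishingZ (c : R) (u : R -> R) : vanishing u -> vanishing (fun x => c * u x).
Proof. by move=> [u1 u2]; split; rewrite -[0](mulr0 c); apply: cvgM => //; exact: cvg_cst. Qed.

(** The decay is measured from an arbitrary centre a, so that it applies directly to
    1 / (x - w) with a = Re w. *)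
Lemma vanishing_bound (C a : R) (u : R -> R) : (forall x, `|u x| * `|x - a| <= C) -> vanishing u.
Proof.
move=> uC.
have C0 : 0 <= C by apply: le_trans (uC a); rewrite mulr_ge0.
have key (e x : R) : 0 < e -> (C + 1) / e <= `|x - a| -> `|u x| < e.
  move=> e0 h.
  have xa0 : 0 < `|x - a| by apply: lt_le_trans h; rewrite divr_gt0// ltr_wpDl.
  rewrite -(ltr_pM2r xa0) (le_lt_trans (uC x))//.
  by move: h; rewrite ler_pdivrMr// => h; rewrite mulrC; apply: lt_le_trans h; lra.
split; apply/cvgr0Pnorm_lt => e e0.
- near=> x; apply: key => //.
  rewrite (le_trans _ (ler_norm _))// lerBrDr.
  by near: x; apply: nbhs_pinfty_ge; rewrite num_real.
- near=> x; apply: key => //.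
  rewrite distrC (le_trans _ (ler_norm _))// lerBrDr -lerBrDl.
  by near: x; apply: nbhs_ninfty_le; rewrite num_real.
Unshelve. all: by end_near. Qed.

Lemma cvanishingD F G : cvanishing F -> cvanishing G -> cvanishing (fun x => F x + G x).
Proof.
move=> [a b] [c d]; split.
  by under eq_fun do rewrite ReD; exact: vanishingD.
by under eq_fun do rewrite ImD; exact: vanishingD.
Qed.

Lemma cvanishingM F G : cvanishing F -> cvanishing G -> cvanishing (fun x => F x * G x).
Proof.
move=> [a b] [c d]; split.
  by under eq_fun do rewrite ReM; apply: vanishingB; exact: vanishingM.
by under eq_fun do rewrite ImM; apply: vanishingD; exact: vanishingM.
Qed.

Lemma cvanishingZ w F : cvanishing F -> cvanishing (fun x => w * F x).
Proof.
move=> [a b]; split.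
  by under eq_fun do rewrite ReM; apply: vanishingB; exact: vanishingZ.
by under eq_fun do rewrite ImM; apply: vanishingD; exact: vanishingZ.
Qed.

Lemma cderivD F G f g : cderiv F f -> cderiv G g ->
  cderiv (fun x => F x + G x) (fun x => f x + g x).
Proof.
move=> hF hG x; have [a b] := hF x; have [c d] := hG x; split.
  by under eq_fun do rewrite ReD; rewrite ReD; apply: is_deriveD.
by under eq_fun do rewrite ImD; rewrite ImD; apply: is_deriveD.
Qed.

Lemma cderivM F G f g : cderiv F f -> cderiv G g ->
  cderiv (fun x => F x * G x) (fun x => f x * G x + F x * g x).
Proof.
move=> hF hG x; have [a b] := hF x; have [c d] := hG x; split.
  under eq_fun do rewrite ReM; rewrite ReD !ReM.
  by apply: is_derive_eq; rewrite /GRing.scale /=; ring.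
under eq_fun do rewrite ImM; rewrite ImD !ImM.
by apply: is_derive_eq; rewrite /GRing.scale /=; ring.
Qed.

Lemma cderiv_cst w : cderiv (fun=> w) (fun=> 0).
Proof. by move=> x; split; exact: is_derive_cst. Qed.

Lemma cderivZ w F f : cderiv F f -> cderiv (fun x => w * F x) (fun x => w * f x).
Proof.
move=> hF; have := cderivM (cderiv_cst w) hF.
by under [X in cderiv _ X]eq_fun do rewrite mul0r add0r.
Qed.

Lemma null_primitiveD f g : null_primitive f -> null_primitive g ->
  null_primitive (fun x => f x + g x).
Proof.
move=> [F F1 F2] [G G1 G2]; exists (fun x => F x + G x).
  exact: cderivD.
exact: cvanishingD.
Qed.

Lemma null_primitiveZ w f : null_primitive f -> null_primitive (fun x => w * f x).
Proof.
move=> [F F1 F2]; exists (fun x => w * F x).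
  exact: cderivZ.
exact: cvanishingZ.
Qed.

Lemma null_primitive0 : null_primitive (fun=> 0).
Proof.
exists (fun=> 0); first exact: cderiv_cst.
by split; split; exact: cvg_cst.
Qed.

Definition cinv_sub w (x : R) : R[i] := ((x%:C)%C - w)^-1.

Lemma Re_cinv_sub w x : Re (cinv_sub w x) = (x - Re w) / ((x - Re w) ^+ 2 + Im w ^+ 2).
Proof. by rewrite /cinv_sub ReV ReD ImD ReN ImN /= add0r sqrrN. Qed.

Lemma Im_cinv_sub w x : Im (cinv_sub w x) = Im w / ((x - Re w) ^+ 2 + Im w ^+ 2).
Proof. by rewrite /cinv_sub ImV ReD ImD ReN ImN /= add0r sqrrN mulNr opprK. Qed.

Lemma sqr_dist_gt0 w (x : R) : Im w != 0 -> 0 < (x - Re w) ^+ 2 + Im w ^+ 2.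
Proof. by move=> h; rewrite ltr_wpDl ?sqr_ge0// exprn_even_gt0. Qed.

Lemma cvanishing_inv_sub w : Im w != 0 -> cvanishing (cinv_sub w).
Proof.
move=> w0; split.
  under eq_fun do rewrite Re_cinv_sub.
  apply: (@vanishing_bound 1 (Re w)) => x.
  have h := sqr_dist_gt0 x w0.
  rewrite normrM normfV (gtr0_norm h) mulrAC ler_pdivrMr// mul1r -normrM ger0_norm.
    by rewrite -expr2 lerDl sqr_ge0.
  by rewrite -expr2 sqr_ge0.
under eq_fun do rewrite Im_cinv_sub.
apply: (@vanishing_bound 1 (Re w)) => x.
have h := sqr_dist_gt0 x w0.
rewrite normrM normfV (gtr0_norm h) mulrAC ler_pdivrMr// mul1r.
rewrite -[leRHS]addr0 -(real_normK (num_real (x - Re w))) -(real_normK (num_real (Im w))).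
have := sqr_ge0 (`|x - Re w| - `|Im w|); have := normr_ge0 (x - Re w); have := normr_ge0 (Im w).
nra.
Qed.

Lemma cderiv_inv_sub w : Im w != 0 -> cderiv (cinv_sub w) (fun x => - (cinv_sub w x * cinv_sub w x)).
Proof.
move=> w0 x; have h := sqr_dist_gt0 x w0; split.
  under eq_fun do rewrite Re_cinv_sub.
  rewrite ReN ReM !Re_cinv_sub !Im_cinv_sub.
  have h' := lt0r_neq0 h.
  apply: is_derive_eq; rewrite /GRing.scale /=.
  by field.
under eq_fun do rewrite Im_cinv_sub.
rewrite ImN ImM !Re_cinv_sub !Im_cinv_sub.
have h' := lt0r_neq0 h.
apply: is_derive_eq; rewrite /GRing.scale /=.
by field.
Qed.

Lemma cvgr_comp_linear (a b : R) : b < 0 ->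
  ((fun x => (x - a) / b) x @[x --> +oo] --> -oo) /\
  ((fun x => (x - a) / b) x @[x --> -oo] --> +oo).
Proof.
move=> b0; split.
  apply/cvgrNyPle => A; near=> x.
  rewrite ler_ndivrMr// lerBrDr.
  by near: x; apply: nbhs_pinfty_ge; rewrite num_real.
apply/cvgryPge => A; near=> x.
rewrite ler_ndivlMr// lerBlDr.
by near: x; apply: nbhs_ninfty_le; rewrite num_real.
Unshelve. all: by end_near. Qed.

Lemma is_derive_atan_sub (a b x : R) : b != 0 ->
  is_derive x 1 (fun t => atan ((t - a) / b)) (b / ((x - a) ^+ 2 + b ^+ 2)).
Proof.
move=> b0.
have h : (x - a) ^+ 2 + b ^+ 2 != 0.
  by rewrite gt_eqF// ltr_wpDl ?sqr_ge0// exprn_even_gt0.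
have h1 : 1 + ((x - a) / b) ^+ 2 != 0 by rewrite gt_eqF// ltr_pwDl// sqr_ge0.
have d : is_derive x 1 (fun t => (t - a) / b) b^-1.
  by apply: is_derive_eq; rewrite /GRing.scale /=; ring.
apply: (is_derive_eq (is_derive1_comp (is_derive1_atan _) d)).
by field; rewrite b0 h.
Qed.

Lemma cvg_atan_sub (a b : R) : b < 0 ->
  ((fun x => atan ((x - a) / b)) x @[x --> +oo] --> - (pi / 2)) /\
  ((fun x => atan ((x - a) / b)) x @[x --> -oo] --> pi / 2).
Proof.
move=> b0; have [h1 h2] := cvgr_comp_linear a b0; split.
  apply: cvg_comp h1 _.
  apply/cvgNy_compNP; rewrite (_ : _ \o _ = (fun x : R => - atan x)).
    by apply: cvgN; exact: cvgy_atan.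
  by apply/funext => x /=; rewrite atanN.
exact: cvg_comp h2 (@cvgy_atan R).
Qed.

(** The primitive is the logarithm of (x - w) / (x - w'), written through its modulus and
    argument; its modulus tends to 1, and the two arctangents have the same limits because
    both poles lie on the same side of the line. *)
Lemma null_primitive_inv_subB w w' : Im w < 0 -> Im w' < 0 ->
  null_primitive (fun x => cinv_sub w x - cinv_sub w' x).
Proof.
move=> w0 w0'.
have n0 : Im w != 0 by rewrite lt_eqF.
have n0' : Im w' != 0 by rewrite lt_eqF.
pose m z (x : R) : R := (x - Re z) ^+ 2 + Im z ^+ 2.
have dm z (x : R) : is_derive x 1 (m z) (2 * (x - Re z)).
  by rewrite /m; apply: is_derive_eq; rewrite /GRing.scale /=; ring.
pose L x : R := 2^-1 * ln (m w x / m w' x).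
have mgt z x : Im z != 0 -> 0 < m z x by move=> /sqr_dist_gt0; exact.
exists (fun x => (L x +i* (atan ((x - Re w) / Im w) - atan ((x - Re w') / Im w')))%C).
  move=> x; split.
    rewrite ReD ReN !Re_cinv_sub /=.
    have h := mgt w x n0; have h' := mgt w' x n0'.
    have hm := lt0r_neq0 h; have hm' := lt0r_neq0 h'.
    have dq : is_derive x 1 (fun t => m w t / m w' t)
        (2 * (x - Re w) / m w' x - m w x * (2 * (x - Re w')) / m w' x ^+ 2).
      have d1 := dm w x; have d2 := dm w' x.
      have d3 := is_deriveM d1 (is_deriveV hm' d2).
      apply: (is_derive_eq d3); rewrite /GRing.scale /=; by field.
    have dl := @is_derive1_comp _ (@ln R) (fun t => m w t / m w' t) x _ _ (is_derive1_ln (divr_gt0 h h')) dq.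
    have := is_deriveZ 2^-1 dl.
    move=> /is_derive_eq; apply; rewrite /GRing.scale /=.
    rewrite -/(m w x) -/(m w' x); field.
    by rewrite hm hm'.
  rewrite ImD ImN !Im_cinv_sub /=.
  have d1 := @is_derive_atan_sub (Re w) _ x n0.
  have d2 := @is_derive_atan_sub (Re w') _ x n0'.
  exact: is_deriveB d1 d2.
split; last first.
  have [a1 a2] := cvg_atan_sub (Re w) w0.
  have [b1 b2] := cvg_atan_sub (Re w') w0'.
  split; [rewrite -(subrr (- (pi / 2)))|rewrite -(subrr (pi / 2))]; exact: cvgB.
have V : vanishing (fun x => 2 * (Re w' - Re w) * Re (cinv_sub w' x) +
  ((Re w' - Re w) ^+ 2 + Im w ^+ 2 - Im w' ^+ 2) / Im w' * Im (cinv_sub w' x)).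
  have [v1 v2] := cvanishing_inv_sub n0'.
  by apply: vanishingD; exact: vanishingZ.
have E : (fun x => m w x / m w' x) = (fun x => 1 + (2 * (Re w' - Re w) * Re (cinv_sub w' x) +
  ((Re w' - Re w) ^+ 2 + Im w ^+ 2 - Im w' ^+ 2) / Im w' * Im (cinv_sub w' x))).
  apply/funext => x; rewrite Re_cinv_sub Im_cinv_sub /m.
  have hm' := lt0r_neq0 (mgt w' x n0'); rewrite /m in hm'.
  by field; rewrite n0' hm'.
have clim (P : set_system R) (FP : Filter P) : (m w x / m w' x) @[x --> P] --> (1 : R) -> L x @[x --> P] --> (0 : R).
  move=> h; rewrite -(mulr0 2^-1) -(ln1 R); apply: cvgM; first exact: cvg_cst.
  by apply: (cvg_comp _ _ h); exact: (continuous_ln ltr01).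
have [V1 V2] := V.
split; apply: clim; rewrite E -[X in _ --> X]addr0; apply: cvgD => //; exact: cvg_cst.
Qed.

Definition cinv_prod (ws : seq R[i]) (x : R) : R[i] := \prod_(w <- ws) cinv_sub w x.

(** The power is at least 2: the primitive is a multiple of a power of
    1 / (x - w) with exponent at least 1. *)
Lemma null_primitive_invX w n : Im w < 0 ->
  null_primitive (fun x => cinv_sub w x ^+ n.+2).
Proof.
move=> w0; have n0 : Im w != 0 by rewrite lt_eqF.
have d k : cderiv (fun x => cinv_sub w x ^+ k) (fun x => - (k%:R * cinv_sub w x ^+ k.+1)).
  elim: k => [|k IH].
    by under [X in cderiv _ X]eq_fun do rewrite mul0r oppr0; exact: cderiv_cst.
  have := cderivM (cderiv_inv_sub n0) IH.
  under eq_fun do rewrite -exprS.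
  congr cderiv; apply/funext => x.
  by rewrite -natr1 !exprS; ring.
have v k : cvanishing (fun x => cinv_sub w x ^+ k.+1).
  elim: k => [|k IH]; first exact: cvanishing_inv_sub.
  under eq_fun do rewrite exprS.
  by apply: cvanishingM => //; exact: cvanishing_inv_sub.
exists (fun x => - (n.+1%:R^-1) * cinv_sub w x ^+ n.+1); last exact: cvanishingZ.
have := cderivZ (- (n.+1%:R^-1)) (d n.+1).
by under [X in cderiv _ X -> _]eq_fun do rewrite mulrNN mulKf ?pnatr_eq0//.
Qed.

Lemma cinv_prod_cons w ws x : cinv_prod (w :: ws) x = cinv_sub w x * cinv_prod ws x.
Proof. by rewrite /cinv_prod big_cons. Qed.

Lemma real_sub_neq0 w (x : R) : Im w != 0 -> (x%:C)%C - w != 0.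
Proof.
apply: contra => /eqP /(congr1 (@complex.Im R)).
by rewrite ImD ImN /= add0r => /eqP; rewrite oppr_eq0.
Qed.

(** Partial fractions by induction on the number of factors: if two poles w, w'
    differ, 1 / ((x - w)(x - w')) = (1 / (x - w) - 1 / (x - w')) / (w - w') removes
    one factor; otherwise the function is a power. *)
Lemma null_primitive_inv_prod ws : (1 < size ws)%N -> (forall w, w \in ws -> Im w < 0) ->
  null_primitive (cinv_prod ws).
Proof.
have [n] := ubnP (size ws); elim: n ws => // n IH ws ltn sz neg.
case: ws sz ltn neg => [//|w ws] sz ltn neg.
have w0 : Im w < 0 by apply: neg; rewrite mem_head.
have [/all_pred1P E|] := boolP (all (pred1 w) ws).
  have -> : cinv_prod (w :: ws) = fun x => cinv_sub w x ^+ (size ws).+1.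
    apply/funext => x; rewrite /cinv_prod {1}E -[w :: _]/(nseq (size ws).+1 w).
    by rewrite big_nseq -Monoid.iteropE.
  by move: sz => /=; case: (size ws) => // k _; exact: null_primitive_invX.
move=> /allPn[w' w'ws /= ww'].
have w'0 : Im w' < 0 by apply: neg; rewrite inE w'ws orbT.
have nw : Im w != 0 by rewrite lt_eqF.
have nw' : Im w' != 0 by rewrite lt_eqF.
have pr := perm_to_rem w'ws.
set rest := rem w' ws in pr.
have E : cinv_prod (w :: ws) = fun x => (w - w')^-1 * (cinv_prod (w :: rest) x + (-1) * cinv_prod (w' :: rest) x).
  apply/funext => x; rewrite !cinv_prod_cons.
  have -> : cinv_prod ws x = cinv_sub w' x * cinv_prod rest x.
    by rewrite /cinv_prod (perm_big _ pr) big_cons.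
  have h := real_sub_neq0 x nw; have h' := real_sub_neq0 x nw'.
  have h2 : w - w' != 0 by rewrite subr_eq0 eq_sym.
  by rewrite /cinv_sub; field; rewrite h h' h2.
rewrite E; apply: null_primitiveZ.
have szws : size ws = (size rest).+1 by rewrite (perm_size pr).
case re: rest => [|r rest'].
  have := null_primitive_inv_subB w0 w'0.
  by congr null_primitive; apply/funext => x; rewrite /cinv_prod !big_seq1 mulN1r.
have mr z : z \in rest -> Im z < 0.
  by move=> zr; apply: neg; rewrite inE (perm_mem pr) inE zr !orbT.
rewrite -re; apply: null_primitiveD; last apply: null_primitiveZ; apply: IH.
- by move: ltn; rewrite /= szws.
- by rewrite /= re.
- by move=> z; rewrite inE => /orP[/eqP ->//|/mr].
- by move: ltn; rewrite /= szws.
- by rewrite /= re.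
- by move=> z; rewrite inE => /orP[/eqP ->//|/mr].
Qed.

(** Division of P by one linear factor at a time reduces to constant numerators;
    the hypothesis says that the quotient decays at least like x^-2. *)
Lemma null_primitive_div ws (P : {poly R[i]}) : (size P < size ws)%N ->
  (forall w, w \in ws -> Im w < 0) ->
  null_primitive (fun x => P.[(x%:C)%C] * cinv_prod ws x).
Proof.
elim: ws P => // w ws IH P; rewrite /= ltnS => szP neg.
have [ws0|ws0] := posnP (size ws).
  move: szP; rewrite ws0 leqn0 size_poly_eq0 => /eqP ->.
  by under eq_fun do rewrite horner0 mul0r; exact: null_primitive0.
have w0 : Im w < 0 by apply: neg; rewrite mem_head.
have nw : Im w != 0 by rewrite lt_eqF.
have [Q eQ] : exists Q, P - (P.[w])%:P = Q * ('X - w%:P).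
  by apply/factor_theorem; rewrite rootE !hornerE subrr.
have szQ : (size Q < size ws)%N.
  have [->|Q0] := eqVneq Q 0; first by rewrite size_poly0.
  have : (size (P - (P.[w])%:P)%R <= size ws)%N.
    rewrite (leq_trans (size_polyD _ _))// geq_max szP size_polyN.
    by rewrite (leq_trans (size_polyC_leq1 _)).
  by rewrite eQ size_Mmonic ?monicXsubC// size_XsubC addn2.
have -> : (fun x => P.[(x%:C)%C] * cinv_prod (w :: ws) x) =
   (fun x => P.[w] * cinv_prod (w :: ws) x + Q.[(x%:C)%C] * cinv_prod ws x).
  apply/funext => x; rewrite cinv_prod_cons.
  have -> : P.[(x%:C)%C] = P.[w] + Q.[(x%:C)%C] * ((x%:C)%C - w).
    rewrite -[P in LHS](subrK (P.[w])%:P) eQ.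
    by rewrite hornerD hornerC hornerM hornerXsubC addrC.
  rewrite /cinv_sub.
  have h := real_sub_neq0 x nw.
  by field.
apply: null_primitiveD; last first.
  by apply: IH => // z zws; apply: neg; rewrite inE zws orbT.
by apply/null_primitiveZ/null_primitive_inv_prod.
Qed.

(** Subtracting k / (x - w), with k the coefficient of 1 / x in the expansion at infinity,
    leaves a quotient covered by null_primitive_div; for real k the imaginary part of
    k / (x - w) has the primitive k atan ((x - Re w) / Im w). *)
Lemma Im_div_primitive ws (P : {poly R[i]}) : (size P <= size ws)%N ->
  (forall w, w \in ws -> Im w < 0) -> (0 < size ws)%N ->
  Im P`_(size ws).-1 = 0 ->
  exists V l m, [/\ forall x : R, is_derive x 1 V (Im (P.[(x%:C)%C] * cinv_prod ws x)),
     V x @[x --> +oo] --> l, V x @[x --> -oo] --> m &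
     l - m = - (pi * Re P`_(size ws).-1)].
Proof.
case: ws => // w ws szP neg _ /=; set k := P`__ => imk.
have w0 : Im w < 0 by apply: neg; rewrite mem_head.
have nw : Im w != 0 by rewrite lt_eqF.
pose Q := P - k *: \prod_(z <- ws) ('X - z%:P).
have szpr : size (\prod_(z <- ws) ('X - z%:P)) = (size ws).+1 by rewrite size_prod_XsubC.
have szQ : (size Q <= size ws)%N.
  apply/leq_sizeP => j; rewrite leq_eqVlt => /orP[/eqP <-|hj].
    rewrite coefB coefZ -/k.
    have /monicP : \prod_(z <- ws) ('X - z%:P) \is monic by rewrite monic_prod_XsubC.
    by rewrite lead_coefE szpr /= => ->; rewrite mulr1 subrr.
  rewrite coefB coefZ !nth_default ?mulr0 ?subr0//; first by rewrite szpr.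
  exact: leq_trans szP _.
have [F dF [_ [vF1 vF2]]] := @null_primitive_div (w :: ws) Q szQ neg.
have [a1 a2] := cvg_atan_sub (Re w) w0.
exists (fun x => Im (F x) + Re k * atan ((x - Re w) / Im w)), (0 + Re k * - (pi / 2)), (0 + Re k * (pi / 2)).
split.
- move=> x; have [_ d] := dF x.
  have d' := @is_derive_atan_sub (Re w) _ x nw.
  apply: is_derive_eq.
  have -> : P = Q + k *: \prod_(z <- ws) ('X - z%:P) by rewrite subrK.
  rewrite hornerD mulrDl ImD; congr (_ + _).
  rewrite hornerZ -Im_cinv_sub.
  have -> : k * (\prod_(z <- ws) ('X - z%:P)).[(x%:C)%C] * cinv_prod (w :: ws) x = k * cinv_sub w x.
    rewrite cinv_prod_cons horner_prod /cinv_prod.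
    rewrite mulrCA !mulrA -mulrA -big_split /= big1_seq ?mulr1 1?mulrC// => z /= zws.
    rewrite hornerXsubC /cinv_sub divff// real_sub_neq0// lt_eqF// neg// inE zws orbT//.
  by rewrite ImM imk mul0r addr0.
- by apply: cvgD => //; apply: cvgM => //; exact: cvg_cst.
- by apply: cvgD => //; apply: cvgM => //; exact: cvg_cst.
- by lra.
Qed.

End ComplexPrimitive.

Arguments jacobi_poly : simpl never.

(** * Recurrence, Green identity and Christoffel sums *)

Section JacobiRecurrence.
Variables (R : realType) (a b : nat -> R).
Hypothesis ha : forall n, 0 < a n.
Local Notation Re := complex.Re.
Local Notation Im := complex.Im.
Local Notation p := (jacobi_poly a b).
Let a0 n : a n != 0. Proof. by rewrite gt_eqF. Qed.

Lemma jacobi_poly0 : p 0 = 1. Proof. by []. Qed.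

Lemma jacobi_poly1 : a 0%N *: p 1 = 'X - (b 0%N)%:P.
Proof. by rewrite /jacobi_poly scalerA divff// scale1r. Qed.

Lemma jacobi_polySS n : a n.+1 *: p n.+2 = ('X - (b n.+1)%:P) * p n.+1 - a n *: p n.
Proof. by rewrite {1}/jacobi_poly -/jacobi_poly scalerA divff// scale1r. Qed.

Lemma size_lead_jacobi_poly n : size (p n) = n.+1 /\ 0 < lead_coef (p n) /\
  lead_coef (p n) = a n * lead_coef (p n.+1).
Proof.
suff H m : (size (p m) = m.+1 /\ 0 < lead_coef (p m)) /\
  (size (p m.+1) = m.+2 /\ lead_coef (p m) = a m * lead_coef (p m.+1)).
  by have [[? ?] [? ?]] := H n.
elim: m => [|m [[s0 l0] [s1 l1]]].
  have E : 'X - (b 0%N)%:P = a 0%N *: p 1 by rewrite jacobi_poly1.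
  rewrite jacobi_poly0 size_poly1 lead_coef1 -(size_scale (p 1) (a0 0)) -lead_coefZ -E.
  by rewrite size_XsubC lead_coefXsubC.
have l1p : 0 < lead_coef (p m.+1) by move: l0; rewrite l1 pmulr_rgt0.
do 2 split => //.
  rewrite -(size_scale _ (a0 m.+1)) jacobi_polySS.
  have sM : size (('X - (b m.+1)%:P) * p m.+1) = m.+3.
    by rewrite size_monicM ?monicXsubC// -?size_poly_eq0 ?s1// size_XsubC.
  by rewrite size_polyDl sM// size_polyN size_scale ?s0// ltnS leqW.
have sM : size (('X - (b m.+1)%:P) * p m.+1) = m.+3.
  by rewrite size_monicM ?monicXsubC// -?size_poly_eq0 ?s1// size_XsubC.
rewrite -lead_coefZ jacobi_polySS lead_coefDl; last first.
  by rewrite size_polyN sM size_scale// s0 ltnS leqW.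
by rewrite lead_coef_monicM// monicXsubC.
Qed.

Lemma size_jacobi_poly n : size (p n) = n.+1.
Proof. by have [] := size_lead_jacobi_poly n. Qed.
Lemma lead_jacobi_poly_gt0 n : 0 < lead_coef (p n).
Proof. by have [_ []] := size_lead_jacobi_poly n. Qed.
Lemma lead_jacobi_polyS n : lead_coef (p n) = a n * lead_coef (p n.+1).
Proof. by have [_ []] := size_lead_jacobi_poly n. Qed.

Definition cjacobi n (z : R[i]) : R[i] := (map_poly (real_complex R) (p n)).[z].

Lemma cjacobi_real n (x : R) : cjacobi n (x%:C)%C = ((p n).[x]%:C)%C.
Proof. by rewrite /cjacobi horner_map. Qed.

Lemma cjacobi0 z : cjacobi 0 z = 1.
Proof. by rewrite /cjacobi rmorph1 hornerC. Qed.

Lemma cjacobi1 z : ((a 0%N)%:C)%C * cjacobi 1 z = z - ((b 0%N)%:C)%C.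
Proof.
rewrite /cjacobi -hornerZ -map_polyZ jacobi_poly1.
by rewrite rmorphB /= map_polyX map_polyC hornerXsubC.
Qed.

Lemma cjacobiSS n z : ((a n.+1)%:C)%C * cjacobi n.+2 z =
  (z - ((b n.+1)%:C)%C) * cjacobi n.+1 z - ((a n)%:C)%C * cjacobi n z.
Proof.
rewrite /cjacobi -hornerZ -map_polyZ jacobi_polySS.
rewrite rmorphB rmorphM rmorphB /= map_polyX map_polyC map_polyZ.
by rewrite hornerD hornerN hornerM hornerXsubC hornerZ.
Qed.

Lemma cjacobi_consecutive n z : cjacobi n z = 0 -> cjacobi n.+1 z = 0 -> False.
Proof.
elim: n => [|n IH].
  by rewrite cjacobi0 => /eqP; rewrite oner_eq0.
move=> e1 e2; apply: IH => //.
have := cjacobiSS n z; rewrite e1 e2 !mulr0 sub0r => /esym/eqP.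
rewrite oppr_eq0 mulf_eq0 => /orP[|/eqP//].
by rewrite eq_complex /= (negbTE (a0 n)).
Qed.

Lemma jacobi_consecutive n (x : R) : (p n).[x] = 0 -> (p n.+1).[x] = 0 -> False.
Proof.
by move=> e1 e2; apply: (@cjacobi_consecutive n (x%:C)%C); rewrite cjacobi_real ?e1 ?e2.
Qed.

Definition sqnorm (z : R[i]) : R := Re z ^+ 2 + Im z ^+ 2.

Lemma sqnorm_ge0 z : 0 <= sqnorm z. Proof. by rewrite addr_ge0 ?sqr_ge0. Qed.

Definition cchristoffel n z : R := \sum_(k < n) sqnorm (cjacobi k z).

Lemma cchristoffelS n z : cchristoffel n.+1 z = cchristoffel n z + sqnorm (cjacobi n z).
Proof. by rewrite /cchristoffel big_ord_recr. Qed.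

Lemma cchristoffel_ge1 n z : 1 <= cchristoffel n.+1 z.
Proof.
rewrite /cchristoffel big_ord_recl /= cjacobi0 /sqnorm /= expr1n expr0n addr0 lerDl.
by apply: sumr_ge0 => i _; exact: sqnorm_ge0.
Qed.

(** Green's identity. The Wronskian of p_n and its conjugate at z telescopes along
    the recurrence. *)
Lemma cjacobi_green n z :
  a n * (Im (cjacobi n.+1 z) * Re (cjacobi n z) - Re (cjacobi n.+1 z) * Im (cjacobi n z)) =
  Im z * cchristoffel n.+1 z.
Proof.
elim: n => [|n IH].
  have := cjacobi1 z; rewrite cjacobi0 /cchristoffel big_ord1 cjacobi0 /sqnorm.
  case: (cjacobi 1 z) => u v; case: z => x y /= [e1 e2].
  by rewrite mulr0 mulr1 subr0 expr1n expr0n addr0 mulr1; move: e2; rewrite mul0r !addr0 subr0.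
rewrite cchristoffelS [RHS]mulrDr -IH /sqnorm.
have := cjacobiSS n z.
case: (cjacobi n.+2 z) => u2 v2; case: (cjacobi n.+1 z) => u1 v1; case: (cjacobi n z) => u v.
case: z {IH} => x y /= [e1 e2].
rewrite mulrBr !mulrA.
have -> : a n.+1 * v2 = (x - b n.+1) * v1 + y * u1 - a n * v.
  by move: e2; rewrite !mul0r !addr0 oppr0 addr0; lra.
have -> : a n.+1 * u2 = (x - b n.+1) * u1 - y * v1 - a n * u.
  by move: e1; rewrite !mul0r !subr0; lra.
ring.
Qed.

(** By Green's identity a_k |p_k(z)| |p_(k+1)(z)| >= Im z for every k, as the Christoffel
    sum is at least 1; the arithmetic-geometric inequality and summation give the
    bound. It makes Carleman's condition effective off the real line. *)
Lemma cchristoffel_lower n z : 0 < Im z ->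
  \sum_(k < n) Im z / a k <= cchristoffel n.+1 z.
Proof.
move=> z0.
have step k : Im z / a k <= 2^-1 * (sqnorm (cjacobi k z) + sqnorm (cjacobi k.+1 z)).
  have g := cjacobi_green k z.
  have g1 : Im z <= Im z * cchristoffel k.+1 z by apply: ler_peMr; [exact: ltW|exact: cchristoffel_ge1].
  rewrite ler_pdivrMr ?ha// mulrC; apply: le_trans g1 _; rewrite -g ler_pM2l ?ha// /sqnorm.
  case: (cjacobi k z) => u v; case: (cjacobi k.+1 z) => u' v' /=.
  have := sqr_ge0 (v' - u); have := sqr_ge0 (u' + v); lra.
have H : \sum_(k < n) Im z / a k <= 2^-1 * (cchristoffel n z + cchristoffel n.+1 z).
  elim: n => [|n IH].
    by rewrite big_ord0 mulr_ge0 ?invr_ge0// addr_ge0// sumr_ge0// => i _; exact: sqnorm_ge0.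
  rewrite big_ord_recr /=; have := step n; move: IH; rewrite !cchristoffelS; lra.
apply: le_trans H _; rewrite cchristoffelS; have := sqnorm_ge0 (cjacobi n z); lra.
Qed.

(** At a zero w, Green's identity reads
    Im w * (Christoffel sum) = - a_n Im tau |p_n(w)|^2. *)
Lemma root_boundary_poly n (tau w : R[i]) : 0 < Im tau ->
  cjacobi n.+1 w + tau * cjacobi n w = 0 -> Im w < 0.
Proof.
move=> t0 /eqP; rewrite addr_eq0 => /eqP e.
have g := cjacobi_green n w; have T1 := cchristoffel_ge1 n w.
have g' : Im w * cchristoffel n.+1 w = - (a n * Im tau * sqnorm (cjacobi n w)).
  rewrite -g e /sqnorm ReN ImN ReM ImM; ring.
rewrite ltNge; apply/negP => w0.
have s0 := sqnorm_ge0 (cjacobi n w).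
have : sqnorm (cjacobi n w) <= 0.
  have aI : 0 < a n * Im tau by rewrite mulr_gt0.
  rewrite -(pmulr_rle0 _ aI) -oppr_ge0 -g' mulr_ge0//; lra.
move=> s1; have {s0 s1} /eqP : sqnorm (cjacobi n w) = 0 by lra.
rewrite /sqnorm paddr_eq0 ?sqr_ge0// !sqrf_eq0 => /andP[/eqP r0 /eqP i0].
have c0 : cjacobi n w = 0 by exact: complex_ext.
by apply: (@cjacobi_consecutive n w) => //; rewrite e c0 mulr0 oppr0.
Qed.

End JacobiRecurrence.

(** * Densities given by a complex boundary condition *)

Section PolyBound.
Variable R : realType.

Lemma continuous_horner (P : {poly R}) : continuous (horner P).
Proof.
move=> x; apply: differentiable_continuous; apply/derivable1_diffP.
exact: derivable_horner.
Qed.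

Local Notation Re := complex.Re.
Local Notation Im := complex.Im.

Lemma ler_normX_oneDsqr (x : R) k n : (k <= n.*2)%N -> `|x| ^+ k <= (1 + x ^+ 2) ^+ n.
Proof.
move=> kn; have o1 : 1 <= 1 + x ^+ 2 by rewrite lerDl sqr_ge0.
pose s := Num.sqrt (1 + x ^+ 2).
have s1 : 1 <= s by rewrite -sqrtr1 ler_wsqrtr.
have xs : `|x| <= s by rewrite -sqrtr_sqr ler_wsqrtr// lerDr.
have -> : (1 + x ^+ 2) ^+ n = s ^+ n.*2.
  by rewrite -mul2n exprM sqr_sqrtr// (le_trans ler01).
apply: (@le_trans _ _ (s ^+ k)); last exact: ler_weXn2l.
by rewrite lerXn2r ?nnegrE// (le_trans ler01).
Qed.

Lemma poly_bound (P : {poly R}) n : (size P <= n.*2.+1)%N ->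
  exists2 C, 0 <= C & forall x, `|P.[x]| <= C * (1 + x ^+ 2) ^+ n.
Proof.
move=> sP; exists (\sum_(i < size P) `|P`_i|); first by apply: sumr_ge0.
move=> x; rewrite horner_coef (le_trans (ler_norm_sum _ _ _))// mulr_suml.
apply: ler_sum => i _; rewrite normrM normrX ler_wpM2l// ler_normX_oneDsqr//.
by rewrite -ltnS (leq_trans (ltn_ord i)).
Qed.

(** The constant comes from x^2 <= 2 (x - Re w)^2 + 2 (Re w)^2. *)
Lemma sqr_dist_lower (w : R[i]) : Im w != 0 ->
  exists2 K : R, 0 < K & forall x : R, 1 + x ^+ 2 <= K * sqnorm ((x%:C)%C - w).
Proof.
move=> w0; have i2 : 0 < Im w ^+ 2 by rewrite exprn_even_gt0.
have c0 : 0 < (1 + 2 * Re w ^+ 2) / Im w ^+ 2.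
  by rewrite divr_gt0// ltr_pwDl// mulr_ge0// sqr_ge0.
exists (2 + (1 + 2 * Re w ^+ 2) / Im w ^+ 2); first lra.
move=> x; rewrite /sqnorm ReD ImD ReN ImN /= add0r sqrrN.
have e : (1 + 2 * Re w ^+ 2) / Im w ^+ 2 * Im w ^+ 2 = 1 + 2 * Re w ^+ 2.
  by rewrite divfK// gt_eqF.
have p1 : 0 <= (1 + 2 * Re w ^+ 2) / Im w ^+ 2 * (x - Re w) ^+ 2 by rewrite mulr_ge0 ?sqr_ge0 ?ltW.
rewrite mulrDl !mulrDr e.
have := sqr_ge0 (x - 2 * Re w); lra.
Qed.

Lemma sqnormM (z w : R[i]) : sqnorm (z * w) = sqnorm z * sqnorm w.
Proof. by rewrite /sqnorm ReM ImM; ring. Qed.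

Lemma prod_dist_lower (ws : seq R[i]) : (forall w, w \in ws -> Im w < 0) ->
  exists2 K : R, 0 < K & forall x : R, (1 + x ^+ 2) ^+ (size ws) <=
     K * sqnorm (\prod_(w <- ws) ((x%:C)%C - w)).
Proof.
elim: ws => [|w ws IH] neg.
  exists 1 => // x; rewrite big_nil /sqnorm /= expr1n expr0n addr0 mulr1.
  by [].
have [K K0 hK] := IH (fun z zw => neg z (mem_behead (s := w :: ws) zw)).
have nw : Im w != 0 by rewrite lt_eqF// neg// mem_head.
have [L L0 hL] := sqr_dist_lower nw.
exists (L * K); first by rewrite mulr_gt0.
move=> x; rewrite big_cons sqnormM [size _]/= exprS mulrACA.
apply: ler_pM; rewrite ?exprn_ge0 ?addr_ge0 ?sqr_ge0//.
Qed.

End PolyBound.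

Section BoundaryDensity.
Variables (R : realType) (a b : nat -> R).
Hypothesis ha : forall n, 0 < a n.
Variables (n : nat) (tau : R[i]).
Hypothesis tau0 : 0 < complex.Im tau.
Local Notation Re := complex.Re.
Local Notation Im := complex.Im.
Local Notation p := (jacobi_poly a b).

(** |p_(n+1) + tau p_n|^2 on the real line. *)
Definition boundary_sq (x : R) : R :=
  ((p n.+1).[x] + Re tau * (p n).[x]) ^+ 2 + (Im tau * (p n).[x]) ^+ 2.

(** The density of the spectral measure of the Jacobi matrix cut after p_n and closed
    by a constant complex boundary condition (a Bernstein-Szego density). *)
Definition boundary_density (x : R) : R := Im tau / (pi * a n * boundary_sq x).

Definition cboundary : {poly R[i]} :=
  map_poly (real_complex R) (p n.+1) + tau *: map_poly (real_complex R) (p n).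

Lemma size_cboundary : size cboundary = n.+2.
Proof.
rewrite /cboundary size_polyDl !size_map_poly size_jacobi_poly//.
by rewrite (leq_ltn_trans (size_scale_leq _ _))// size_map_poly size_jacobi_poly.
Qed.

Lemma lead_cboundary : lead_coef cboundary = ((lead_coef (p n.+1))%:C)%C.
Proof.
rewrite /cboundary lead_coefDl ?lead_coef_map// size_map_poly size_jacobi_poly//.
by rewrite (leq_ltn_trans (size_scale_leq _ _))// size_map_poly size_jacobi_poly.
Qed.

Lemma cboundary_factor : exists ws : seq R[i], [/\ size ws = n.+1,
   forall w, w \in ws -> Im w < 0 &
   forall x, ((p n.+1).[x]%:C)%C + tau * ((p n).[x]%:C)%C =
     ((lead_coef (p n.+1))%:C)%C * \prod_(w <- ws) ((x%:C)%C - w)].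
Proof.
have [ws E] := closed_field_poly_normal cboundary.
have l0 : lead_coef cboundary != 0 by rewrite lead_coef_eq0 -size_poly_eq0 size_cboundary.
have sz : size ws = n.+1.
  by have := size_cboundary; rewrite {1}E size_scale// size_prod_XsubC => -[].
exists ws; split => //.
  move=> w wws; apply: (@root_boundary_poly _ a b ha n tau) => //.
  have : root cboundary w by rewrite E rootZ// root_prod_XsubC.
  by rewrite rootE /cboundary hornerD hornerZ => /eqP.
move=> x; transitivity (cboundary.[(x%:C)%C]).
  by rewrite /cboundary hornerD hornerZ !horner_map.
rewrite {1}E hornerZ lead_cboundary horner_prod; congr (_ * _).
by apply: eq_bigr => w _; rewrite hornerXsubC.
Qed.

Lemma cboundary_quotient (P : {poly R}) (x : R) ws :
  (forall x, ((p n.+1).[x]%:C)%C + tau * ((p n).[x]%:C)%C =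
     ((lead_coef (p n.+1))%:C)%C * \prod_(w <- ws) ((x%:C)%C - w)) ->
  (map_poly (real_complex R) P).[(x%:C)%C] * cinv_prod ws x =
    ((lead_coef (p n.+1) * P.[x])%:C)%C * (((p n.+1).[x]%:C)%C + tau * ((p n).[x]%:C)%C)^-1.
Proof.
move=> ->; rewrite horner_map invfM rmorphM /=.
have l0' : ((lead_coef (p n.+1))%:C)%C != 0 by rewrite eq_complex /= gt_eqF// lead_jacobi_poly_gt0.
have -> : cinv_prod ws x = (\prod_(w <- ws) ((x%:C)%C - w))^-1 by rewrite /cinv_prod prodfV.
by rewrite [((lead_coef _)%:C)%C * _]mulrC -mulrA mulVKf.
Qed.

Lemma boundary_sqE x : boundary_sq x = sqnorm (((p n.+1).[x]%:C)%C + tau * ((p n).[x]%:C)%C).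
Proof. by rewrite /boundary_sq /sqnorm ReD ImD ReM ImM /= mulr0 mulr0 subr0 add0r add0r. Qed.

Lemma boundary_sq_gt0 x : 0 < boundary_sq x.
Proof.
have h1 := sqr_ge0 ((p n.+1).[x] + Re tau * (p n).[x]); have h2 := sqr_ge0 (Im tau * (p n).[x]).
rewrite lt_neqAle addr_ge0// andbT eq_sym paddr_eq0// !sqrf_eq0 mulf_eq0 (gt_eqF tau0)/=.
apply/negP => /andP[/eqP e1 /eqP e2]; apply: (@jacobi_consecutive _ a b ha n x) => //.
by move: e1; rewrite e2 mulr0 addr0.
Qed.

Lemma boundary_density_gt0 x : 0 < boundary_density x.
Proof. by rewrite divr_gt0// !mulr_gt0 ?pi_gt0 ?boundary_sq_gt0. Qed.

Lemma boundary_sq_horner : boundary_sq = horner ((p n.+1 + Re tau *: p n) ^+ 2 + (Im tau *: p n) ^+ 2).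
Proof. by apply/funext => x; rewrite /boundary_sq !hornerE. Qed.

Lemma continuous_boundary_density : continuous boundary_density.
Proof.
move=> x; apply: cvgM; first exact: cvg_cst.
apply: cvgV; first by rewrite gt_eqF// !mulr_gt0 ?pi_gt0 ?boundary_sq_gt0.
by apply: cvgM; [exact: cvg_cst|rewrite boundary_sq_horner; exact: continuous_horner].
Qed.

Lemma boundary_density_bound (P : {poly R}) : (size P <= n.*2.+1)%N ->
  exists C, forall x, `|P.[x] * boundary_density x| <= C / (1 + x ^+ 2).
Proof.
move=> sP; have [C C0 hC] := poly_bound sP.
have [ws [sws nws fws]] := cboundary_factor.
have [K K0 hK] := prod_dist_lower nws.
have l0 := lead_jacobi_poly_gt0 b ha n.+1.
set l := lead_coef (p n.+1) in l0 fws.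
have bE x : boundary_sq x = l ^+ 2 * sqnorm (\prod_(w <- ws) ((x%:C)%C - w)).
  by rewrite boundary_sqE fws sqnormM /sqnorm /= expr0n /= addr0.
have pa : 0 < pi * a n by rewrite mulr_gt0// pi_gt0.
exists (C * (Im tau / (pi * a n)) * (K / l ^+ 2)) => x.
have o1 : 0 < 1 + x ^+ 2 by rewrite ltr_pwDl// sqr_ge0.
have bx := boundary_sq_gt0 x.
rewrite normrM (gtr0_norm (boundary_density_gt0 x)) /boundary_density.
rewrite ler_pdivlMr// mulrAC invfM [X in _ * X <= _]mulrA !mulrA ler_pdivrMr//.
have h1 : (1 + x ^+ 2) ^+ n.+1 <= K / l ^+ 2 * boundary_sq x.
  rewrite bE mulrA divfK ?gt_eqF ?exprn_gt0// -sws; exact: hK.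
have h2 := hC x.
have t0 : 0 < Im tau / (pi * a n) by rewrite divr_gt0.
rewrite mulrAC -!mulrA [Im tau * _]mulrA [leRHS]mulrCA.
rewrite [X in X <= _](_ : _ = Im tau / (pi * a n) * (`|P.[x]| * (1 + x ^+ 2))); last by rewrite invfM; ring.
rewrite [X in _ <= X](_ : _ = Im tau / (pi * a n) * (C * (K / l ^+ 2 * boundary_sq x))); last by rewrite !invfM; ring.
rewrite ler_pM2l//; apply: (@le_trans _ _ (C * (1 + x ^+ 2) ^+ n * (1 + x ^+ 2))).
  by rewrite ler_pM2r.
by rewrite -mulrA -exprSr ler_wpM2l.
Qed.

(** On the real line, P p_n / |D|^2 = - Im (P / D) / Im tau with D = p_(n+1) + tau p_n,
    as P, p_n and p_(n+1) are real; only the leading term of P / D contributes to the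
    increment of the primitive. *)
Lemma boundary_top_primitive (P : {poly R}) : (size P <= n.+1)%N ->
  exists V l m, [/\ forall x : R, is_derive x 1 V ((P * p n).[x] * boundary_density x),
     V x @[x --> +oo] --> l, V x @[x --> -oo] --> m & l - m = P`_n / lead_coef (p n)].
Proof.
move=> sP; have [ws [sws nws fws]] := cboundary_factor.
have l0 := lead_jacobi_poly_gt0 b ha n.+1.
have lS := lead_jacobi_polyS b ha n.
set l := lead_coef (p n.+1) in l0 fws lS.
pose Q := map_poly (real_complex R) P.
have sQ : (size Q <= size ws)%N by rewrite size_map_poly sws.
have [||V [L [M [dV VL VM LM]]]] := @Im_div_primitive _ ws Q sQ nws; first by rewrite sws.
  by rewrite /Q coef_map /=.
pose c := - (pi * a n * l)^-1.
exists (fun x => c * V x), (c * L), (c * M); split.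
- move=> x; have := is_deriveZ c (dV x).
  move=> /is_derive_eq; apply; rewrite /GRing.scale /=.
  have bx := lt0r_neq0 (boundary_sq_gt0 x).
  have E := cboundary_quotient P x fws.
  rewrite E -/l ImM /= mul0r addr0 ImV -/(sqnorm _) -boundary_sqE.
  rewrite ImD ImM /= mulr0 add0r add0r hornerM /boundary_density /c.
  move: (lt0r_neq0 (pi_gt0 R)); move: (@pi R) => q q0.
  by field; rewrite bx q0 (lt0r_neq0 (ha n)) (lt0r_neq0 l0).
- by apply: cvgM => //; exact: cvg_cst.
- by apply: cvgM => //; exact: cvg_cst.
- rewrite -mulrBr LM sws /= coef_map /= lS /c.
  move: (lt0r_neq0 (pi_gt0 R)); move: (@pi R) => q q0.
  by field; rewrite q0 (lt0r_neq0 (ha n)) (lt0r_neq0 l0).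
Qed.

(** Here P p_(n+1) / |D|^2 = Re (P / D) - Re tau * P p_n / |D|^2, and both terms have
    primitives with equal limits at the two ends. *)
Lemma boundary_next_primitive (P : {poly R}) : (size P <= n)%N ->
  exists (V : R -> R) (l : R), [/\ forall x : R, is_derive x 1 V ((P * p n.+1).[x] * boundary_density x),
     V x @[x --> +oo] --> l & V x @[x --> -oo] --> l].
Proof.
move=> sP; have [ws [sws nws fws]] := cboundary_factor.
have l0 := lead_jacobi_poly_gt0 b ha n.+1.
set l := lead_coef (p n.+1) in l0 fws.
pose Q := map_poly (real_complex R) P.
have sQ : (size Q < size ws)%N by rewrite size_map_poly sws.
have [F dF [[F1 F2] _]] := @null_primitive_div _ ws Q sQ nws.
have [V [L [M [dV VL VM LM]]]] := @boundary_top_primitive P (leqW sP).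
have {}LM : M = L.
  by apply/esym/eqP; rewrite -subr_eq0 LM nth_default// mul0r.
rewrite LM in VM.
pose c := Im tau / (pi * a n * l).
exists (fun x => c * Re (F x) - Re tau * V x), (c * 0 - Re tau * L); split.
- move=> x; have [d1 _] := dF x; have d2 := dV x.
  apply: is_derive_eq; rewrite /GRing.scale /=.
  have bx := lt0r_neq0 (boundary_sq_gt0 x).
  have E := cboundary_quotient P x fws.
  rewrite E -/l ReM /= mul0r subr0 ReV -/(sqnorm _) -boundary_sqE.
  rewrite ReD ReM /= mulr0 subr0 !hornerM /boundary_density /c.
  move: (lt0r_neq0 (pi_gt0 R)); move: (@pi R) => q q0.
  by field; rewrite bx q0 (lt0r_neq0 (ha n)) (lt0r_neq0 l0).
- by apply: cvgB; apply: cvgM => //; exact: cvg_cst.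
- by apply: cvgB; apply: cvgM => //; exact: cvg_cst.
Qed.

End BoundaryDensity.

(** * Orthonormality with respect to the boundary densities *)

Section Orthonormality.
Variables (R : realType) (a b : nat -> R).
Hypothesis ha : forall n, 0 < a n.
Local Notation p := (jacobi_poly a b).

(** A functional on polynomials of degree at most 2n which behaves correctly against
    p_n and p_(n+1) behaves correctly against every p_k, k <= n: the recurrence
    expresses a_k p_k by p_(k+1) and p_(k+2), so orthogonality descends. *)
Lemma orthonormal_downward (I : {poly R} -> R) n :
  (forall P Q : {poly R}, (size P <= n.*2.+1)%N -> (size Q <= n.*2.+1)%N -> I (P + Q) = I P + I Q) ->
  (forall c (P : {poly R}), (size P <= n.*2.+1)%N -> I (c *: P) = c * I P) ->
  (forall P : {poly R}, (size P <= n.+1)%N -> I (P * p n) = P`_n / lead_coef (p n)) ->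
  (forall P : {poly R}, (size P <= n)%N -> I (P * p n.+1) = 0) ->
  forall k, (k <= n)%N ->
    (forall P : {poly R}, (size P <= k)%N -> I (P * p k) = 0) /\ I (p k * p k) = 1.
Proof.
move=> ID IZ top next.
have szM (P Q : {poly R}) i j : (size P <= i)%N -> (size Q <= j.+1)%N -> (i + j <= n.*2.+1)%N ->
    (size (P * Q)%R <= n.*2.+1)%N.
  move=> h1 h2 h3; rewrite (leq_trans (size_polyMleq _ _))//.
  rewrite (leq_trans _ h3)//.
  by move: (leq_add h1 h2); rewrite addnS; case: (size P + size Q)%N.
suff H d k : (d + k = n)%N -> [/\ forall P : {poly R}, (size P <= k)%N -> I (P * p k) = 0,
   forall P : {poly R}, (size P <= k)%N -> I (P * p k.+1) = 0 & I (p k * p k) = 1].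
  by move=> k kn; have [|h1 _ h2] := H (n - k)%N k; rewrite ?subnK.
elim: d k => [k|d IH k dk].
  rewrite add0n => ->; split => //.
    by move=> P sP; rewrite top ?(leq_trans sP)// nth_default// mul0r.
  rewrite top ?size_jacobi_poly// lead_coefE size_jacobi_poly// divff//.
  have := lt0r_neq0 (lead_jacobi_poly_gt0 b ha n).
  by rewrite lead_coefE size_jacobi_poly.
have [|h1 h2 h3] := IH k.+1; first by rewrite addnS -addSn.
have kn : (k < n)%N by rewrite -dk addSn ltnS leq_addl.
have kn2 : (k.+1 + k.+1 <= n.*2)%N by rewrite -addnn leq_add.
have ak := ha k; have ak0 := lt0r_neq0 ak.
have E (P : {poly R}) : a k *: (P * p k) = P * ('X - (b k.+1)%:P) * p k.+1 + (- a k.+1) *: (P * p k.+2).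
  rewrite scalerAr -mulrA scaleNr scalerAr -mulrBr; congr (_ * _).
  by rewrite jacobi_polySS// opprB addrCA subrr addr0.
have sX (P : {poly R}) : (size P <= k.+1)%N -> (size (P * ('X - (b k.+1)%:P))%R <= k.+2)%N.
  by move=> sP; rewrite (leq_trans (size_polyMleq _ _))// size_XsubC addn2.
have key (P : {poly R}) : (size P <= k.+1)%N -> a k * I (P * p k) =
    I (P * ('X - (b k.+1)%:P) * p k.+1).
  move=> sP; rewrite -IZ; last first.
    by apply: (szM _ _ k.+1 k) => //; rewrite ?size_jacobi_poly// addSn ltnS (leq_trans _ kn2)// leq_add// leqW.
  rewrite E ID; last 2 first.
  - by apply: (szM _ _ k.+2 k.+1); rewrite ?sX ?size_jacobi_poly//.
  - rewrite (leq_trans (size_scale_leq _ _))//.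
    apply: (szM _ _ k.+1 k.+2); rewrite ?size_jacobi_poly//.
    by rewrite addnS ltnS.
  rewrite IZ; last first.
    apply: (szM _ _ k.+1 k.+2); rewrite ?size_jacobi_poly//.
    by rewrite addnS ltnS.
  by rewrite h2// mulr0 addr0.
split.
- move=> P sP; apply: (mulfI ak0); rewrite mulr0 key ?leqW// h1//.
  by rewrite (leq_trans (size_polyMleq _ _))// size_XsubC addn2.
- by move=> P sP; apply: h1; exact: leqW.
apply: (mulfI ak0); rewrite mulr1 key ?size_jacobi_poly//.
pose T := (b k - b k.+1) *: p k + (if k is m.+1 then a m *: p m else 0).
have -> : p k * ('X - (b k.+1)%:P) = a k *: p k.+1 + T.
  rewrite /T; case: (k) => [|m].
    rewrite jacobi_poly1// jacobi_poly0 mul1r addr0 alg_polyC polyCB.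
    ring.
  rewrite jacobi_polySS// scalerBl -!mul_polyC mulrC !mulrBl.
  ring.
have sT : (size T <= k.+1)%N.
  rewrite (leq_trans (size_polyD _ _))// geq_max.
  rewrite (leq_trans (size_scale_leq _ _)) ?size_jacobi_poly//=.
  case: (k) => [|m]; first by rewrite size_poly0.
  by rewrite (leq_trans (size_scale_leq _ _))// size_jacobi_poly.
have sp1 : (size (p k.+1 * p k.+1)%R <= n.*2.+1)%N.
  by apply: (szM _ _ k.+2 k.+1); rewrite ?size_jacobi_poly.
rewrite mulrDl ID; last 2 first.
- by rewrite -scalerAl (leq_trans (size_scale_leq _ _)).
- apply: (szM _ _ k.+1 k.+1); rewrite ?size_jacobi_poly//.
  exact: leqW.
by rewrite -scalerAl IZ// h3 h1// mulr1 addr0.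
Qed.

Let Leb := @lebesgue_measure R.

(** The measure and the weight are separate, so that the same statements cover mu
    with weight 1 and Lebesgue measure with a boundary density. *)
Definition weighted_orthonormal (m : {measure set (measurableTypeR R) -> \bar R})
    (rho : R -> R) n := forall j k, (j <= n)%N -> (k <= n)%N ->
  m.-integrable setT (EFin \o (fun x => (p j).[x] * (p k).[x] * rho x)) /\
  (\int[m]_x ((p j).[x] * (p k).[x] * rho x)%:E = ((j == k)%:R : R)%:E)%E.

Lemma boundary_density_orthonormal n tau : 0 < complex.Im tau ->
  weighted_orthonormal Leb (boundary_density a b n tau) n.
Proof.
move=> tau0; pose rho := boundary_density a b n tau.
have int (P : {poly R}) : (size P <= n.*2.+1)%N ->
    Leb.-integrable setT (EFin \o (fun x => P.[x] * rho x)).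
  move=> sP; have [C hC] := boundary_density_bound b ha tau0 sP.
  apply: (@integrable_decay _ _ C) => // x.
  apply: cvgM; first exact: continuous_horner.
  exact: continuous_boundary_density.
have sz (P : {poly R}) i k : (size P <= i)%N -> (i + k <= n.*2.+1)%N -> (size (P * p k)%R <= n.*2.+1)%N.
  move=> h1 h3; rewrite (leq_trans (size_polyMleq _ _))// size_jacobi_poly// addnS /=.
  by rewrite (leq_trans _ h3)// leq_add2r.
have val (P : {poly R}) V (l m : R) : (size P <= n.*2.+1)%N ->
    (forall x : R, is_derive x 1 V (P.[x] * rho x)) -> V x @[x --> +oo] --> l ->
    V x @[x --> -oo] --> m -> (\int[Leb]_x (P.[x] * rho x)%:E = (l - m)%:E)%E.
  move=> sP dV Vl Vm; have [C hC] := boundary_density_bound b ha tau0 sP.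
  have [|_ ->//] := @FTC_line R _ V C l m _ hC dV Vl Vm.
  move=> x; apply: cvgM; first exact: continuous_horner.
  exact: continuous_boundary_density.
pose I (P : {poly R}) := Rintegral Leb setT (fun x => P.[x] * rho x).
have ID (P Q : {poly R}) : (size P <= n.*2.+1)%N -> (size Q <= n.*2.+1)%N -> I (P + Q) = I P + I Q.
  move=> sP sQ; rewrite /I -RintegralD//; try exact: int.
  by apply: eq_Rintegral => x _; rewrite hornerD mulrDl.
have IZ c (P : {poly R}) : (size P <= n.*2.+1)%N -> I (c *: P) = c * I P.
  move=> sP; rewrite /I -RintegralZl//; try exact: int.
  by apply: eq_Rintegral => x _; rewrite /= hornerZ -mulrA.
have top (P : {poly R}) : (size P <= n.+1)%N -> I (P * p n) = P`_n / lead_coef (p n).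
  move=> sP; have [V [l [m [dV Vl Vm E]]]] := boundary_top_primitive b ha tau0 sP.
  rewrite /I /Rintegral (val _ V l m)// ?E//.
  by apply: (sz _ n.+1) => //; rewrite addSn addnn.
have next (P : {poly R}) : (size P <= n)%N -> I (P * p n.+1) = 0.
  move=> sP; have [V [l [dV Vl Vm]]] := boundary_next_primitive b ha tau0 sP.
  rewrite /I /Rintegral (val _ V l l)// ?subrr//.
  by apply: (sz _ n) => //; rewrite addnS addnn.
have H := orthonormal_downward ID IZ top next.
move=> j k jn kn.
have szjk : (size (p j * p k)%R <= n.*2.+1)%N.
  by apply: (sz _ j.+1); rewrite ?size_jacobi_poly// addSn ltnS -addnn leq_add.
have E : (fun x => (p j).[x] * (p k).[x] * rho x) = fun x => (p j * p k).[x] * rho x.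
  by apply/funext => x; rewrite hornerM.
rewrite E; split; first exact: int.
under eq_integral => x _ do rewrite -hornerM.
rewrite -[LHS]fineK; last by apply: integrable_fin_num => //; exact: int.
congr EFin; transitivity (I (p j * p k)) => //.
have [jk|kj|<-] := ltngtP j k.
- by have [h _] := H k kn; rewrite h ?size_jacobi_poly.
- by have [h _] := H j jn; rewrite mulrC h ?size_jacobi_poly.
- by have [_ ->] := H j jn.
Qed.

End Orthonormality.

(** * Poisson integrals and finitely many moments *)

Section IntegralSum.
Variables (R : realType) (m : {measure set (measurableTypeR R) -> \bar R}).

Lemma integrable_addR (f g : R -> R) : m.-integrable setT (EFin \o f) ->
  m.-integrable setT (EFin \o g) -> m.-integrable setT (EFin \o (fun x => f x + g x)).
Proof.
move=> hf hg; have := integrableD measurableT hf hg.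
by apply: eq_integrable => // x _; rewrite /= EFinD.
Qed.

Lemma integrable_subR (f g : R -> R) : m.-integrable setT (EFin \o f) ->
  m.-integrable setT (EFin \o g) -> m.-integrable setT (EFin \o (fun x => f x - g x)).
Proof.
move=> hf hg; have := integrableB measurableT hf hg.
by apply: eq_integrable => // x _; rewrite /= EFinB.
Qed.

Lemma integrable_scaleR (c : R) (f : R -> R) : m.-integrable setT (EFin \o f) ->
  m.-integrable setT (EFin \o (fun x => c * f x)).
Proof.
move=> hf; have := integrableZl measurableT c hf.
by apply: eq_integrable => // x _; rewrite /= EFinM.
Qed.

Lemma Rintegral_sum (I : Type) (s : seq I) (f : I -> R -> R) :
  (forall i, m.-integrable setT (EFin \o f i)) ->
  m.-integrable setT (EFin \o (fun x => \sum_(i <- s) f i x)) /\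
  Rintegral m setT (fun x => \sum_(i <- s) f i x) = \sum_(i <- s) Rintegral m setT (f i).
Proof.
move=> hf; elim: s => [|i s [IH1 IH2]].
  have -> : (fun x : R => \sum_(i <- [::]) f i x) = cst 0.
    by apply/funext => x; rewrite big_nil.
  split; first exact: integrable0.
  by rewrite big_nil /Rintegral integral0.
have E : (fun x => \sum_(j <- i :: s) f j x) = fun x => f i x + \sum_(j <- s) f j x.
  by apply/funext => x; rewrite big_cons.
rewrite E big_cons -IH2 -RintegralD//; split => //.
exact: integrable_addR.
Qed.

End IntegralSum.

Section Poisson.
Variables (R : realType) (a b : nat -> R).
Hypothesis ha : forall n, 0 < a n.
Local Notation p := (jacobi_poly a b).

Definition jacobi_comb n (c : nat -> R) : {poly R} := \sum_(k < n.+1) c k *: p k.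

Lemma jacobi_combP n (P : {poly R}) : (size P <= n.+1)%N -> exists c, P = jacobi_comb n c.
Proof.
elim: n P => [|n IH] P sP.
  exists (fun=> P`_0); rewrite /jacobi_comb big_ord1 jacobi_poly0.
  by rewrite {1}(size1_polyC sP) alg_polyC.
pose d := P`_n.+1 / lead_coef (p n.+1).
have [|c E] := IH (P - d *: p n.+1).
  apply/leq_sizeP => j; rewrite leq_eqVlt => /orP[/eqP <-|nj].
    rewrite coefB coefZ.
    have -> : (p n.+1)`_n.+1 = lead_coef (p n.+1) by rewrite lead_coefE size_jacobi_poly.
    by rewrite divfK ?subrr// gt_eqF// lead_jacobi_poly_gt0.
  rewrite coefB coefZ !nth_default ?mulr0 ?subr0//.
    by rewrite size_jacobi_poly.
  exact: leq_trans sP _.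
exists (fun k => if k == n.+1 then d else c k).
rewrite /jacobi_comb big_ord_recr /= eqxx -[LHS](subrK (d *: p n.+1)) E; congr (_ + _).
by apply: eq_bigr => i _; rewrite ltn_eqF.
Qed.

Lemma horner_jacobi_comb n c x : (jacobi_comb n c).[x] = \sum_(k < n.+1) c k * (p k).[x].
Proof. by rewrite /jacobi_comb horner_sum; apply: eq_bigr => k _; rewrite hornerZ. Qed.

Lemma weighted_integral_pair (m : {measure set (measurableTypeR R) -> \bar R}) rho n c d :
  weighted_orthonormal a b m rho n ->
  m.-integrable setT (EFin \o (fun x => (jacobi_comb n c).[x] * (jacobi_comb n d).[x] * rho x)) /\
  Rintegral m setT (fun x => (jacobi_comb n c).[x] * (jacobi_comb n d).[x] * rho x) =
    \sum_(k < n.+1) c k * d k.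
Proof.
move=> WO.
have leS (k : 'I_n.+1) : (k <= n)%N by rewrite -ltnS.
have intjk (j k : 'I_n.+1) : m.-integrable setT
    (EFin \o (fun x => c j * d k * ((p j).[x] * (p k).[x] * rho x))).
  by have [h _] := WO j k (leS j) (leS k); exact: integrable_scaleR.
have inner (j : 'I_n.+1) := Rintegral_sum (index_enum 'I_n.+1) (intjk j).
have [h1 h2] := Rintegral_sum (index_enum 'I_n.+1) (fun j => (inner j).1).
have E : (fun x => (jacobi_comb n c).[x] * (jacobi_comb n d).[x] * rho x) =
   (fun x => \sum_(j < n.+1) \sum_(k < n.+1) c j * d k * ((p j).[x] * (p k).[x] * rho x)).
  apply/funext => x; rewrite !horner_jacobi_comb !mulr_suml; apply: eq_bigr => j _.
  by rewrite mulr_sumr mulr_suml; apply: eq_bigr => k _; ring.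
rewrite E; split => //; rewrite h2; apply: eq_bigr => j _.
rewrite (inner j).2 (bigD1 j)//= big1 ?addr0 => [|k kj].
  rewrite RintegralZl//; last by have [] := WO j j (leS j) (leS j).
  by have [_ E2] := WO j j (leS j) (leS j); rewrite /Rintegral E2 eqxx mulr1.
rewrite RintegralZl//; last by have [] := WO j k (leS j) (leS k).
have [_ E2] := WO j k (leS j) (leS k); rewrite /Rintegral E2.
by rewrite val_eqE eq_sym (negbTE kj) mulr0.
Qed.

Lemma jacobi_comb_delta0 n : jacobi_comb n (fun k => (k == 0%N)%:R) = 1.
Proof.
rewrite /jacobi_comb big_ord_recl /= scale1r jacobi_poly0 big1 ?addr0// => i _.
by rewrite scale0r.
Qed.

Lemma weighted_integral_comb (m : {measure set (measurableTypeR R) -> \bar R}) rho n c :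
  weighted_orthonormal a b m rho n ->
  m.-integrable setT (EFin \o (fun x => (jacobi_comb n c).[x] * rho x)) /\
  Rintegral m setT (fun x => (jacobi_comb n c).[x] * rho x) = c 0%N.
Proof.
move=> WO; have := weighted_integral_pair c (fun k => (k == 0%N)%:R) WO.
have -> : (fun x => (jacobi_comb n c).[x] * (jacobi_comb n (fun k => (k == 0%N)%:R)).[x] * rho x) =
  (fun x => (jacobi_comb n c).[x] * rho x).
  by apply/funext => x; rewrite jacobi_comb_delta0 hornerC mulr1.
move=> [h1 h2]; split => //; rewrite h2 big_ord_recl /= mulr1 big1 ?addr0// => i _.
by rewrite mulr0.
Qed.

Lemma Re_sum (I : Type) (s : seq I) (F : I -> R[i]) :
  complex.Re (\sum_(i <- s) F i) = \sum_(i <- s) complex.Re (F i).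
Proof. by elim/big_rec2: _ => //= i u v _ <-; rewrite ReD. Qed.

Lemma Im_sum (I : Type) (s : seq I) (F : I -> R[i]) :
  complex.Im (\sum_(i <- s) F i) = \sum_(i <- s) complex.Im (F i).
Proof. by elim/big_rec2: _ => //= i u v _ <-; rewrite ImD. Qed.

(** The Poisson kernel Im 1 / (x - (t + iy)), of total mass pi. *)
Definition poisson (t y x : R) : R := y / ((x - t) ^+ 2 + y ^+ 2).

(** The polynomial Q = sum_k conj(p_k(z)) p_k / T, with z = t + iy and T the Christoffel
    sum, satisfies Q(z) = 1. Hence 1 / (x - z) - Q(x) / (x - z) is a polynomial of
    degree less than n in x, and the Poisson kernel differs from a real polynomial by
    Im (Q(x) / (x - z)), which is at most |Q(x)| / y. The square of |Q| has integral 1 / T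
    for every orthonormality measure; the linear term |Q| is traded for
    (eps + |Q|^2 / eps) / 2. *)
Lemma poisson_approx n t y : 0 < y -> exists c d e : nat -> R,
  \sum_(k < n.+1) c k * c k + \sum_(k < n.+1) d k * d k = (cchristoffel a b n.+1 (t +i* y)%C)^-1 /\
  forall x eps, 0 < eps -> `|poisson t y x - (jacobi_comb n e).[x]| <=
    (eps + ((jacobi_comb n c).[x] * (jacobi_comb n c).[x] +
            (jacobi_comb n d).[x] * (jacobi_comb n d).[x]) / eps) / (2 * y).
Proof.
move=> y0; set z := (t +i* y)%C.
have T1 := cchristoffel_ge1 a b n z; set T := cchristoffel a b n.+1 z in T1 *.
have T0 : 0 < T by apply: lt_le_trans T1.
pose c k := complex.Re (cjacobi a b k z) / T.
pose d k := - complex.Im (cjacobi a b k z) / T.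
pose Q : {poly R[i]} := \sum_(k < n.+1) ((c k +i* d k)%C *: map_poly (real_complex R) (p k)).
have Qz : Q.[z] = 1.
  rewrite /Q horner_sum.
  have -> : (1 : R[i]) = ((\sum_(k < n.+1) sqnorm (cjacobi a b k z) / T)%:C)%C.
    by rewrite -mulr_suml divff// gt_eqF.
  rewrite rmorph_sum /=; apply: eq_bigr => k _.
  rewrite hornerZ -/(cjacobi a b k z) /c /d /sqnorm.
  by case: (cjacobi a b k z) => u v; apply: complex_ext => /=; field; rewrite gt_eqF.
have QE x : Q.[(x%:C)%C] = ((jacobi_comb n c).[x] +i* (jacobi_comb n d).[x])%C.
  rewrite /Q horner_sum !horner_jacobi_comb.
  apply: complex_ext; rewrite ?Re_sum ?Im_sum; apply: eq_bigr => k _;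
    by rewrite hornerZ horner_map /=; ring.
have [H eH] : exists H, 1 - Q = H * ('X - z%:P).
  by apply/factor_theorem; rewrite rootE hornerD hornerN hornerC Qz subrr.
have sQ : (size Q <= n.+1)%N.
  apply: (big_ind (fun q : {poly R[i]} => (size q <= n.+1)%N)).
  - by rewrite size_poly0.
  - by move=> u v su sv; rewrite (leq_trans (size_polyD _ _))// geq_max su.
  - move=> i _; rewrite (leq_trans (size_scale_leq _ _))// size_map_poly.
    by rewrite size_jacobi_poly.
have sH : (size H <= n.+1)%N.
  have [->|H0] := eqVneq H 0; first by rewrite size_poly0.
  have : (size (1 - Q)%R <= n.+1)%N.
    by rewrite (leq_trans (size_polyD _ _))// geq_max size_polyN sQ size_poly1.
  by rewrite eH size_Mmonic ?monicXsubC// size_XsubC addn2 => /ltnW.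
pose P : {poly R} := \poly_(i < size H) complex.Im H`_i.
have PE x : P.[x] = complex.Im (H.[(x%:C)%C]).
  rewrite /P horner_poly horner_coef.
  elim/big_rec2: _ => //= i u v _ ->; rewrite ImD; congr (_ + _).
  by rewrite -rmorphXn /= ImM /= mulr0 add0r.
have [e eE] : exists e, P = jacobi_comb n e.
  by apply: jacobi_combP; rewrite (leq_trans (size_poly _ _)).
exists c, d, e; split.
  rewrite -big_split /=.
  have -> : T^-1 = \sum_(k < n.+1) sqnorm (cjacobi a b k z) / T ^+ 2.
    by rewrite -mulr_suml -/(cchristoffel a b n.+1 z) -/T; field; rewrite gt_eqF.
  by apply: eq_bigr => k _; rewrite /c /d /sqnorm; field; rewrite gt_eqF.
move=> x eps eps0; rewrite -eE PE.
have y0' : complex.Im z != 0 by rewrite gt_eqF.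
have -> : poisson t y x = complex.Im (cinv_sub z x) by rewrite Im_cinv_sub.
rewrite -ImN -ImD.
have -> : cinv_sub z x - H.[(x%:C)%C] = Q.[(x%:C)%C] * cinv_sub z x.
  have := congr1 (fun q => q.[(x%:C)%C]) eH.
  rewrite /= hornerD hornerN hornerC hornerM hornerXsubC => h.
  have h0 := real_sub_neq0 x y0'.
  rewrite /cinv_sub; apply: (mulIf h0); rewrite mulrBl -h mulVf// mulfVK//.
  by rewrite opprB addrC subrK.
set w := complex.Im _; set S := (_.[x] * _.[x] + _.[x] * _.[x]).
have S0 : (y * w) ^+ 2 <= S.
  rewrite /w /S ImM QE Re_cinv_sub Im_cinv_sub /= -!expr2.
  set A := (jacobi_comb n c).[x]; set B := (jacobi_comb n d).[x].
  have h := sqr_dist_gt0 x y0'; rewrite /= in h.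
  set m := (x - t) ^+ 2 + y ^+ 2 in h *.
  have -> : y * (A * (y / m) + B * ((x - t) / m)) = y * (A * y + B * (x - t)) / m.
    by field; rewrite gt_eqF.
  rewrite expr_div_n ler_pdivrMr ?exprn_gt0//.
  have m1 : (A * y + B * (x - t)) ^+ 2 <= (A ^+ 2 + B ^+ 2) * m.
    rewrite /m; have := sqr_ge0 (A * (x - t) - B * y); lra.
  rewrite exprMn; have m2 : y ^+ 2 <= m by rewrite /m lerDr sqr_ge0.
  rewrite [leRHS](_ : _ = m * ((A ^+ 2 + B ^+ 2) * m)); last by rewrite expr2; ring.
  by apply: ler_pM; rewrite ?sqr_ge0.
rewrite ler_pdivlMr ?mulr_gt0//.
have -> : `|w| * (2 * y) = 2 * `|y * w| by rewrite normrM (gtr0_norm y0); ring.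
have : 2 * `|y * w| * eps <= eps ^+ 2 + S.
  rewrite (le_trans _ (lerD (lexx _) S0))// -[leRHS](_ : eps ^+ 2 + `|y * w| ^+ 2 = _).
    have := sqr_ge0 (eps - `|y * w|); lra.
  by rewrite real_normK ?num_real.
have -> : eps + S / eps = (eps ^+ 2 + S) / eps by field; rewrite gt_eqF.
by rewrite ler_pdivlMr.
Qed.

Lemma continuous_poisson t y : 0 < y -> continuous (poisson t y).
Proof.
move=> y0 x; apply: cvgM; first exact: cvg_cst.
apply: cvgV; first by rewrite gt_eqF// ltr_wpDl ?sqr_ge0// exprn_gt0.
apply: cvgD; last exact: cvg_cst.
apply: (@continuous_comp _ _ _ (fun x => x - t) (fun x => x ^+ 2)); last exact: exprn_continuous.
by apply: cvgB; [exact: cvg_id|exact: cvg_cst].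
Qed.

Lemma poisson_ge0 t y x : 0 < y -> 0 <= poisson t y x.
Proof. by move=> y0; rewrite divr_ge0 ?addr_ge0 ?sqr_ge0// ltW. Qed.

Lemma poisson_le t y x : 0 < y -> poisson t y x <= y^-1.
Proof.
move=> y0; have h : 0 < (x - t) ^+ 2 + y ^+ 2 by rewrite ltr_wpDl ?sqr_ge0// exprn_gt0.
rewrite /poisson ler_pdivrMr// mulrDr expr2 mulKf ?gt_eqF// lerDr.
by rewrite mulr_ge0 ?sqr_ge0// invr_ge0 ltW.
Qed.

Section Weight.
Variables (m : {measure set (measurableTypeR R) -> \bar R}) (rho : R -> R) (n : nat).
Hypothesis WO : weighted_orthonormal a b m rho n.
Hypothesis rho_ge0 : forall x, 0 <= rho x.
Hypothesis rho_meas : measurable_fun setT rho.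

Lemma weight_integrable : m.-integrable setT (EFin \o rho) /\ Rintegral m setT rho = 1.
Proof.
have [] := weighted_integral_comb (fun k => (k == 0%N)%:R) WO.
have -> : (fun x => (jacobi_comb n (fun k => (k == 0%N)%:R)).[x] * rho x) = rho.
  by apply/funext => x; rewrite jacobi_comb_delta0 hornerC mul1r.
by [].
Qed.

Lemma weight_integrable_bounded (f : R -> R) (C : R) : measurable_fun setT f ->
  (forall x, `|f x| <= C) -> m.-integrable setT (EFin \o (fun x => f x * rho x)).
Proof.
move=> mf fC; have [h _] := weight_integrable.
have h2 := integrableZl measurableT C h.
apply: (le_integrable _ _ _ h2) => //.
  by apply/measurable_EFinP; apply: measurable_funM.
move=> x _ /=; rewrite lee_fin normrM (ger0_norm (rho_ge0 x)).
rewrite (le_trans _ (ler_norm _))// ler_wpM2r//.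
Qed.

Lemma poisson_weight_integrable t y : 0 < y ->
  m.-integrable setT (EFin \o (fun x => poisson t y x * rho x)).
Proof.
move=> y0; apply: (@weight_integrable_bounded _ y^-1).
  by apply: continuous_measurable_fun; exact: continuous_poisson.
by move=> x; rewrite ger0_norm ?poisson_ge0 ?poisson_le.
Qed.

End Weight.

(** The common value v is the integral of the approximating polynomial, which is the same
    for all weights that make p_0, ..., p_n orthonormal; eps = T^(-1/2) balances the two
    error terms. *)
Lemma poisson_weight_value n t y : 0 < y -> exists v,
  forall (m : {measure set (measurableTypeR R) -> \bar R}) (rho : R -> R),
  weighted_orthonormal a b m rho n -> (forall x, 0 <= rho x) -> measurable_fun setT rho ->
  `|Rintegral m setT (fun x => poisson t y x * rho x) - v| <=
    (y * Num.sqrt (cchristoffel a b n.+1 (t +i* y)%C))^-1.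
Proof.
move=> y0; have [c [d [e [S1 hS]]]] := poisson_approx n t y0.
exists (e 0%N) => m rho WO r0 mr.
set T := cchristoffel a b n.+1 _ in S1 *.
have T0 : 0 < T by apply: lt_le_trans (cchristoffel_ge1 a b n (t +i* y)%C).
have [ie ve] := weighted_integral_comb e WO.
have [ic vc] := weighted_integral_pair c c WO.
have [id vd] := weighted_integral_pair d d WO.
have [ir vr] := weight_integrable WO.
have ip := poisson_weight_integrable WO r0 mr t y0.
rewrite -ve -RintegralB//.
pose eps := (Num.sqrt T)^-1.
have sT0 : 0 < Num.sqrt T by rewrite sqrtr_gt0.
have eps0 : 0 < eps by rewrite invr_gt0.
have idiff := integrable_subR ip ie.
apply: (le_trans (le_normr_Rintegral measurableT idiff)).
pose g x := (2 * y)^-1 * (eps * rho x + eps^-1 * ((jacobi_comb n c).[x] * (jacobi_comb n c).[x] * rho x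
   + (jacobi_comb n d).[x] * (jacobi_comb n d).[x] * rho x)).
have icd := integrable_addR ic id.
have icd' := integrable_scaleR eps^-1 icd.
have ier := integrable_scaleR eps ir.
have isum := integrable_addR ier icd'.
have ig : m.-integrable setT (EFin \o g) := integrable_scaleR (2 * y)^-1 isum.
have vg : Rintegral m setT g = (y * Num.sqrt T)^-1.
  rewrite /g RintegralZl// RintegralD// !RintegralZl// RintegralD// vr vc vd S1 mulr1.
  have -> : T^-1 = (Num.sqrt T ^+ 2)^-1 by rewrite sqr_sqrtr ?ltW.
  rewrite /eps.
  by field; rewrite !gt_eqF.
rewrite -vg; apply: le_Rintegral => //.
  move: (integrable_norm idiff); by apply: eq_integrable.
move=> x _; rewrite /g -mulrBl normrM (ger0_norm (r0 x)).
apply: (@le_trans _ _ ((eps + ((jacobi_comb n c).[x] * (jacobi_comb n c).[x] +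
            (jacobi_comb n d).[x] * (jacobi_comb n d).[x]) / eps) / (2 * y) * rho x)).
  by rewrite ler_wpM2r// hS.
rewrite le_eqVlt; apply/orP; left; apply/eqP.
by ring.
Qed.

Lemma poisson_compare n t y (m m' : {measure set (measurableTypeR R) -> \bar R}) (rho rho' : R -> R) :
  0 < y ->
  weighted_orthonormal a b m rho n -> (forall x, 0 <= rho x) -> measurable_fun setT rho ->
  weighted_orthonormal a b m' rho' n -> (forall x, 0 <= rho' x) -> measurable_fun setT rho' ->
  `|Rintegral m setT (fun x => poisson t y x * rho x) -
    Rintegral m' setT (fun x => poisson t y x * rho' x)| <=
  2 * (y * Num.sqrt (cchristoffel a b n.+1 (t +i* y)%C))^-1.
Proof.
move=> y0 h1 h2 h3 h4 h5 h6.
have [v hv] := poisson_weight_value n t y0.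
have e1 := hv _ _ h1 h2 h3; have e2 := hv _ _ h4 h5 h6.
by rewrite (le_trans (ler_distD v _ _))// mulr2n mulrDl mul1r lerD// distrC.
Qed.

End Poisson.

(** * Local behaviour of the Poisson integral of an orthonormality measure *)

Section PoissonIntegral.
Variable R : realType.
Let Leb := @lebesgue_measure R.

Lemma cvg_atan_sub_pos (a b : R) : 0 < b ->
  ((fun x => atan ((x - a) / b)) x @[x --> +oo] --> pi / 2) /\
  ((fun x => atan ((x - a) / b)) x @[x --> -oo] --> - (pi / 2)).
Proof.
move=> b0; have [] := @cvg_atan_sub _ a (- b); first by rewrite oppr_lt0.
have -> : (fun x => atan ((x - a) / - b)) = (fun x => - atan ((x - a) / b)).
  by apply/funext => x; rewrite invrN mulrN atanN.
move=> h1 h2; split.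
  rewrite -[X in _ --> X]opprK; apply: cvg_trans (cvgN h1); apply: near_eq_cvg.
  by apply: nearW => x; rewrite /= opprK.
apply: cvg_trans (cvgN h2); apply: near_eq_cvg.
by apply: nearW => x; rewrite /= opprK.
Qed.

Lemma integral_poisson t y : 0 < y ->
  Leb.-integrable setT (EFin \o poisson t y) /\ Rintegral Leb setT (poisson t y) = pi.
Proof.
move=> y0.
have c := @continuous_poisson R t y y0.
have [h1 h2] := cvg_atan_sub_pos t y0.
have d (x : R) : is_derive x 1 (fun x => atan ((x - t) / y)) (poisson t y x).
  by apply: is_derive_atan_sub; rewrite gt_eqF.
have E := ge0_FTC_line (fun x => poisson_ge0 t x y0) c d h1 h2.
have E2 : pi / 2 - - (pi / 2) = pi :> R by rewrite opprK -splitr.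
split; last by rewrite /Rintegral E /= E2.
apply/integrableP; split.
  by apply/measurable_EFinP; exact: continuous_measurable_fun.
under eq_integral => x _ do rewrite /= ger0_norm ?poisson_ge0//.
by rewrite E ltry.
Qed.

End PoissonIntegral.

Section SpectralMeasure.
Variables (R : realType) (a b : nat -> R).
Hypothesis ha : forall n, 0 < a n.
Variable mu : probability (measurableTypeR R) R.
Hypothesis hmu : orthonormality_measure a b mu.
Local Notation p := (jacobi_poly a b).
Let Leb := @lebesgue_measure R.

Lemma mu_weighted_orthonormal n : weighted_orthonormal a b mu (cst 1) n.
Proof.
move=> j k _ _; have [h1 h2] := hmu j k.
have E : (fun x => (p j).[x] * (p k).[x] * cst 1 x) = (fun x => (p j).[x] * (p k).[x]).
  by apply/funext => x; rewrite /= mulr1.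
by rewrite E; under eq_integral => x _ do rewrite mulr1.
Qed.

(** The polynomial c = sum_k p_k(x0) p_k / T, T = sum_(k <= n) p_k(x0)^2, equals 1 at x0 and
    has integral of its square 1 / T, so the mass of x0 is at most 1 / T. *)
Lemma no_atom x0 : (forall M, exists n, M <= \sum_(k < n.+1) (p k).[x0] ^+ 2) ->
  mu [set x0] = 0%E.
Proof.
move=> unb.
have key n : (mu [set x0] <= (\sum_(k < n.+1) (p k).[x0] ^+ 2)^-1%:E)%E.
  set T := \sum_(k < _) _.
  have T0 : 0 < T.
    rewrite /T big_ord_recl /= jacobi_poly0 hornerC expr1n ltr_pwDl//.
    by apply: sumr_ge0 => i _; rewrite sqr_ge0.
  pose c k := (p k).[x0] / T.
  have [i v] := weighted_integral_pair c c (@mu_weighted_orthonormal n).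
  have {}v : Rintegral mu setT (fun x => (jacobi_comb a b n c).[x] ^+ 2) = T^-1.
    transitivity (\sum_(k < n.+1) c k * c k).
      by rewrite -v; apply: eq_Rintegral => x _; rewrite mulr1 expr2.
    have -> : T^-1 = T / T ^+ 2 by field; rewrite gt_eqF.
    rewrite {1}/T mulr_suml; apply: eq_bigr => k _.
    by rewrite /c -expr2 expr_div_n.
  have {}i : mu.-integrable setT (EFin \o (fun x => (jacobi_comb a b n c).[x] ^+ 2)).
    by move: i; apply: eq_integrable => // x _; rewrite /= mulr1 expr2.
  rewrite -v /Rintegral fineK; last exact: integrable_fin_num.
  have -> : mu [set x0] = (\int[mu]_x (\1_[set x0] x)%:E)%E.
    by rewrite integral_indic ?setIT//; exact: measurable_set1.
  apply: ge0_le_integral => //.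
  - by apply/measurable_EFinP; exact: measurable_indic.
  - by have /integrableP[] := i.
  move=> x _; rewrite lee_fin indicE; case: (boolP (x \in _)) => [|_]; last by rewrite sqr_ge0.
  rewrite inE => ->; rewrite horner_jacobi_comb.
  rewrite (_ : \sum_(k < n.+1) _ = 1) ?expr1n//.
  have -> : (1 : R) = T / T by rewrite divff ?gt_eqF.
  by rewrite {1}/T mulr_suml; apply: eq_bigr => k _; rewrite /c; ring.
apply/eqP; rewrite eq_le measure_ge0 andbT.
apply/lee_addgt0Pr => e e0; rewrite add0e.
have [n hn] := unb e^-1.
apply: le_trans (key n) _; rewrite lee_fin -[leRHS]invrK lef_pV2// posrE ?invr_gt0//.
by apply: lt_le_trans hn; rewrite invr_gt0.
Qed.

Hypothesis carleman : forall M, exists n, M <= \sum_(k < n) (a k)^-1.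

Lemma cchristoffel_unbounded z : 0 < complex.Im z ->
  forall M, exists n0, forall n, (n0 <= n)%N -> M <= cchristoffel a b n.+1 z.
Proof.
move=> z0 M; have [n0 h0] := carleman (M / complex.Im z).
exists n0 => n n0n.
have h : M <= cchristoffel a b n0.+1 z.
  apply: le_trans (cchristoffel_lower b ha n0 z0).
  by rewrite -mulr_sumr mulrC -ler_pdivrMr.
apply: (le_trans h); rewrite -(subnK n0n); elim: (n - n0)%N => // m IH.
by rewrite addSn [leRHS]cchristoffelS (le_trans IH)// lerDl sqnorm_ge0.
Qed.

(** The neighbourhood of x0 has to work for boundary densities of arbitrarily large order:
    the order is chosen last, when the height y of the Poisson kernel is known. *)
Definition local_density x0 w0 := forall eps, 0 < eps -> exists2 delta, 0 < delta &
  forall n0, exists n tau, [/\ (n0 <= n)%N, 0 < complex.Im tau &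
    forall x, `|x - x0| < delta -> `|boundary_density a b n tau x - w0| <= eps].

Definition poisson_mu t y := Rintegral mu setT (poisson t y).

(** Near x0 the density is close to w0; away from x0, and for t close to x0, both the
    density and the constant w0 are integrated against a kernel of size O(y). For the
    constant, the kernel at height y is compared with the one at height 1. *)
Lemma boundary_poisson_local n tau x0 w0 eps delta t y : 0 < complex.Im tau -> 0 <= w0 ->
  0 < eps -> 0 < delta ->
  (forall x, `|x - x0| < delta -> `|boundary_density a b n tau x - w0| <= eps) ->
  `|t - x0| < delta / 2 -> 0 < y ->
  `|Rintegral Leb setT (fun x => poisson t y x * boundary_density a b n tau x) - pi * w0| <=
    eps * pi + y * (4 / delta ^+ 2 + w0 * (1 + 4 / delta ^+ 2) * pi).
Proof.
move=> tau0 w00 e0 d0 loc tx y0.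
set rho := boundary_density a b n tau.
have WO := @boundary_density_orthonormal _ _ b ha n tau tau0.
have rho0 x : 0 <= rho x by apply/ltW/boundary_density_gt0.
have mrho : measurable_fun setT rho.
  by apply: continuous_measurable_fun; exact: continuous_boundary_density.
have [ir vr] := weight_integrable WO.
have ip := poisson_weight_integrable WO rho0 mrho t y0.
have [iq vq] := integral_poisson t y0.
have [i1 v1] := integral_poisson t (@ltr01 R).
have iqw : Leb.-integrable setT (EFin \o (fun x => poisson t y x * w0)).
  by have := integrableZr measurableT w0 iq; apply: eq_integrable => // x _; rewrite /= EFinM.
have -> : pi * w0 = Rintegral Leb setT (fun x => poisson t y x * w0).
  by rewrite RintegralZr// vq.
rewrite -RintegralB//.
have idiff := integrable_subR ip iqw.
apply: (le_trans (le_normr_Rintegral measurableT idiff)).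
set C := 4 / delta ^+ 2.
have C0 : 0 < C by rewrite divr_gt0 ?exprn_gt0.
have iZ (f : R -> R) c : Leb.-integrable setT (EFin \o f) -> Leb.-integrable setT (EFin \o (fun x => c * f x)).
  exact: integrable_scaleR.
have iD (f g : R -> R) : Leb.-integrable setT (EFin \o f) -> Leb.-integrable setT (EFin \o g) ->
  Leb.-integrable setT (EFin \o (fun x => f x + g x)) by exact: integrable_addR.
have -> : eps * pi + y * (C + w0 * (1 + C) * pi) =
   Rintegral Leb setT (fun x => eps * poisson t y x + (y * C * rho x + y * w0 * (1 + C) * poisson t 1 x)).
  rewrite RintegralD//; [|exact: iZ|by apply: iD; exact: iZ].
  rewrite RintegralD//; [|exact: iZ|exact: iZ].
  have vZ (f : R -> R) c : Leb.-integrable setT (EFin \o f) ->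
      Rintegral Leb setT (fun x => c * f x) = c * Rintegral Leb setT f.
    by move=> hf; rewrite RintegralZl.
  rewrite (vZ (poisson t y) eps iq) (vZ rho (y * C) ir) (vZ (poisson t 1) (y * w0 * (1 + C)) i1).
  by rewrite vq vr v1; ring.
apply: le_Rintegral => //.
  by move: (integrable_norm idiff); apply: eq_integrable.
  by apply: (iD); [exact: iZ|apply: iD; exact: iZ].
move=> x _; rewrite -mulrBr normrM (ger0_norm (poisson_ge0 t x y0)).
have pp := poisson_ge0 t x y0; have pp1 := poisson_ge0 t x (@ltr01 R).
have [near0|far] := ltP `|x - x0| delta.
  rewrite [leLHS]mulrC; apply: (@le_trans _ _ (eps * poisson t y x)).
    by rewrite ler_wpM2r// loc.
  rewrite lerDl; apply: addr_ge0.
    exact: mulr_ge0 (mulr_ge0 (ltW y0) (ltW C0)) (rho0 x).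
  exact: mulr_ge0 (mulr_ge0 (mulr_ge0 (ltW y0) w00) (addr_ge0 ler01 (ltW C0))) pp1.
have xt : delta / 2 <= `|x - t|.
  have := ler_distD t x x0; lra.
have xt2 : delta ^+ 2 / 4 <= (x - t) ^+ 2.
  rewrite -[leRHS]real_normK ?num_real//.
  have -> : delta ^+ 2 / 4 = (delta / 2) ^+ 2 by field.
  by rewrite lerXn2r ?nnegrE// divr_ge0// ltW.
have xt0 : 0 < (x - t) ^+ 2.
  by apply: lt_le_trans xt2; rewrite divr_gt0// exprn_gt0.
have Cxt : 1 <= C * (x - t) ^+ 2.
  rewrite /C mulrAC ler_pdivlMr ?exprn_gt0// mul1r.
  by move: xt2; rewrite ler_pdivrMr// mulrC.
have b1 : poisson t y x <= y * C.
  rewrite /poisson ler_pM2l// -[C]invrK lef_pV2 ?posrE ?invr_gt0//; last by rewrite ltr_pwDl ?sqr_ge0.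
  rewrite (@le_trans _ _ ((x - t) ^+ 2))// ?lerDl ?sqr_ge0//.
  by rewrite -[C^-1]mul1r ler_pdivrMr// mulrC.
have b2 : poisson t y x <= y * (1 + C) * poisson t 1 x.
  rewrite /poisson mul1r expr1n -mulrA ler_pM2l// ler_pdivlMr; last by rewrite ltr_pwDl// ltW.
  rewrite mulrC ler_pdivrMr; last by rewrite ltr_pwDl ?sqr_ge0.
  apply: (@le_trans _ _ ((1 + C) * (x - t) ^+ 2)); first by rewrite mulrDl mul1r addrC [X in _ <= X]addrC lerD2r.
  by rewrite ler_pM2l ?addr_gt0// lerDl sqr_ge0.
have tri : `|rho x - w0| <= rho x + w0.
  by rewrite (le_trans (ler_normB _ _))// !ger0_norm.
apply: (@le_trans _ _ (poisson t y x * (rho x + w0))); first by rewrite ler_wpM2l.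
rewrite mulrDr; apply: (@le_trans _ _ (y * C * rho x + y * w0 * (1 + C) * poisson t 1 x)).
  apply: lerD; first by rewrite ler_wpM2r.
  by rewrite [leRHS](_ : _ = y * (1 + C) * poisson t 1 x * w0); [rewrite ler_wpM2r|ring].
by rewrite lerDr mulr_ge0// ltW.
Qed.

Lemma poisson_mu_local x0 w0 : 0 <= w0 -> local_density x0 w0 ->
  forall eps, 0 < eps -> exists delta y0, [/\ 0 < delta, 0 < y0 &
    forall t y, `|t - x0| < delta -> 0 < y < y0 -> `|poisson_mu t y - pi * w0| <= eps].
Proof.
move=> w00 loc eps e0.
have pi0 := @pi_gt0 R.
pose eps' := eps / (4 * pi).
have e'0 : 0 < eps' by rewrite divr_gt0// mulr_gt0.
have [delta d0 hd] := loc eps' e'0.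
pose B := 4 / delta ^+ 2 + w0 * (1 + 4 / delta ^+ 2) * pi.
have B0 : 0 < B.
  have C0 : 0 < 4 / delta ^+ 2 by rewrite divr_gt0 ?exprn_gt0.
  by rewrite /B ltr_pwDl// !mulr_ge0// ltW// addr_gt0.
exists (delta / 2), (eps / (4 * B)); split; rewrite ?divr_gt0 ?mulr_gt0//.
move=> t y tx /andP[y0 yB].
(* T0 is the size of the Christoffel sum from which the comparison error is at most
   eps / 4; eps' pi and B y take two further quarters. *)
pose T0 := (8 / (y * eps)) ^+ 2.
have [n0 hn0] := @cchristoffel_unbounded (t +i* y)%C y0 T0.
have [n [tau [n0n tau0 hnt]]] := hd n0.
have WO := @boundary_density_orthonormal _ _ b ha n tau tau0.
have h1 := boundary_poisson_local tau0 w00 e'0 d0 hnt tx y0.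
have rho0 x : 0 <= boundary_density a b n tau x by apply/ltW/boundary_density_gt0.
have mrho : measurable_fun setT (boundary_density a b n tau).
  by apply: continuous_measurable_fun; exact: continuous_boundary_density.
have h2 := poisson_compare ha t y0 (@mu_weighted_orthonormal n) (fun=> ler01) (@measurable_cst _ _ _ _ setT (1 : R)) WO rho0 mrho.
have E : Rintegral mu setT (fun x => poisson t y x * cst 1 x) = poisson_mu t y.
  by apply: eq_Rintegral => x _; rewrite /= mulr1.
rewrite E in h2.
have h3 : 2 / (y * Num.sqrt (cchristoffel a b n.+1 (t +i* y)%C)) <= eps / 4.
  have ye : 0 < 8 / (y * eps) by rewrite divr_gt0// mulr_gt0.
  have : 8 / (y * eps) <= Num.sqrt (cchristoffel a b n.+1 (t +i* y)%C).
    rewrite -[leLHS]gtr0_norm// -sqrtr_sqr ler_wsqrtr//; exact: hn0.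
  set s := Num.sqrt _ => hs.
  have s0 : 0 < s by apply: lt_le_trans hs.
  rewrite ler_pdivrMr ?mulr_gt0//.
  move: hs; rewrite ler_pdivrMr ?mulr_gt0//; lra.
have h4 : eps' * pi = eps / 4 by rewrite /eps' invfM mulrA divfK// gt_eqF.
have h5 : y * B <= eps / 4.
  move: (ltW yB); rewrite !ler_pdivlMr ?mulr_gt0//.
  by rewrite -mulrA [B * 4]mulrC.
have := ler_distD (Rintegral Leb setT (fun x => poisson t y x * boundary_density a b n tau x)) (poisson_mu t y) (pi * w0).
rewrite -/B h4 in h1; lra.
Qed.

End SpectralMeasure.

(** * From Poisson integrals to a density *)

Section DistributionFunction.
Variables (R : realType) (mu : probability (measurableTypeR R) R).
Let Leb := @lebesgue_measure R.

Lemma bounded_integrable (f : R -> R) C : measurable_fun setT f ->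
  (forall x, `|f x| <= C) -> mu.-integrable setT (EFin \o f).
Proof.
move=> mf fC; have hC : mu.-integrable setT (EFin \o cst C).
  exact: finite_measure_integrable_cst.
apply: (le_integrable _ _ _ hC) => //; first exact/measurable_EFinP.
by move=> x _ /=; rewrite lee_fin (le_trans (fC x))// ler_norm.
Qed.

(** Dominated convergence when pointwise convergence fails at one point that is not an
    atom. *)
Lemma bounded_cvg_ae (f_ : nat -> R -> R) (f : R -> R) C t :
  (forall n, measurable_fun setT (f_ n)) -> measurable_fun setT f ->
  (forall n x, `|f_ n x| <= C) -> mu [set t] = 0%E ->
  (forall x, x != t -> f_ n x @[n --> \oo] --> f x) ->
  Rintegral mu setT (f_ n) @[n --> \oo] --> Rintegral mu setT f.
Proof.
move=> mf_ mf fC mt fcvg.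
have hC : mu.-integrable setT (EFin \o cst C).
  exact: finite_measure_integrable_cst.
have [| | | |fi _ cv] := @dominated_convergence _ _ _ mu setT measurableT (fun n => EFin \o f_ n) (EFin \o f) (EFin \o cst C) _ _ _ hC.
- by move=> n; apply/measurable_EFinP; exact: mf_.
- exact/measurable_EFinP.
- exists [set t]; split => //.
  move=> x /= h; apply/eqP; apply/negPn/negP => xt; apply: h => _.
  by apply/cvg_EFin; [exact: nearW|exact: fcvg].
- by apply: aeW => x n _ /=; rewrite lee_fin.
have fin := integrable_fin_num measurableT fi.
by rewrite /Rintegral; apply: fine_cvg; rewrite fineK.
Qed.

Definition pcdf (t : R) : R := fine (mu `]-oo, t]%classic).

Lemma pcdfE t : pcdf t = Rintegral mu setT (\1_(`]-oo, t]%classic)).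
Proof. by rewrite /Rintegral integral_indic ?setIT//; exact: measurable_itv. Qed.

Lemma pcdf_itv (s t : R) : s <= t -> mu `]s, t]%classic = (pcdf t - pcdf s)%:E.
Proof.
move=> st.
have E : `]-oo, t]%classic = `]-oo, s] `|` `]s, t] :> set (measurableTypeR R).
  apply/seteqP; split => x /=; rewrite !in_itv/=.
    by move=> xt; case: (leP x s); [left|right].
  by case=> [xs|/andP[]//]; exact: le_trans xs st.
have d : [disjoint `]-oo, s]%classic & `]s, t]%classic : set (measurableTypeR R)].
  apply/disj_setPS => x /= []; rewrite !in_itv/= => xs /andP[sx _].
  by move: (lt_le_trans sx xs); rewrite ltxx.
have : mu `]-oo, t]%classic = (mu `]-oo, s]%classic + mu `]s, t]%classic)%E.
  by rewrite {1}E measureU//; exact/disj_set2P.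
have f1 : mu `]-oo, t]%classic \is a fin_num by apply: fin_num_measure; exact: measurable_itv.
have f2 : mu `]-oo, s]%classic \is a fin_num by apply: fin_num_measure; exact: measurable_itv.
have f3 : mu `]s, t]%classic \is a fin_num by apply: fin_num_measure; exact: measurable_itv.
rewrite /pcdf -(fineK f3) -(fineK f1) -(fineK f2) /= => -[->].
by congr EFin; ring.
Qed.

Lemma measurable_indic_ray (t : R) : measurable_fun setT (\1_(`]-oo, t]%classic) : R -> R).
Proof. by apply: measurable_indic; exact: measurable_itv. Qed.

Lemma pcdf_cvg_seq (u : nat -> R) t : mu [set t] = 0%E -> u n @[n --> \oo] --> t ->
  pcdf (u n) @[n --> \oo] --> pcdf t.
Proof.
move=> mt ut; rewrite pcdfE; under eq_cvg do rewrite pcdfE.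
apply: (@bounded_cvg_ae _ _ 1 t) => //.
  by move=> n x; rewrite indicE; case: (_ \in _); rewrite ?normr1 ?normr0.
move=> x xt; apply: cvg_near_cst.
have e0 : 0 < `|x - t| by rewrite normr_gt0 subr_eq0.
move/cvgrPdist_lt : ut => /(_ _ e0); apply: filterS => n h.
rewrite !indicE; congr (nat_of_bool _)%:R; apply/idP/idP; rewrite !inE /= !in_itv/= => h2.
  rewrite leNgt; apply/negP => tx; move: h; rewrite ltNge => /negP; apply.
  by rewrite gtr0_norm ?subr_gt0// distrC (le_trans _ (ler_norm _))// lerB.
rewrite leNgt; apply/negP => tx; move: h; rewrite ltNge => /negP; apply.
by rewrite ler0_norm ?subr_le0// opprB (le_trans _ (ler_norm _))// lerB// ltW.
Qed.

(** An affine image of the distribution function convolved with a Cauchy law of scale y,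
    in a form that can be differentiated under the integral. *)
Definition smoothed_cdf (y t : R) : R := Rintegral mu setT (fun x => atan ((t - x) / y)).

Lemma continuous_atan_div (y t : R) : continuous (fun x => atan ((t - x) / y)).
Proof.
move=> x; apply: (@continuous_comp _ _ _ (fun x => (t - x) / y) atan); last exact: continuous_atan.
by apply: cvgM; [apply: cvgB; [exact: cvg_cst|exact: cvg_id]|exact: cvg_cst].
Qed.

Lemma atan_le_pi (x : R) : `|atan x| <= pi.
Proof.
have := atan_gtNpi2 x; have := atan_ltpi2 x; have := pi_gt0 R.
rewrite ler_norml; lra.
Qed.

Lemma atan_div_integrable y t : mu.-integrable setT (EFin \o (fun x => atan ((t - x) / y))).
Proof.
apply: (@bounded_integrable _ pi); last by move=> x; exact: atan_le_pi.
by apply: continuous_measurable_fun; exact: continuous_atan_div.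
Qed.

Lemma is_derive_atan_div (y t x : R) : 0 < y -> is_derive t 1 (fun s => atan ((s - x) / y)) (poisson t y x).
Proof.
move=> y0; rewrite /poisson -sqrrN opprB; apply: is_derive_atan_sub.
by rewrite gt_eqF.
Qed.

Lemma is_derive_smoothed_cdf (y t : R) : 0 < y ->
  is_derive t 1 (smoothed_cdf y) (Rintegral mu setT (poisson t y)).
Proof.
move=> y0.
have pd s x : partial1of2 (fun t x => atan ((t - x) / y)) s x = poisson s y x.
  by rewrite /partial1of2 derive1E; case: (is_derive_atan_div s x y0).
pose f (s : R) (x : measurableTypeR R) : R := atan ((s - x) / y).
have tin : `]t - 1, t + 1[%classic t by rewrite /= in_itv/=; lra.
have h1 s : `]t - 1, t + 1[%classic s -> mu.-integrable setT (EFin \o f s).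
  by move=> _; exact: atan_div_integrable.
have h2 s x : `]t - 1, t + 1[%classic s -> setT x -> derivable (f^~ x) s 1.
  by move=> _ _; have [] := is_derive_atan_div s x y0.
have h3 : mu.-integrable setT (EFin \o (cst y^-1 : measurableTypeR R -> R)).
  exact: finite_measure_integrable_cst.
have h4 s x : `]t - 1, t + 1[%classic s -> setT x -> `|partial1of2 f s x| <= cst y^-1 x.
  by move=> _ _; rewrite pd ger0_norm ?poisson_ge0// poisson_le.
have y'0 (x : measurableTypeR R) : 0 <= cst y^-1 x by rewrite /= invr_ge0 ltW.
apply: DeriveDef.
  exact: (derivable_under_integral measurableT tin h1 h2 y'0 h3 h4).
rewrite -derive1E (differentiation_under_integral measurableT tin h1 h2 y'0 h3 h4).
by apply: eq_Rintegral => x _; exact: pd.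
Qed.

Lemma smoothed_cdf_cvg (t : R) : mu [set t] = 0%E ->
  smoothed_cdf (n.+1%:R^-1) t @[n --> \oo] --> pi * pcdf t - pi / 2.
Proof.
move=> mt.
have mi := measurable_indic_ray t.
have i1 : mu.-integrable setT (EFin \o (\1_(`]-oo, t]%classic) : R -> R)).
  apply: (@bounded_integrable _ 1) => // x.
  by rewrite indicE; case: (_ \in _); rewrite ?normr1 ?normr0.
have i2 : mu.-integrable setT (EFin \o (cst (pi / 2) : R -> R)).
  exact: finite_measure_integrable_cst.
have i3 : mu.-integrable setT (EFin \o (fun x => pi * \1_(`]-oo, t]%classic) x)).
  have := integrableZl measurableT pi i1; by apply: eq_integrable => // x _; rewrite /= EFinM.
have -> : pi * pcdf t - pi / 2 = Rintegral mu setT (fun x => pi * \1_(`]-oo, t]%classic) x - cst (pi / 2) x).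
  rewrite RintegralB// RintegralZl// -pcdfE; congr (_ - _).
  rewrite Rintegral_cst// -[LHS]mulr1; congr (_ * _); apply/esym.
  have muT : fine (mu setT) = 1 by rewrite probability_setT.
  exact: muT.
apply: (@bounded_cvg_ae _ _ pi t) => //.
- by move=> n; apply: continuous_measurable_fun; exact: continuous_atan_div.
- by apply: measurable_funB => //; apply: measurable_funM => //.
- by move=> n x; exact: atan_le_pi.
move=> x xt; rewrite indicE.
have ar : (t - x) / n.+1%:R^-1 @[n --> \oo] --> if x < t then +oo else -oo%R.
  case: ltP => xt'.
    apply/cvgryPge => A; near=> n; rewrite invrK mulrC -ler_pdivrMr ?subr_gt0//.
    rewrite -natr1 ler_wpDr//; near: n; exact: nbhs_infty_ger.
  have tx : t < x by rewrite lt_neqAle eq_sym xt.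
  apply/cvgrNyPle => A; near=> n; rewrite invrK mulrC -ler_ndivrMr ?subr_lt0//.
  rewrite -natr1 ler_wpDr//; near: n; exact: nbhs_infty_ger.
case: ltP ar => xt' ar.
  rewrite (_ : (x \in `]-oo, t]%classic) = true) ?mulr1; last first.
    by apply: mem_set; rewrite /= in_itv/= ltW.
  rewrite [X in _ --> X](_ : _ = pi / 2); last by rewrite /=; lra.
  exact: cvg_comp ar (@cvgy_atan R).
have tx : t < x by rewrite lt_neqAle eq_sym xt.
rewrite memNset; last by rewrite /= in_itv/=; apply/negP; rewrite -ltNge.
rewrite mulr0 sub0r; exact: cvg_comp ar (@cvgNy_atan R).
Unshelve. all: by end_near. Qed.

(** The mean value theorem for the smoothed distribution function, whose derivative is the
    Poisson integral, and then y -> 0 along 1 / (n + 1). *)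
Lemma pcdf_local (x0 w0 eps delta y0 s t : R) : 0 < y0 ->
  (forall t y, `|t - x0| < delta -> 0 < y < y0 -> `|Rintegral mu setT (poisson t y) - pi * w0| <= pi * eps) ->
  mu [set s] = 0%E -> mu [set t] = 0%E ->
  `|s - x0| < delta -> `|t - x0| < delta -> s < t ->
  `|pcdf t - pcdf s - w0 * (t - s)| <= eps * (t - s).
Proof.
move=> y00 loc ms mt sx tx st.
have pi0 := @pi_gt0 R.
have cv : `|smoothed_cdf n.+1%:R^-1 t - smoothed_cdf n.+1%:R^-1 s - pi * w0 * (t - s)| @[n --> \oo] -->
    `|pi * (pcdf t - pcdf s) - pi * w0 * (t - s)|.
  apply: cvg_norm; apply: cvgB; last exact: cvg_cst.
  rewrite (_ : pi * _ = pi * pcdf t - pi / 2 - (pi * pcdf s - pi / 2)); last by ring.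
  by apply: cvgB; exact: smoothed_cdf_cvg.
rewrite -(ler_pM2l pi0) -[in leLHS](gtr0_norm pi0) -normrM.
have -> : pi * (pcdf t - pcdf s - w0 * (t - s)) = pi * (pcdf t - pcdf s) - pi * w0 * (t - s) by ring.
have /cvg_lim <- // := cv.
apply: limr_le; first by apply/cvg_ex; eexists; exact: cv.
near=> n.
have yn : 0 < (n.+1%:R^-1 : R) < y0.
  rewrite invr_gt0 ltr0n /= -[ltRHS]invrK ltf_pV2 ?posrE ?invr_gt0//.
  rewrite -natr1 ltr_pwDr//; near: n; exact: nbhs_infty_ger.
have [yn0 _] := andP yn.
(* The mean value point lies between s and t, hence also within delta of x0. *)
have [||c cin e] := @MVT _ (smoothed_cdf n.+1%:R^-1) (fun t => Rintegral mu setT (poisson t n.+1%:R^-1)) s t st.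
  by move=> x _; exact: is_derive_smoothed_cdf.
  apply: derivable_within_continuous => x _.
  by have [] := is_derive_smoothed_cdf x yn0.
rewrite /= e -mulrBl normrM [`|t - s|]gtr0_norm ?subr_gt0// mulrA ler_pM2r ?subr_gt0//.
apply: loc => //; move: cin; rewrite in_itv/= => /andP[sc ct].
move: sx tx; rewrite !ltr_norml; move: sc ct; clear; lra.
Unshelve. all: by end_near. Qed.

Lemma is_derive_pcdf (x0 w0 : R) (r : R) : 0 < r ->
  (forall x, `|x - x0| < r -> mu [set x] = 0%E) ->
  (forall eps, 0 < eps -> exists delta y0, [/\ 0 < delta, 0 < y0 &
    forall t y, `|t - x0| < delta -> 0 < y < y0 ->
      `|Rintegral mu setT (poisson t y) - pi * w0| <= eps]) ->
  is_derive x0 1 pcdf w0.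
Proof.
move=> r0 na loc.
have cv : h^-1 *: (pcdf (h *: 1 + x0) - pcdf x0) @[h --> 0^'] --> w0.
  apply/cvgrPdist_le => e e0.
  have pe0 : 0 < pi * e by rewrite mulr_gt0 ?pi_gt0.
  have [delta [y0 [d0 y00 hd]]] := loc _ pe0.
  near=> h.
  have hn0 : h != 0 by near: h; exact: nbhs_dnbhs_neq.
  have hd1 : `|h| < delta by near: h; exact: dnbhs0_lt.
  have hr : `|h| < r by near: h; exact: dnbhs0_lt.
  have -> : h *: 1 = h by rewrite /GRing.scale /= mulr1.
  have key s t : `|s - x0| < delta -> `|t - x0| < delta -> `|s - x0| < r -> `|t - x0| < r -> s < t ->
     `|pcdf t - pcdf s - w0 * (t - s)| <= e * (t - s).
    by move=> s1 t1 s2 t2; apply: (pcdf_local y00 hd) => //; exact: na.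
  have x00 : `|x0 - x0| = 0 by rewrite subrr normr0.
  have hx0 : `|h + x0 - x0| = `|h| by rewrite addrK.
  have -> : w0 - h^-1 *: (pcdf (h + x0) - pcdf x0) = - h^-1 * (pcdf (h + x0) - pcdf x0 - w0 * h).
    by rewrite /GRing.scale /=; field.
  rewrite normrM normrN normfV mulrC ler_pdivrMr ?normr_gt0//.
  have [h0|h0|h0] := ltgtP h 0; last by rewrite h0 eqxx in hn0.
    have := key (h + x0) x0; rewrite x00 hx0 => /(_ hd1 d0 hr r0).
    rewrite -[X in _ < X -> _]add0r ltrD2r => /(_ h0).
    rewrite (ltr0_norm h0) -normrN; congr (_ <= _); last by ring.
    by congr `|_|; ring.
  have := key x0 (h + x0); rewrite x00 hx0 => /(_ d0 hd1 r0 hr).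
  rewrite -[X in X < _ -> _]add0r ltrD2r => /(_ h0).
  rewrite (gtr0_norm h0); congr (_ <= _); last by ring.
  by congr `|_|; ring.
apply: DeriveDef; first by apply/cvg_ex; exists w0.
by apply/cvg_lim.
Unshelve. all: by end_near. Qed.

Lemma density_measure_exists (f : R -> R) : measurable_fun setT f -> (forall x, 0 <= f x) ->
  exists m : {measure set (measurableTypeR R) -> \bar R},
    forall A, m A = (\int[Leb]_(x in A) (f x)%:E)%E.
Proof.
move=> mf f0.
pose g (A : set (measurableTypeR R)) : \bar R := (\int[Leb]_(x in A) (f x)%:E)%E.
have g00 : g set0 = 0%E by rewrite /g integral_set0.
have g0 A : (0 <= g A)%E by apply: integral_ge0 => x _; rewrite lee_fin.
have gs : semi_sigma_additive g.
  move=> F mF tF mUF; rewrite /g; apply: cvg_toP.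
    apply: ereal_nondecreasing_is_cvgn => m n mn.
    by apply: lee_sum_nneg_natr => // k _ _; exact: g0.
  rewrite ge0_integral_bigcup//=.
    by apply/measurable_EFinP; exact: measurable_funTS.
  by move=> x _; rewrite lee_fin.
pose M : {measure set (measurableTypeR R) -> \bar R} :=
  HB.pack g (isMeasure.Build _ _ _ g g00 g0 gs).
by exists M.
Qed.

Lemma measure_trace_itv (m : {measure set (measurableTypeR R) -> \bar R}) (c d s t : R) :
  m [set Num.max s c] = 0%E ->
  m (`]s, t]%classic `&` `[c, d]%classic) = m (`]Num.max s c, Num.min t d]%classic).
Proof.
set s1 := Num.max s c; set t1 := Num.min t d => m0.
have mA : measurable (`]s, t]%classic `&` `[c, d]%classic : set (measurableTypeR R)).
  by apply: measurableI; exact: measurable_itv.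
have mB : measurable (`]s1, t1]%classic : set (measurableTypeR R)) by exact: measurable_itv.
have ms : measurable ([set s1] : set (measurableTypeR R)) by exact: measurable_set1.
apply/eqP; rewrite eq_le; apply/andP; split.
  apply: (@le_trans _ _ (m ([set s1] `|` `]s1, t1]%classic))).
    apply: le_measure; rewrite ?inE//; first exact: measurableU.
    move=> x [] /=; rewrite !in_itv/= => /andP[sx xt] /andP[cx xd].
    have [->|xs] := eqVneq x s1; first by left.
    right; rewrite /t1 le_min xt xd !andbT lt_neqAle eq_sym xs /= /s1 ge_max cx andbT.
    exact: ltW.
  apply: (le_trans (measureU2 _ _ _)) => //.
  by rewrite [X in (X + _)%E](_ : _ = 0%E) ?add0e//; exact: m0.
apply: le_measure; rewrite ?inE// => x /=; rewrite !in_itv/=.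
by rewrite /s1 /t1 gt_max le_min => /andP[/andP[-> cx] /andP[-> ->]]; rewrite (ltW cx).
Qed.

(** Inside the interval the distribution function has derivative w, by the fundamental
    theorem of calculus mu and w dx agree on subintervals, and measures that agree on
    half-open intervals are equal. *)
Lemma density_of_local_poisson (c d : R) (w : R -> R) : c < d ->
  {within `[c, d], continuous w} -> (forall x, x \in `[c, d] -> 0 <= w x) ->
  (forall x, x \in `[c, d] -> mu [set x] = 0%E) ->
  (forall x0, x0 \in `]c, d[ -> forall eps, 0 < eps -> exists delta y0, [/\ 0 < delta, 0 < y0 &
    forall t y, `|t - x0| < delta -> 0 < y < y0 ->
      `|Rintegral mu setT (poisson t y) - pi * w x0| <= eps]) ->
  forall A : set (measurableTypeR R), measurable A -> A `<=` `[c, d]%classic ->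
    mu A = (\int[Leb]_(x in A) (w x)%:E)%E.
Proof.
move=> cd cw w0 na loc.
have dF x0 : x0 \in `]c, d[ -> is_derive x0 1 pcdf (w x0).
  move=> x0cd; have := x0cd; rewrite in_itv/= => /andP[cx0 x0d].
  apply: (@is_derive_pcdf x0 (w x0) (Num.min (x0 - c) (d - x0))).
  - by rewrite lt_min !subr_gt0 cx0.
  - move=> x; rewrite lt_min => /andP[h1 h2]; apply: na; rewrite in_itv/=.
    move: h1 h2; rewrite !ltr_norml => /andP[h1 h1'] /andP[h2 h2'].
    apply/andP; split; move: h1 h1' h2 h2'; clear; lra.
  - exact: loc.
have lcont t : t \in `[c, d] -> pcdf x @[x --> t^'-] --> pcdf t.
  by move=> tK; apply/cvg_at_leftP => u [_ ut]; apply: pcdf_cvg_seq => //; exact: na.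
have rcont t : t \in `[c, d] -> pcdf x @[x --> t^'+] --> pcdf t.
  by move=> tK; apply/cvg_at_rightP => u [_ ut]; apply: pcdf_cvg_seq => //; exact: na.
have ftc s t : c <= s -> s < t -> t <= d ->
    (\int[Leb]_(x in `[s, t]) (w x)%:E = (pcdf t)%:E - (pcdf s)%:E)%E.
  move=> cs st td; apply: continuous_FTC2 => //.
  - apply: continuous_subspaceW cw; apply: subset_itvScc; by rewrite bnd_simp.
  - split.
    + move=> x; rewrite in_itv/= => /andP[sx xt].
      by case: (dF x); rewrite // in_itv/= (le_lt_trans cs sx) (lt_le_trans xt td).
    + by apply: rcont; rewrite in_itv/= cs (le_trans (ltW st) td).
    + by apply: lcont; rewrite in_itv/= td (le_trans cs (ltW st)).
  - move=> x; rewrite in_itv/= => /andP[sx xt]; rewrite derive1E.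
    by case: (dF x); rewrite // in_itv/= (le_lt_trans cs sx) (lt_le_trans xt td).
pose K : set (measurableTypeR R) := `[c, d]%classic.
have mK : measurable K by exact: measurable_itv.
have mw : measurable_fun K w by exact: subspace_continuous_measurable_fun.
(* w may be negative or non-measurable off K; only its restriction matters. *)
pose f : R -> R := w \_ K.
have mf : measurable_fun setT f by apply/(measurable_restrictT _ mK).
have f0 x : 0 <= f x.
  by rewrite /f patchE; case: ifPn => // xK; apply: w0; move: xK; rewrite inE.
have [m hm] := density_measure_exists mf f0.
have mE (A : set (measurableTypeR R)) : A `<=` K -> m A = (\int[Leb]_(x in A) (w x)%:E)%E.
  move=> AK; rewrite hm; apply: eq_integral => x; rewrite inE => Ax.
  by rewrite /f patchE mem_set//; exact: AK.
have mpt x : x \in `[c, d] -> m [set x] = 0%E.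
  move=> xK; rewrite hm integral_set1//.
have mitv s t : c <= s -> t <= d -> m `]s, t]%classic = mu `]s, t]%classic.
  move=> cs td; have [ts|st] := leP t s.
    by rewrite set_itv_ge ?measure0// bnd_simp -leNgt.
  rewrite mE; last first.
    move=> x /=; rewrite /K /= !in_itv/= => /andP[sx xt].
    by rewrite (le_trans cs (ltW sx)) (le_trans xt td).
  rewrite integral_itv_obnd_cbnd; last first.
    apply/measurable_EFinP; apply: measurable_funS mw => //.
    move=> x /=; rewrite /K /= !in_itv/= => /andP[sx xt].
    by rewrite (le_trans cs (ltW sx)) (le_trans xt td).
  by rewrite ftc// pcdf_itv ?ltW// EFinB.
pose M1 : {measure set (measurableTypeR R) -> \bar R} := mrestr mu mK.
pose M2 : {measure set (measurableTypeR R) -> \bar R} := mrestr m mK.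
have main (A : set (measurableTypeR R)) : measurable A -> M1 A = M2 A.
  have g1 : @measurable _ (measurableTypeR R) = <<s (@ocitv R : set (set (measurableTypeR R))) >> by [].
  have g2 : setI_closed (@ocitv R : set (set (measurableTypeR R))) by exact: ocitvI.
  pose g (k : nat) : set (measurableTypeR R) := `](- k%:R), k%:R]%classic.
  move: A; apply: (@measure_unique _ R (measurableTypeR R) _ g g1 g2).
  - by move=> k; exact: is_ocitv.
  - exact: bigcup_itvT.
  - move=> B [[s t] _ <-]; rewrite /M1 /M2 /= /mrestr.
    (* The trace of ]s, t] on [c, d] is half-open up to the point max s c, which neither
       measure charges. *)
    case: (leP (Num.max s c) d) => [sd|ds].
      have sK : Num.max s c \in `[c, d] by rewrite in_itv/= sd le_max lexx orbT.
      rewrite measure_trace_itv; last exact: na.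
      rewrite measure_trace_itv; last exact: mpt.
      by apply/esym/mitv; rewrite ?le_max ?ge_min lexx orbT.
    have -> : `]s, t]%classic `&` K = set0.
      rewrite -subset0 /K => x [] /=; rewrite !in_itv/= => /andP[sx _] /andP[cx xd].
      by move: ds; rewrite ltNge => /negP; apply; rewrite ge_max (le_trans (ltW sx) xd) (ltW cd).
    by rewrite !measure0.
  - move=> k; rewrite (le_lt_trans (probability_le1 _ _)) ?ltry//.
    by apply: measurableI => //; exact: measurable_itv.
move=> A mA AK; rewrite -mE//.
by have := main A mA; rewrite /M1 /M2 /= /mrestr (setIidl AK).
Qed.

End DistributionFunction.

(** * Uniform convergence on a set *)

Section Uniform.
Variable R : realType.
Implicit Types (K : set R) (f g : R -> R) (fs gs : nat -> R -> R) (d : nat -> R).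

(** Summability through its Cauchy criterion, the only form in which it is used. *)
Definition summable_seq d := (forall n, 0 <= d n) /\
  forall e, 0 < e -> exists J, forall j m, (J <= j)%N -> \sum_(j <= k < m) d k <= e.

Lemma bounded_sum_summable d S : (forall n, 0 <= d n) ->
  (forall m, \sum_(0 <= k < m) d k <= S) -> summable_seq d.
Proof.
move=> d0 dS; split => // e e0.
pose P := [set \sum_(0 <= k < m) d k | m in [set: nat]].
have hP : has_sup P by split; [exists (\sum_(0 <= k < 0) d k), 0%N|exists S => _ [m _ <-]].
have [_ [J _ <-] hJ] := sup_adherent e0 hP.
exists J => j m Jj.
have [mj|jm] := leqP m j; first by rewrite big_geq// ltW.
have h1 : \sum_(0 <= k < m) d k <= sup P by apply: ub_le_sup; [exists S => _ [i _ <-]|exists m].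
have h2 : \sum_(0 <= k < j) d k + \sum_(j <= k < m) d k = \sum_(0 <= k < m) d k.
  by rewrite -big_cat_nat// ltnW.
have h3 : \sum_(0 <= k < J) d k <= \sum_(0 <= k < j) d k.
  by rewrite [leRHS](@big_cat_nat _ _ _ J)//= lerDl sumr_ge0.
move: hJ h1 h2 h3; clear; lra.
Qed.

Lemma euclidean_norm_ge n (v : 'cV[R]_n) k : `|v k 0| <= euclidean_norm v.
Proof.
rewrite /euclidean_norm -sqrtr_sqr ler_wsqrtr// (bigD1 k)//= lerDl.
by apply: sumr_ge0 => i _; exact: sqr_ge0.
Qed.

Lemma entry_le_spectral_norm n (A : 'M[R]_n) k l : `|A k l| <= spectral_norm A.
Proof.
pose e : 'cV[R]_n := \col_i (i == l)%:R.
have Ae : (A *m e) k 0 = A k l.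
  rewrite mxE (bigD1 l)//= mxE eqxx mulr1 big1 ?addr0// => i il.
  by rewrite mxE (negbTE il) mulr0.
have ne : euclidean_norm e <= 1.
  rewrite /euclidean_norm -sqrtr1 ler_wsqrtr// (bigD1 l)//= mxE eqxx expr1n big1 ?addr0// => i il.
  by rewrite mxE (negbTE il) expr0n.
rewrite -Ae (le_trans (euclidean_norm_ge _ _))//.
apply: ub_le_sup; last by exists e.
pose B := \sum_(i < n) (\sum_(j < n) `|A i j|) ^+ 2.
exists (Num.sqrt B) => _ [v /= v1 <-].
rewrite ler_wsqrtr//; apply: ler_sum => i _.
rewrite -real_normK ?num_real// lerXn2r ?nnegrE ?sumr_ge0//.
rewrite mxE (le_trans (ler_norm_sum _ _ _))//; apply: ler_sum => j _.
by rewrite normrM ler_piMr// (le_trans (euclidean_norm_ge _ _)).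
Qed.

(** The operator norm dominates every entry, so the bounded total variation in the norm
    passes to the entries with one majorant for all of them. *)
Lemma D1_entries K (Y : nat -> R -> 'M[R]_2) : K !=set0 -> D1 K Y ->
  exists2 d, summable_seq d & forall n x k l, (0 < n)%N -> K x ->
    `|Y n.+1 x k l - Y n x k l| <= d n.
Proof.
move=> [x0 Kx0] [_ fin].
pose s n := ereal_sup [set (spectral_norm (Y n.+1 x - Y n x))%:E | x in K].
have ub n x k l : K x -> ((`|Y n.+1 x k l - Y n x k l|)%:E <= s n)%E.
  move=> Kx; apply: (@le_trans _ _ (spectral_norm (Y n.+1 x - Y n x))%:E).
    by rewrite lee_fin; have := entry_le_spectral_norm (Y n.+1 x - Y n x) k l; rewrite !mxE.
  by apply: ereal_sup_ubound; exists x.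
have s0 n : (0 <= s n)%E by apply: le_trans (ub n x0 0 0 Kx0); rewrite lee_fin.
have part k : (\sum_(1 <= i < k) s i <= \sum_(1 <= i <oo) s i)%E by apply: nneseries_lim_ge.
have Sfin : (\sum_(1 <= i <oo) s i)%E \is a fin_num.
  by rewrite ge0_fin_numE//; apply: nneseries_ge0.
have sfin n : (0 < n)%N -> s n \is a fin_num.
  move=> n0; rewrite ge0_fin_numE//; apply: le_lt_trans fin.
  apply: le_trans (part n.+1); rewrite big_nat_recr//= leeDr// sume_ge0//.
pose d n := if n is 0 then 0 else fine (s n).
have dE n : (0 < n)%N -> (d n)%:E = s n by case: n => // n _; rewrite /d fineK// sfin.
have d0 n : 0 <= d n by case: n => //= n; rewrite fine_ge0.
exists d; last by move=> n x k l n0 Kx; rewrite -lee_fin dE//; exact: ub.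
apply: (@bounded_sum_summable _ (fine (\sum_(1 <= i <oo) s i)%E)) => // m.
rewrite -lee_fin fineK//; apply: le_trans (part m).
case: m => [|m]; first by rewrite !big_geq.
rewrite big_ltn//= add0r -sumEFin (eq_big_nat _ _ (F2 := s))// => i /andP[i1 _].
by rewrite dE.
Qed.

Definition unif_cvg K (fs : nat -> R -> R) f := forall e, 0 < e ->
  exists J, forall j x, (J <= j)%N -> K x -> `|fs j x - f x| <= e.

Definition bounded_fun_on K f := exists B, forall x, K x -> `|f x| <= B.

Lemma unif_cvg_cvg K fs f x : unif_cvg K fs f -> K x -> fs j x @[j --> \oo] --> f x.
Proof.
move=> h Kx; apply/cvgrPdist_le => e e0; have [J hJ] := h e e0.
by exists J => // j /= Jj; rewrite distrC hJ.
Qed.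

Lemma unif_cvg_summable K fs d C : summable_seq d ->
  (exists J, forall j x, (J <= j)%N -> K x -> `|fs j.+1 x - fs j x| <= C * d j) ->
  exists f, unif_cvg K fs f.
Proof.
move=> [d0 dt] [J0 hJ0].
have C0 : C <= `|C| + 1 by have := ler_norm C; lra.
have C1 : 0 < `|C| + 1 by have := normr_ge0 C; lra.
have tele j m x : (J0 <= j <= m)%N -> K x -> `|fs m x - fs j x| <= (`|C| + 1) * \sum_(j <= k < m) d k.
  move=> /andP[Jj jm] Kx; rewrite -(telescope_sumr (fun k => fs k x) jm) mulr_sumr.
  apply: (le_trans (ler_norm_sum _ _ _)); rewrite big_nat_cond [leRHS]big_nat_cond.
  apply: ler_sum => k; rewrite andbT => /andP[jk _].
  by apply: (le_trans (hJ0 _ _ (leq_trans Jj jk) Kx)); rewrite ler_wpM2r.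
have key e : 0 < e -> exists J, forall j m x, (J <= j <= m)%N -> K x -> `|fs m x - fs j x| <= e.
  move=> e0; have [J hJ] := dt (e / (`|C| + 1)) (divr_gt0 e0 C1).
  exists (maxn J J0) => j m x /andP[]; rewrite geq_max => /andP[Jj J0j] jm Kx.
  apply: (le_trans (tele j m x _ Kx)); first by rewrite J0j.
  by rewrite -ler_pdivlMl// mulrC hJ.
have cv x : K x -> cvgn (fs ^~ x).
  move=> Kx; apply: cauchy_cvg; apply: cauchy_exP => e e0.
  have e20 : 0 < e / 2 by rewrite divr_gt0.
  have [J hJ] := key _ e20; exists (fs J x); exists J => // j /= Jj.
  rewrite /ball /= distrC (le_lt_trans (hJ J j x _ Kx)) ?leqnn//.
  by rewrite ltr_pdivrMr// ltr_pMr// ltr1n.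
exists (fun x => lim (fs j x @[j --> \oo])) => e e0.
have [J hJ] := key e e0; exists J => j x Jj Kx.
have c1 : `|fs m x - fs j x| @[m --> \oo] --> `|lim (fs k x @[k --> \oo]) - fs j x|.
  by apply: cvg_norm; apply: cvgB; [exact: cv|exact: cvg_cst].
rewrite distrC; have /cvg_lim <- // := c1.
apply: limr_le; first by apply/cvg_ex; eexists; exact: c1.
by exists j => // m /= jm; rewrite hJ// Jj.
Qed.

Lemma unif_cvg_continuous K fs f : (forall j, {within K, continuous (fs j)}) ->
  unif_cvg K fs f -> {within K, continuous f}.
Proof.
move=> cf h; apply/subspace_continuousP => x Kx; apply/cvgrPdist_le => e e0.
have e30 : 0 < e / 3 by rewrite divr_gt0.
have [J hJ] := h _ e30.
have := cf J => /subspace_continuousP /(_ x Kx) /cvgrPdist_le /(_ _ e30).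
rewrite /prop_near1 /nbhs /= /within /=; apply: filterS => y hy Ky.
have h1 := hJ J x (leqnn J) Kx; have h2 := hJ J y (leqnn J) Ky; have h3 := hy Ky.
move: h1 h2 h3; rewrite distrC.
have := ler_distD (fs J x) (f x) (f y); have := ler_distD (fs J y) (fs J x) (f y); clear; lra.
Qed.

Lemma unif_cvgD K fs f gs g : unif_cvg K fs f -> unif_cvg K gs g ->
  unif_cvg K (fun j x => fs j x + gs j x) (fun x => f x + g x).
Proof.
move=> hf hg e e0; have e20 : 0 < e / 2 by rewrite divr_gt0.
have [J1 h1] := hf _ e20; have [J2 h2] := hg _ e20.
exists (maxn J1 J2) => j x; rewrite geq_max => /andP[j1 j2] Kx.
rewrite opprD addrACA (le_trans (ler_normD _ _))// [e]splitr lerD ?h1 ?h2//.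
Qed.

Lemma unif_cvgM K fs f gs g : bounded_fun_on K f -> bounded_fun_on K g ->
  unif_cvg K fs f -> unif_cvg K gs g -> unif_cvg K (fun j x => fs j x * gs j x) (fun x => f x * g x).
Proof.
move=> [B hB] [C hC] hf hg e e0.
pose M := `|B| + `|C| + 1.
have M1 : 1 <= M by rewrite /M; have := normr_ge0 B; have := normr_ge0 C; lra.
have M0 : 0 < M by lra.
pose e' := Num.min 1 (e / (3 * M)).
have e'0 : 0 < e' by rewrite lt_min ltr01 divr_gt0// mulr_gt0.
have [J1 h1] := hf _ e'0; have [J2 h2] := hg _ e'0.
exists (maxn J1 J2) => j x; rewrite geq_max => /andP[j1 j2] Kx.
have a1 := h1 j x j1 Kx; have a2 := h2 j x j2 Kx.
have b1 : `|f x| <= M.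
  by have := hB x Kx; have := ler_norm B; have := normr_ge0 C; rewrite /M; lra.
have b2 : `|g x| <= M.
  by have := hC x Kx; have := ler_norm C; have := normr_ge0 B; rewrite /M; lra.
have -> : fs j x * gs j x - f x * g x =
  (fs j x - f x) * (gs j x - g x) + f x * (gs j x - g x) + (fs j x - f x) * g x by ring.
have e1 : e' <= 1 by rewrite ge_min lexx.
have e2 : M * e' <= e / 3.
  have : e' <= e / (3 * M) by rewrite ge_min lexx orbT.
  rewrite ler_pdivlMr ?mulr_gt0//; lra.
apply: (le_trans (ler_normD _ _)); apply: (@le_trans _ _ (e / 3 + e / 3 + e / 3)); last by lra.
apply: lerD.
  apply: (le_trans (ler_normD _ _)); apply: lerD.
    rewrite normrM (le_trans _ e2)// mulrC [M * _]mulrC.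
    by apply: ler_pM => //; apply: le_trans M1; apply: le_trans e1.
  by rewrite normrM (le_trans _ e2)// ler_pM.
by rewrite normrM (le_trans _ e2)// mulrC ler_pM.
Qed.

Lemma unif_cvgN K fs f : unif_cvg K fs f -> unif_cvg K (fun j x => - fs j x) (fun x => - f x).
Proof.
by move=> hf e e0; have [J h] := hf e e0; exists J => j x Jj Kx; rewrite -opprD normrN h.
Qed.

Lemma unif_cvgZ K (c : R) fs f : unif_cvg K fs f -> unif_cvg K (fun j x => c * fs j x) (fun x => c * f x).
Proof.
move=> hf e e0.
have c1 : 0 < `|c| + 1 by have := normr_ge0 c; lra.
have [J h] := hf _ (divr_gt0 e0 c1); exists J => j x Jj Kx.
rewrite -mulrBr normrM; apply: (@le_trans _ _ ((`|c| + 1) * (e / (`|c| + 1)))).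
  by apply: ler_pM => //; [rewrite lerDl|exact: h].
by rewrite mulrC divfK// gt_eqF.
Qed.

Lemma unif_cvg_sqrt K fs f : unif_cvg K fs f ->
  unif_cvg K (fun j x => Num.sqrt (fs j x)) (fun x => Num.sqrt (f x)).
Proof.
move=> hf e e0.
have [J h] := hf (e ^+ 2) (exprn_gt0 _ e0); exists J => j x Jj Kx.
have key (u v : R) : u - v <= e ^+ 2 -> Num.sqrt u - Num.sqrt v <= e.
  move=> uv; rewrite lerBlDr.
  have v0 : v <= Num.sqrt v ^+ 2.
    by have [v0|/ltW v0] := leP 0 v; [rewrite sqr_sqrtr|apply: le_trans v0 (sqr_ge0 _)].
  have -> : e + Num.sqrt v = Num.sqrt ((e + Num.sqrt v) ^+ 2).
    by rewrite sqrtr_sqr ger0_norm// addr_ge0 ?sqrtr_ge0// ltW.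
  apply: ler_wsqrtr.
  rewrite sqrrD; have : 0 <= e * Num.sqrt v by rewrite mulr_ge0 ?sqrtr_ge0 ?ltW.
  by rewrite mulr2n; lra.
have := h j x Jj Kx; rewrite ler_norml => /andP[h1 h2].
by rewrite ler_norml lerNl opprB !key//; lra.
Qed.

Lemma unif_cvg_inv K fs f m : 0 < m -> (forall x, K x -> m <= f x) -> unif_cvg K fs f ->
  unif_cvg K (fun j x => (fs j x)^-1) (fun x => (f x)^-1).
Proof.
move=> m0 fm hf e e0.
have e'0 : 0 < Num.min (m / 2) (e * (m ^+ 2 / 2)).
  by rewrite lt_min divr_gt0// mulr_gt0// divr_gt0// exprn_gt0.
have [J h] := hf _ e'0; exists J => j x Jj Kx.
have := h j x Jj Kx; rewrite le_min => /andP[h1 h2].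
have fx := fm x Kx.
have fj : m / 2 <= fs j x by move: h1; rewrite ler_norml => /andP[h1 _]; lra.
have fj0 : 0 < fs j x by apply: lt_le_trans fj; rewrite divr_gt0.
have fx0 : 0 < f x by apply: lt_le_trans fx.
have -> : (fs j x)^-1 - (f x)^-1 = - (fs j x - f x) / (fs j x * f x) by field; rewrite !gt_eqF.
rewrite normrM normrN normfV [`|fs j x * f x|]gtr0_norm ?mulr_gt0// ?ler_pdivrMr ?mulr_gt0//.
rewrite (le_trans h2)// ler_pM2l//.
have -> : m ^+ 2 / 2 = m / 2 * m by ring.
by rewrite ler_pM// ltW// divr_gt0.
Qed.

Lemma unif_cvg_eq K fs gs f : (exists J, forall j x, (J <= j)%N -> K x -> fs j x = gs j x) ->
  unif_cvg K fs f -> unif_cvg K gs f.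
Proof.
move=> [J0 E] hf e e0; have [J h] := hf e e0.
by exists (maxn J J0) => j x; rewrite geq_max => /andP[j1 j2] Kx; rewrite -E// h.
Qed.

Lemma unif_cvg_cont_bounded K f : compact K -> K !=set0 -> {within K, continuous f} -> bounded_fun_on K f.
Proof.
move=> cK K0 cf.
have [c1 _ h1] := compact_EVT_max K0 cK cf.
have [c2 _ h2] := compact_EVT_min K0 cK cf.
exists (`|f c1| + `|f c2|) => x Kx.
have a1 := h1 x (mem_set Kx); have a2 := h2 x (mem_set Kx).
rewrite ler_norml; apply/andP; split.
  by have := ler_norm (- f c2); rewrite normrN; have := normr_ge0 (f c1); lra.
by have := ler_norm (f c1); have := normr_ge0 (f c2); lra.
Qed.

End Uniform.

(** * Continuous arguments of nonvanishing plane curves *)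

Section ArgumentLift.
Variable R : realType.
Implicit Types (F G eta : R -> R).

(** eta is an argument of F + iG at x. *)
Definition polar (F G eta : R -> R) x :=
  F x = Num.sqrt (F x ^+ 2 + G x ^+ 2) * cos (eta x) /\
  G x = Num.sqrt (F x ^+ 2 + G x ^+ 2) * sin (eta x).

Lemma sincos_atan_div (C D : R) : 0 < D ->
  Num.sqrt (D ^+ 2 + C ^+ 2) * cos (atan (C / D)) = D /\
  Num.sqrt (D ^+ 2 + C ^+ 2) * sin (atan (C / D)) = C.
Proof.
move=> D0.
have e : D ^+ 2 + C ^+ 2 = D ^+ 2 * (1 + (C / D) ^+ 2) by field; rewrite gt_eqF.
have s0 : 0 < Num.sqrt (1 + (C / D) ^+ 2) by rewrite sqrtr_gt0 ltr_pwDl// sqr_ge0.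
have h : Num.sqrt (D ^+ 2 + C ^+ 2) * cos (atan (C / D)) = D.
  by rewrite e sqrtrM ?sqr_ge0// sqrtr_sqr (gtr0_norm D0) cos_atan mulfK// gt_eqF.
split => //.
have c0 : cos (atan (C / D)) != 0 by rewrite cos_atan invr_neq0// gt_eqF.
have t : sin (atan (C / D)) = C / D * cos (atan (C / D)).
  by have := atanK (C / D); rewrite /tan => {2}<-; rewrite divfK.
by rewrite t mulrCA h divfK// gt_eqF.
Qed.

Lemma continuous_dot F G (a b : R) : continuous F -> continuous G ->
  continuous (fun x => a * F x + b * G x).
Proof.
by move=> cF cG x; apply: cvgD; apply: cvgM; [exact: cvg_cst|exact: cF|exact: cvg_cst|exact: cG].
Qed.

(** While the scalar product with (F, G)(s) stays positive, the argument relative to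
    (F, G)(s) is an arctangent; the argument at t is transported by the difference of
    two of them. *)
Lemma polar_extend F G eta (s t x : R) : (forall y, 0 < F y ^+ 2 + G y ^+ 2) ->
  polar F G eta t -> 0 < F s * F t + G s * G t -> 0 < F s * F x + G s * G x ->
  polar F G (fun y => eta t + (atan ((F s * G y - G s * F y) / (F s * F y + G s * G y))
    - atan ((F s * G t - G s * F t) / (F s * F t + G s * G t)))) x.
Proof.
move=> n0 [e1 e2] Dt Dx.
have [a1 a2] := sincos_atan_div (F s * G x - G s * F x) Dx.
have [b1 b2] := sincos_atan_div (F s * G t - G s * F t) Dt.
have sq y : (F s * F y + G s * G y) ^+ 2 + (F s * G y - G s * F y) ^+ 2 =
   (F s ^+ 2 + G s ^+ 2) * (F y ^+ 2 + G y ^+ 2) by ring.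
have rE y : Num.sqrt ((F s * F y + G s * G y) ^+ 2 + (F s * G y - G s * F y) ^+ 2) =
   Num.sqrt (F s ^+ 2 + G s ^+ 2) * Num.sqrt (F y ^+ 2 + G y ^+ 2).
  by rewrite sq sqrtrM// ltW.
rewrite rE in a1 a2; rewrite rE in b1 b2.
set bx := atan _ in a1 a2 *; set bt := atan _ in b1 b2 *.
have r0 y : 0 < Num.sqrt (F y ^+ 2 + G y ^+ 2) by rewrite sqrtr_gt0.
have rs y : Num.sqrt (F y ^+ 2 + G y ^+ 2) ^+ 2 = F y ^+ 2 + G y ^+ 2 by rewrite sqr_sqrtr// ltW.
have h0 := r0 s; have h1 := r0 t.
have g0 := rs s; have g1 := rs t.
rewrite /polar.
have m0 : (Num.sqrt (F s ^+ 2 + G s ^+ 2) * Num.sqrt (F t ^+ 2 + G t ^+ 2)) ^+ 2 != 0.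
  by rewrite expf_neq0// mulf_neq0// gt_eqF.
move: a1 a2 b1 b2 e1 e2 m0 g0 g1 {h0 h1 rs r0 rE}.
move: (Num.sqrt (F s ^+ 2 + _)) (Num.sqrt (F x ^+ 2 + _)) (Num.sqrt (F t ^+ 2 + _)) => r1 r3 r2 a1 a2 b1 b2 e1 e2 m0 g0 g1.
have cB := cosB bx bt; have sB := sinB bx bt; rewrite /= -/bx -/bt [cos (eta t + _)]cosD [sin (eta t + _)]sinD cB sB; split; apply: (mulfI m0).
  transitivity ((r2 * cos (eta t)) * ((r1 * r3 * cos bx) * (r1 * r2 * cos bt) +
      (r1 * r3 * sin bx) * (r1 * r2 * sin bt)) - (r2 * sin (eta t)) *
      ((r1 * r3 * sin bx) * (r1 * r2 * cos bt) - (r1 * r3 * cos bx) * (r1 * r2 * sin bt))); last by ring.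
  by rewrite a1 a2 b1 b2 -e1 -e2 exprMn g0 g1; ring.
transitivity ((r2 * sin (eta t)) * ((r1 * r3 * cos bx) * (r1 * r2 * cos bt) +
    (r1 * r3 * sin bx) * (r1 * r2 * sin bt)) + (r2 * cos (eta t)) *
    ((r1 * r3 * sin bx) * (r1 * r2 * cos bt) - (r1 * r3 * cos bx) * (r1 * r2 * sin bt))); last by ring.
by rewrite a1 a2 b1 b2 -e1 -e2 exprMn g0 g1; ring.
Qed.

Lemma polar_point (F G : R -> R) x : exists e : R, polar F G (fun=> e) x.
Proof.
rewrite /polar; have [z|nz] := eqVneq (F x ^+ 2 + G x ^+ 2) 0.
  have := z; move/eqP; rewrite paddr_eq0 ?sqr_ge0// !sqrf_eq0 => /andP[/eqP -> /eqP ->].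
  by exists 0; rewrite expr0n addr0 sqrtr0 !mul0r.
have n0 : 0 < F x ^+ 2 + G x ^+ 2 by rewrite lt_neqAle eq_sym nz addr_ge0 ?sqr_ge0.
set r := Num.sqrt _; have r0 : 0 < r by rewrite sqrtr_gt0.
have rs : r ^+ 2 = F x ^+ 2 + G x ^+ 2 by rewrite sqr_sqrtr// ltW.
have q1 : (F x / r) ^+ 2 + (G x / r) ^+ 2 = 1.
  by rewrite !expr_div_n -mulrDl -rs divff// expf_neq0// gt_eqF.
have b : -1 <= F x / r <= 1.
  rewrite -ler_norml -(@expr_le1 _ 2)// real_normK ?num_real//.
  by have := sqr_ge0 (G x / r); lra.
have sE : Num.sqrt (1 - (F x / r) ^+ 2) = `|G x / r|.
  by rewrite -sqrtr_sqr -q1 addrAC subrr add0r.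
have [G0|/ltW G0] := leP 0 (G x).
  exists (acos (F x / r)); rewrite acosK// sin_acos// sE ger0_norm ?divr_ge0// ?ltW//.
  by rewrite ![r * _]mulrC !divfK// gt_eqF.
exists (- acos (F x / r)); rewrite cosN sinN acosK// sin_acos// sE ler0_norm.
  by rewrite opprK ![r * _]mulrC !divfK// gt_eqF.
by rewrite -oppr_ge0 -mulNr divr_ge0 ?oppr_ge0// ltW.
Qed.

Lemma continuous_truncate (c d : R) : continuous (fun x : R => Num.min (Num.max x c) d).
Proof.
move=> x; apply: (@continuous_min _ _ (fun x : R => Num.max x c) (fun=> d)); last exact: cvg_cst.
by apply: (@continuous_max _ _ id (fun=> c)); [exact: cvg_id|exact: cvg_cst].
Qed.

(** Let s be the supremum of the points up to which a continuous argument exists. Around s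
    the curve stays in a half-plane, so an argument that is given on [c, t] with t just
    below s extends past s; hence s = d. *)
Lemma argument_lift_line (F G : R -> R) (c d : R) : c <= d -> continuous F -> continuous G ->
  (forall y, 0 < F y ^+ 2 + G y ^+ 2) ->
  exists2 eta : R -> R, continuous eta & forall x, c <= x <= d -> polar F G eta x.
Proof.
move=> cd cF cG n0.
pose T := [set t | c <= t <= d /\
  exists2 eta : R -> R, continuous eta & forall x, c <= x <= t -> polar F G eta x].
have Tc : T c.
  split; first by rewrite lexx.
  have [e he] := polar_point F G c.
  exists (fun=> e); first by move=> x; exact: cvg_cst.
  by move=> x /andP[h1 h2]; have -> : x = c by apply/eqP; rewrite eq_le h1 h2.
have hT : has_sup T by split; [exists c|exists d => t [/andP[]]].
pose s := sup T.
have cs : c <= s by apply: ub_le_sup => //; exists d => t [/andP[]].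
have cdot : continuous (fun y => F s * F y + G s * G y) by exact: continuous_dot.
have cross : continuous (fun y => F s * G y - G s * F y).
  have -> : (fun y => F s * G y - G s * F y) = (fun y => (- G s) * F y + F s * G y).
    by apply/funext => y; rewrite mulNr addrC.
  exact: continuous_dot.
have d0 : 0 < F s * F s + G s * G s by rewrite -!expr2.
have [e /= e0 he] := cvgr_gt _ (cdot s) _ d0.
have {he} near_s y : `|y - s| < e -> 0 < F s * F y + G s * G y.
  by move=> ys; apply: he; rewrite /ball_ /= distrC.
have [t [/andP[ct td] [eta ceta heta]] st] := sup_adherent e0 hT.
have ts : t <= s by apply: ub_le_sup; [exists d => t0 [/andP[]]|split; [rewrite ct|exists eta]].
pose t' := Num.min d (s + e / 2).
have tt' : t <= t' by rewrite le_min td; lra.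
have t's : t' <= s + e / 2 by rewrite ge_min lexx orbT.
pose cl x := Num.min (Num.max x t) t'.
have ccl : continuous cl by exact: continuous_truncate.
have cmin : continuous (fun x => Num.min x t).
  by move=> x; apply: (@continuous_min _ _ id (fun=> t)); [exact: cvg_id|exact: cvg_cst].
have cl_near x : `|cl x - s| < e.
  have h1 : t <= cl x by rewrite le_min tt' le_max lexx orbT.
  have h2 : cl x <= t' by rewrite ge_min lexx orbT.
  rewrite /s in ts t's *; rewrite ltr_norml; lra.
pose B y := atan ((F s * G y - G s * F y) / (F s * F y + G s * G y)).
have T' : T t'.
  split; first by rewrite (le_trans ct)//= ge_min lexx.
  (* cl truncates to [t, t'], where the scalar product with (F, G)(s) is positive; the new
     argument equals eta before t and the transported one after t. *)
  exists (fun x => eta (Num.min x t) + (B (cl x) - B t)).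
    move=> x; apply: cvgD; first exact: (@continuous_comp _ _ _ _ _ x (cmin x) (ceta _)).
    apply: cvgB; last exact: cvg_cst.
    apply: (@continuous_comp _ _ _ cl B x (ccl x)).
    apply: continuous_comp; last exact: continuous_atan.
    apply: cvgM; first exact: cross.
    by apply: cvgV; [rewrite gt_eqF// near_s|exact: cdot].
  move=> x /andP[cx xt'].
  have [xt|/ltW tx] := leP x t.
    have -> : polar F G (fun x => eta (Num.min x t) + (B (cl x) - B t)) x = polar F G eta x.
      rewrite /polar; have -> : cl x = t by rewrite /cl (max_idPr xt) (min_idPl tt').
      by rewrite (min_idPl xt) subrr addr0.
    by apply: heta; rewrite cx.
  have -> : polar F G (fun x => eta (Num.min x t) + (B (cl x) - B t)) x =
            polar F G (fun y => eta t + (B y - B t)) x.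
    rewrite /polar; have -> : cl x = x by rewrite /cl (max_idPl tx) (min_idPl xt').
    by rewrite (min_idPr tx).
  apply: polar_extend => //.
  - by apply: heta; rewrite ct lexx.
  - by apply: near_s; have := cl_near t; rewrite /cl maxxx (min_idPl tt').
  - by apply: near_s; have := cl_near x; rewrite /cl (max_idPl tx) (min_idPl xt').
have t's2 : t' <= s by apply: ub_le_sup => //; exists d => t0 [/andP[]].
have t'd : t' = d.
  by move: t's2; rewrite /t'; have [//|_ h] := leP d (s + e / 2); exfalso; move: h e0; clear; lra.
by move: T'; rewrite t'd => -[_ [eta' h1 h2]]; exists eta'.
Qed.

Lemma continuous_clamp (F : R -> R) (c d : R) : c <= d -> {within `[c, d], continuous F} ->
  continuous (fun x => F (Num.min (Num.max x c) d)).
Proof.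
move=> cd /subspace_continuousP cF x.
pose cl y := Num.min (Num.max y c) d.
have clK y : `[c, d]%classic (cl y).
  by rewrite /= in_itv /= /cl ge_min lexx orbT andbT le_min cd andbT le_max lexx orbT.
have ccl : cl y @[y --> x] --> cl x by exact: continuous_truncate.
apply/cvgrPdist_le => e e0.
have := cF (cl x) (clK x) => /cvgrPdist_le /(_ e e0).
rewrite /prop_near1 /nbhs /= /within /= => h.
have [del /= del0 hd] := h.
move/cvgrPdist_lt: ccl => /(_ _ del0); apply: filterS => y hy.
by apply: hd; [exact: hy|exact: clK].
Qed.

Lemma argument_lift (F G : R -> R) (c d : R) : c <= d ->
  {within `[c, d], continuous F} -> {within `[c, d], continuous G} ->
  (forall x, c <= x <= d -> 0 < F x ^+ 2 + G x ^+ 2) ->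
  exists2 eta : R -> R, {within `[c, d], continuous eta} & forall x, c <= x <= d -> polar F G eta x.
Proof.
move=> cd cF cG n0; pose cl y := Num.min (Num.max y c) d.
have clE x : c <= x <= d -> cl x = x.
  by move=> /andP[h1 h2]; rewrite /cl (max_idPl h1) (min_idPl h2).
have clK x : c <= cl x <= d by rewrite /cl ge_min lexx orbT andbT le_min cd andbT le_max lexx orbT.
have [|eta ce he] := argument_lift_line cd (continuous_clamp cd cF) (continuous_clamp cd cG).
  by move=> y; apply: n0; exact: clK.
exists eta; first exact: continuous_subspaceT.
by move=> x hx; have := he x hx; rewrite /polar -/(cl x) clE.
Qed.

End ArgumentLift.

(** * Shifted Turan determinants and phases *)

Section Acos.
Variable R : realType.

(** The eigenvalues of a real 2 x 2 matrix of trace t and determinant D with negative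
    discriminant - w^2 are D^(1/2) exp(+- i theta), theta being this arccosine. *)
Lemma acos_trace (t D w : R) : 0 < D -> 0 < w -> t ^+ 2 - 4 * D = - w ^+ 2 ->
  [/\ -1 < t / (2 * Num.sqrt D) < 1,
      Num.sqrt D * cos (acos (t / (2 * Num.sqrt D))) = t / 2 &
      Num.sqrt D * sin (acos (t / (2 * Num.sqrt D))) = w / 2].
Proof.
move=> D0 w0 e; set x := t / (2 * _).
have r0 : 0 < Num.sqrt D by rewrite sqrtr_gt0.
have rs : Num.sqrt D ^+ 2 = D by rewrite sqr_sqrtr// ltW.
have tx : Num.sqrt D * x = t / 2 by rewrite /x; field; rewrite gt_eqF.
have x2 : 1 - x ^+ 2 = (w / (2 * Num.sqrt D)) ^+ 2.
  have h y : (y / (2 * Num.sqrt D)) ^+ 2 = y ^+ 2 / (4 * D).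
    by rewrite expr_div_n exprMn rs; congr (_ / (_ * _)); ring.
  rewrite !h; have -> : w ^+ 2 = 4 * D - t ^+ 2 by lra.
  by field; rewrite gt_eqF.
have b : -1 < x < 1.
  rewrite -ltr_norml -(@expr_lt1 _ 2)// real_normK ?num_real//.
  have : 0 < (w / (2 * Num.sqrt D)) ^+ 2 by rewrite exprn_gt0// divr_gt0// mulr_gt0.
  by rewrite -x2; lra.
have b' : -1 <= x <= 1 by case/andP: b => *; apply/andP; split; exact: ltW.
split; [exact: b|by rewrite acosK|].
rewrite sin_acos// x2 sqrtr_sqr ger0_norm ?divr_ge0 ?mulr_ge0 ?ltW//.
by field; rewrite gt_eqF.
Qed.

End Acos.

Section QuadraticForm.
Variable R : realFieldType.
Implicit Types p q r s x y : R.

(** The discriminant of the matrix (p q; r s). *)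
Definition disc2 p q r s : R := (p + s) ^+ 2 - 4 * (p * s - q * r).

(** det [v, M v] for M = (p q; r s), v = (x, y). *)
Definition wedge_form p q r s x y : R := r * x ^+ 2 + (s - p) * (x * y) - q * y ^+ 2.

(** Completing the square in x, resp. in y, bounds |r Q|, resp. |q Q|, below by
    - disc / 4 times y^2, resp. x^2. *)
Lemma wedge_form_lower p q r s c C x y : 0 < c -> 0 < C -> `|q| <= C -> `|r| <= C ->
  disc2 p q r s <= - c -> c / (8 * C) * (x ^+ 2 + y ^+ 2) <= `|wedge_form p q r s x y|.
Proof.
move=> c0 C0 qC rC hd; set W := wedge_form p q r s x y.
have W1 : c / 4 * y ^+ 2 <= C * `|W|.
  apply: (@le_trans _ _ (`|r| * `|W|)); last by rewrite ler_wpM2r.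
  rewrite -normrM (le_trans _ (ler_norm _))//.
  have -> : r * W = (r * x + (s - p) / 2 * y) ^+ 2 - disc2 p q r s / 4 * y ^+ 2.
    by rewrite /W /wedge_form /disc2; field.
  have h1 := sqr_ge0 (r * x + (s - p) / 2 * y).
  have h2 : 0 <= (- disc2 p q r s - c) / 4 * y ^+ 2 by rewrite mulr_ge0 ?sqr_ge0// divr_ge0//; lra.
  move: h1 h2; clear; lra.
have W2 : c / 4 * x ^+ 2 <= C * `|W|.
  apply: (@le_trans _ _ (`|q| * `|W|)); last by rewrite ler_wpM2r.
  rewrite -normrM -normrN (le_trans _ (ler_norm _))//.
  have -> : - (q * W) = (q * y - (s - p) / 2 * x) ^+ 2 - disc2 p q r s / 4 * x ^+ 2.
    by rewrite /W /wedge_form /disc2; field.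
  have h1 := sqr_ge0 (q * y - (s - p) / 2 * x).
  have h2 : 0 <= (- disc2 p q r s - c) / 4 * x ^+ 2 by rewrite mulr_ge0 ?sqr_ge0// divr_ge0//; lra.
  move: h1 h2; clear; lra.
rewrite mulrAC ler_pdivrMr ?mulr_gt0//; move: W1 W2; clear; lra.
Qed.

Lemma wedge_form_diff p q r s p' q' r' s' d x y :
  `|p' - p| <= d -> `|q' - q| <= d -> `|r' - r| <= d -> `|s' - s| <= d ->
  `|wedge_form p' q' r' s' x y - wedge_form p q r s x y| <= 2 * d * (x ^+ 2 + y ^+ 2).
Proof.
move=> hp hq hr hs.
have -> : wedge_form p' q' r' s' x y - wedge_form p q r s x y =
   (r' - r) * x ^+ 2 + ((s' - s) * (x * y) - (p' - p) * (x * y)) - (q' - q) * y ^+ 2.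
  by rewrite /wedge_form; ring.
have xy : `|x * y| <= (x ^+ 2 + y ^+ 2) / 2.
  rewrite normrM -[x ^+ 2]real_normK ?num_real// -[y ^+ 2]real_normK ?num_real//.
  have := sqr_ge0 (`|x| - `|y|); clear; lra.
have d0 : 0 <= d by apply: le_trans hp.
have h1 : `|(r' - r) * x ^+ 2| <= d * x ^+ 2.
  by rewrite normrM [`|x ^+ 2|]ger0_norm ?sqr_ge0// ler_wpM2r ?sqr_ge0.
have h2 : `|(q' - q) * y ^+ 2| <= d * y ^+ 2.
  by rewrite normrM [`|y ^+ 2|]ger0_norm ?sqr_ge0// ler_wpM2r ?sqr_ge0.
have h3 : `|(s' - s) * (x * y)| <= d * ((x ^+ 2 + y ^+ 2) / 2) by rewrite normrM ler_pM.
have h4 : `|(p' - p) * (x * y)| <= d * ((x ^+ 2 + y ^+ 2) / 2) by rewrite normrM ler_pM.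
apply: (le_trans (ler_normB _ _)).
apply: (@le_trans _ _ (`|(r' - r) * x ^+ 2| + (`|(s' - s) * (x * y)| + `|(p' - p) * (x * y)|) + `|(q' - q) * y ^+ 2|)).
  rewrite lerD2r; apply: (le_trans (ler_normD _ _)); rewrite lerD2l; exact: ler_normB.
move: h1 h2 h3 h4; clear; lra.
Qed.

(** det [X v, M X v] = det X det [v, M v] for X = sigma + M / l, since X and M commute. *)
Lemma wedge_form_commute p q r s sigma l x y :
  wedge_form p q r s ((sigma + p / l) * x + q / l * y) (r / l * x + (sigma + s / l) * y) =
  ((sigma + p / l) * (sigma + s / l) - (q / l) * (r / l)) * wedge_form p q r s x y.
Proof. by rewrite /wedge_form; ring. Qed.

End QuadraticForm.

Section Turan.
Variables (R : realType) (K : set R) (al : nat -> R) (u v r00 r01 r10 r11 : nat -> R -> R).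
Variables (sigma : R) (d : nat -> R).
Hypothesis al0 : forall j, 0 < al j.
Hypothesis cK : compact K.
Hypothesis K0 : K !=set0.
Hypothesis sd : summable_seq d.
Definition slowly_varying (r : nat -> R -> R) := forall j x, (0 < j)%N -> K x -> `|r j.+1 x - r j x| <= d j.
Hypothesis d00 : slowly_varying r00.
Hypothesis d01 : slowly_varying r01.
Hypothesis d10 : slowly_varying r10.
Hypothesis d11 : slowly_varying r11.
Definition cont_seq (r : nat -> R -> R) := forall j, {within K, continuous (r j)}.
Hypothesis c00 : cont_seq r00.
Hypothesis c01 : cont_seq r01.
Hypothesis c10 : cont_seq r10.
Hypothesis c11 : cont_seq r11.
Hypothesis cu : cont_seq u.
Hypothesis cv : cont_seq v.
Hypothesis rec_u : forall j x, (0 < j)%N -> K x ->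
  u j.+1 x = (sigma + r00 j x / al j.+1) * u j x + r01 j x / al j.+1 * v j x.
Hypothesis rec_v : forall j x, (0 < j)%N -> K x ->
  v j.+1 x = r10 j x / al j.+1 * u j x + (sigma + r11 j x / al j.+1) * v j x.
Hypothesis hdet : forall j x, (0 < j)%N -> K x ->
  (sigma + r00 j x / al j.+1) * (sigma + r11 j x / al j.+1) - r01 j x / al j.+1 * (r10 j x / al j.+1)
  = al j / al j.+1.
Hypothesis nz : forall j x, (0 < j)%N -> K x -> u j x = 0 -> v j x = 0 -> False.

Definition disc_seq j x := disc2 (r00 j x) (r01 j x) (r10 j x) (r11 j x).
Definition form_seq j x s t := wedge_form (r00 j x) (r01 j x) (r10 j x) (r11 j x) s t.
(** With R_j = al_(j+1) (X_j - sigma) this is al_j al_(j+1) det [v_j, v_(j+1)], a scaled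
    N-shifted Turan determinant. *)
Definition turan_seq j x := al j * form_seq j x (u j x) (v j x).

Hypothesis hneg : forall x, K x -> exists l : R, disc_seq j x @[j --> \oo] --> l /\ l < 0.

Lemma slowly_varying_unif_cvg r : slowly_varying r -> cont_seq r ->
  exists q, [/\ unif_cvg K r q, {within K, continuous q} & bounded_fun_on K q].
Proof.
move=> hr cr; have [|q hq] := @unif_cvg_summable _ K r d 1 sd.
  by exists 1%N => j x j0 Kx; rewrite mul1r hr.
exists q; have cq := unif_cvg_continuous cr hq; split => //.
exact: unif_cvg_cont_bounded.
Qed.

(** Uniform definiteness of the forms, for the limits and from the index J on: c and C are
    the constants of wedge_form_lower. *)
Definition uniform_data (q00 q01 q10 q11 : R -> R) (c C : R) (J : nat) :=
  [/\ [/\ unif_cvg K r00 q00, unif_cvg K r01 q01, unif_cvg K r10 q10 & unif_cvg K r11 q11],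
      [/\ {within K, continuous q00}, {within K, continuous q01},
          {within K, continuous q10} & {within K, continuous q11}],
      [/\ 0 < c, 0 < C & (0 < J)%N],
      forall x, K x -> [/\ disc2 (q00 x) (q01 x) (q10 x) (q11 x) <= - c, `|q01 x| <= C & `|q10 x| <= C] &
      forall j x, (J <= j)%N -> K x -> [/\ disc_seq j x <= - c, `|r01 j x| <= C & `|r10 j x| <= C]].

Lemma continuousM_within (f g : R -> R) : {within K, continuous f} -> {within K, continuous g} ->
  {within K, continuous (fun x => f x * g x)}.
Proof. by move=> cf cg x; apply: cvgM; [exact: cf|exact: cg]. Qed.

Lemma continuousD_within (f g : R -> R) : {within K, continuous f} -> {within K, continuous g} ->
  {within K, continuous (fun x => f x + g x)}.
Proof. by move=> cf cg x; apply: cvgD; [exact: cf|exact: cg]. Qed.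

Lemma continuousB_within (f g : R -> R) : {within K, continuous f} -> {within K, continuous g} ->
  {within K, continuous (fun x => f x - g x)}.
Proof. by move=> cf cg x; apply: cvgB; [exact: cf|exact: cg]. Qed.

Lemma continuousZ_within c (f : R -> R) : {within K, continuous f} ->
  {within K, continuous (fun x => c * f x)}.
Proof. by move=> cf x; apply: cvgM; [exact: cvg_cst|exact: cf]. Qed.

Lemma bounded_continuous f : {within K, continuous f} -> bounded_fun_on K f.
Proof. exact: unif_cvg_cont_bounded. Qed.

Lemma disc_unif_cvg q00 q01 q10 q11 :
  unif_cvg K r00 q00 -> unif_cvg K r01 q01 -> unif_cvg K r10 q10 -> unif_cvg K r11 q11 ->
  {within K, continuous q00} -> {within K, continuous q01} ->
  {within K, continuous q10} -> {within K, continuous q11} ->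
  unif_cvg K disc_seq (fun x => disc2 (q00 x) (q01 x) (q10 x) (q11 x)) /\
  {within K, continuous (fun x => disc2 (q00 x) (q01 x) (q10 x) (q11 x))}.
Proof.
move=> u00 u01 u10 u11 k00 k01 k10 k11.
have b00 := bounded_continuous k00; have b01 := bounded_continuous k01.
have b10 := bounded_continuous k10; have b11 := bounded_continuous k11.
pose h x := disc2 (q00 x) (q01 x) (q10 x) (q11 x).
have hE x : h x = (q00 x + q11 x) * (q00 x + q11 x) - 4 * (q00 x * q11 x - q01 x * q10 x).
  by rewrite /h /disc2 expr2.
have kh : {within K, continuous h}.
  have -> : h = fun x => (q00 x + q11 x) * (q00 x + q11 x) - 4 * (q00 x * q11 x - q01 x * q10 x).
    by apply/funext => x; rewrite hE.
  apply: continuousB_within.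
    by apply: continuousM_within; exact: continuousD_within.
  by apply: continuousZ_within; apply: continuousB_within; exact: continuousM_within.
have uh : unif_cvg K disc_seq h.
  have bs : bounded_fun_on K (fun x => q00 x + q11 x).
    by apply: bounded_continuous; exact: continuousD_within.
  have us := unif_cvgD u00 u11.
  have u1 := unif_cvgM bs bs us us.
  have u2 := unif_cvgZ 4 (unif_cvgD (unif_cvgM b00 b11 u00 u11) (unif_cvgN (unif_cvgM b01 b10 u01 u10))).
  have := unif_cvgD u1 (unif_cvgN u2).
  have -> : (fun j x => (r00 j x + r11 j x) * (r00 j x + r11 j x) -
     4 * (r00 j x * r11 j x + - (r01 j x * r10 j x))) = disc_seq.
    by apply/funext => j; apply/funext => x; rewrite /disc_seq /disc2 expr2.
  have -> : (fun x => (q00 x + q11 x) * (q00 x + q11 x) -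
     4 * (q00 x * q11 x + - (q01 x * q10 x))) = h.
    by apply/funext => x; rewrite hE.
  by [].
by split.
Qed.

Lemma uniform_data_exists : exists q00 q01 q10 q11 c C J, uniform_data q00 q01 q10 q11 c C J.
Proof.
have [q00 [u00 k00 b00]] := slowly_varying_unif_cvg d00 c00.
have [q01 [u01 k01 b01]] := slowly_varying_unif_cvg d01 c01.
have [q10 [u10 k10 b10]] := slowly_varying_unif_cvg d10 c10.
have [q11 [u11 k11 b11]] := slowly_varying_unif_cvg d11 c11.
pose h x := disc2 (q00 x) (q01 x) (q10 x) (q11 x).
have [uh' kh'] := disc_unif_cvg u00 u01 u10 u11 k00 k01 k10 k11.
have uh : unif_cvg K disc_seq h := uh'; have kh : {within K, continuous h} := kh'.
have hneg' x : K x -> h x < 0.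
  move=> Kx; have [l [hl l0]] := hneg Kx.
  by rewrite (cvg_unique _ (unif_cvg_cvg uh Kx) hl).
have [x0 x0K hmax] := compact_EVT_max K0 cK kh.
have c0 : 0 < - h x0 / 2 by rewrite divr_gt0// oppr_gt0 hneg'//; move: x0K; rewrite inE.
have [J1 hJ1] := uh _ c0.
have [B1 hB1] := b01; have [B2 hB2] := b10.
have [J2 hJ2] := u01 1 ltr01; have [J3 hJ3] := u10 1 ltr01.
have nB1 := ler_norm B1; have nB2 := ler_norm B2; have n1 := normr_ge0 B1; have n2 := normr_ge0 B2.
exists q00, q01, q10, q11, (- h x0 / 2), (`|B1| + `|B2| + 1), (maxn (maxn J1 J2) (maxn J3 1)).
split => //.
- split; [exact: c0|by rewrite ltr_wpDl// addr_ge0|by rewrite !leq_max !orbT].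
- move=> x Kx; have m := hmax x (mem_set Kx); have a1 := hB1 x Kx; have a2 := hB2 x Kx.
  rewrite -/(h x); split.
  + lra.
  + lra.
  + lra.
- move=> j x; rewrite !geq_max => /andP[/andP[j1 j2] /andP[j3 _]] Kx.
  have m := hmax x (mem_set Kx); have a1 := hB1 x Kx; have a2 := hB2 x Kx.
  have e1 := hJ1 j x j1 Kx; have e2 := hJ2 j x j2 Kx; have e3 := hJ3 j x j3 Kx.
  split.
  + move: e1; rewrite ler_norml => /andP[_ e1]; lra.
  + have := ler_normD (r01 j x - q01 x) (q01 x); rewrite subrK; lra.
  + have := ler_normD (r10 j x - q10 x) (q10 x); rewrite subrK; lra.
Qed.

Variables (q00 q01 q10 q11 : R -> R) (c C : R) (J : nat).
Hypothesis UD : uniform_data q00 q01 q10 q11 c C J.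

Let kappa := c / (8 * C).
Let kappa0 : 0 < kappa. Proof. by case: UD => _ _ [? ? _] _ _; rewrite divr_gt0// mulr_gt0. Qed.

Lemma form_seq_lower j x s t : (J <= j)%N -> K x -> kappa * (s ^+ 2 + t ^+ 2) <= `|form_seq j x s t|.
Proof.
case: UD => _ _ [c0 C0 _] _ h Jj Kx; have [h1 h2 h3] := h j x Jj Kx.
exact: wedge_form_lower.
Qed.

Lemma turan_step j x : (J <= j)%N -> K x ->
  al j.+1 * form_seq j x (u j.+1 x) (v j.+1 x) = turan_seq j x.
Proof.
move=> Jj Kx; have j0 : (0 < j)%N by case: UD => _ _ [_ _ J0] _ _; exact: leq_trans Jj.
rewrite /form_seq rec_u// rec_v// wedge_form_commute hdet// mulrA mulrC.
by rewrite [al j.+1 * _]mulrC divfK ?gt_eqF// mulrC.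
Qed.

Lemma turan_diff j x : (J <= j)%N -> K x ->
  `|turan_seq j.+1 x - turan_seq j x| <= 2 / kappa * d j * `|turan_seq j x|.
Proof.
move=> Jj Kx; have j0 : (0 < j)%N by case: UD => _ _ [_ _ J0] _ _; exact: leq_trans Jj.
have h := form_seq_lower (u j.+1 x) (v j.+1 x) Jj Kx.
rewrite -(turan_step Jj Kx) /turan_seq -mulrBr !normrM (gtr0_norm (al0 _)).
rewrite [leRHS]mulrCA ler_pM2l//.
apply: (@le_trans _ _ (2 * d j * ((u j.+1 x) ^+ 2 + (v j.+1 x) ^+ 2))).
  by apply: wedge_form_diff; [exact: d00|exact: d01|exact: d10|exact: d11].
have -> : 2 / kappa * d j * `|form_seq j x (u j.+1 x) (v j.+1 x)| =
   2 * d j * (kappa^-1 * `|form_seq j x (u j.+1 x) (v j.+1 x)|) by ring.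
apply: ler_wpM2l; first by rewrite mulr_ge0// sd.1.
by rewrite ler_pdivlMl.
Qed.

Lemma turan_seq_neq0 j x : (J <= j)%N -> K x -> turan_seq j x != 0.
Proof.
move=> Jj Kx; have j0 : (0 < j)%N by case: UD => _ _ [_ _ J0] _ _; exact: leq_trans Jj.
rewrite /turan_seq; apply: mulf_neq0; first by rewrite gt_eqF.
rewrite -normr_gt0.
apply: lt_le_trans (form_seq_lower (u j x) (v j x) Jj Kx).
rewrite mulr_gt0// lt_neqAle addr_ge0 ?sqr_ge0// andbT eq_sym paddr_eq0 ?sqr_ge0//.
rewrite !sqrf_eq0; apply/negP => /andP[/eqP e1 /eqP e2]; exact: (nz j0 Kx e1 e2).
Qed.

Lemma continuous_turan_seq j : {within K, continuous (turan_seq j)}.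
Proof.
have -> : turan_seq j = fun x => al j * (r10 j x * (u j x * u j x) + (r11 j x - r00 j x) * (u j x * v j x)
   - r01 j x * (v j x * v j x)).
  by apply/funext => x; rewrite /turan_seq /form_seq /wedge_form !expr2.
apply: continuousZ_within; apply: continuousB_within; last first.
  by apply: continuousM_within => //; exact: continuousM_within.
apply: continuousD_within; first by apply: continuousM_within => //; exact: continuousM_within.
by apply: continuousM_within; [exact: continuousB_within|exact: continuousM_within].
Qed.

(** The relative increments are at most 2 d_j / kappa (turan_diff). Once the tail of the
    sum of d is small, the sequence stays within half of its value at J', which is a
    nonvanishing continuous function; convergence then follows from summability and the
    limit cannot vanish. *)
Lemma turan_limit : exists g J' B, [/\ (J <= J')%N, unif_cvg K turan_seq g,
  {within K, continuous g}, forall x, K x -> g x != 0 &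
  forall j x, (J' <= j)%N -> K x -> al j * ((u j x) ^+ 2 + (v j x) ^+ 2) <= B].
Proof.
have e0 : 0 < kappa / 8 by rewrite divr_gt0.
have [d0 dt] := sd; have [J1 hJ1] := dt _ e0.
pose J' := maxn J J1.
have JJ' : (J <= J')%N by rewrite leq_maxl.
(* A total relative change of at most 1/4 bounds all later values by twice the first one,
   which closes the induction in close below. *)
have tail m : 2 / kappa * \sum_(J' <= k < m) d k <= 1 / 4.
  have := hJ1 J' m (leq_maxr _ _) => h.
  rewrite mulrAC ler_pdivrMr//; lra.
have [M hM] := bounded_continuous (@continuous_turan_seq J').
have M0 : 0 <= M by have [x0 Kx0] := K0; exact: le_trans (hM x0 Kx0).
have close j x : (J' <= j)%N -> K x ->
    `|turan_seq j x - turan_seq J' x| <= 2 / kappa * (\sum_(J' <= k < j) d k) * (2 * `|turan_seq J' x|).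
  move=> + Kx; elim: j => [|j IH].
    by rewrite leqn0 => /eqP E; rewrite -E subrr normr0 big_geq ?leqnn// ?mulr0 ?mul0r.
  rewrite leq_eqVlt => /orP[/eqP <-|]; first by rewrite subrr normr0 big_geq ?leqnn// ?mulr0 ?mul0r.
  rewrite ltnS => J'j; have {IH} := IH J'j => IH.
  have T := tail j; have N0 := normr_ge0 (turan_seq J' x).
  have jb : `|turan_seq j x| <= 2 * `|turan_seq J' x|.
    have h1 : 2 / kappa * (\sum_(J' <= k < j) d k) * (2 * `|turan_seq J' x|) <= 1 / 4 * (2 * `|turan_seq J' x|).
      by apply: ler_wpM2r; rewrite ?mulr_ge0.
    have := ler_normD (turan_seq j x - turan_seq J' x) (turan_seq J' x); rewrite subrK.
    lra.
  have st := turan_diff (leq_trans JJ' J'j) Kx.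
  have st2 : 2 / kappa * d j * `|turan_seq j x| <= 2 / kappa * d j * (2 * `|turan_seq J' x|).
    by rewrite ler_wpM2l// mulr_ge0 ?d0// divr_ge0// ltW.
  rewrite big_nat_recr//= mulrDr mulrDl.
  have := ler_distD (turan_seq j x) (turan_seq j.+1 x) (turan_seq J' x).
  lra.
have half j x : (J' <= j)%N -> K x -> `|turan_seq j x - turan_seq J' x| <= `|turan_seq J' x| / 2.
  move=> J'j Kx; apply: (le_trans (close j x J'j Kx)).
  have h1 : 2 / kappa * (\sum_(J' <= k < j) d k) * (2 * `|turan_seq J' x|) <= 1 / 4 * (2 * `|turan_seq J' x|).
    by apply: ler_wpM2r; rewrite ?mulr_ge0.
  lra.
have bnd j x : (J' <= j)%N -> K x -> `|turan_seq j x| <= 2 * M.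
  move=> J'j Kx; have h := half j x J'j Kx; have hm := hM x Kx.
  have := ler_normD (turan_seq j x - turan_seq J' x) (turan_seq J' x); rewrite subrK.
  lra.
have [|g hg] := @unif_cvg_summable _ K turan_seq d (2 / kappa * (2 * M)) sd.
  exists J' => j x J'j Kx; apply: (le_trans (turan_diff (leq_trans JJ' J'j) Kx)).
  by rewrite [leRHS]mulrAC ler_wpM2l ?bnd// mulr_ge0 ?d0// divr_ge0// ltW.
exists g, J', (2 * M / kappa); split => //.
- exact: unif_cvg_continuous continuous_turan_seq hg.
- move=> x Kx; apply/negP => /eqP gx.
  have t0 : 0 < `|turan_seq J' x| / 4 by rewrite divr_gt0// normr_gt0 turan_seq_neq0.
  have [J2 hJ2] := hg _ t0; pose j := maxn J' J2.
  have := hJ2 j x (leq_maxr _ _) Kx; rewrite gx subr0 => h1.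
  have h2 := half j x (leq_maxl _ _) Kx.
  have := ler_distD (turan_seq j x) (turan_seq J' x) 0; rewrite !subr0.
  rewrite distrC in h2; lra.
- move=> j x J'j Kx; rewrite ler_pdivlMr//.
  apply: le_trans (bnd j x J'j Kx).
  rewrite /turan_seq normrM (gtr0_norm (al0 _)) -mulrA ler_pM2l// mulrC.
  by apply: form_seq_lower => //; exact: leq_trans J'j.
Qed.


Definition sdisc j x := Num.sqrt (- disc_seq j x).
(** Real and imaginary part of al_j^(1/2) ell_j(u_j, v_j) for the row vector
    ell_j = (r10, rho - r00), rho = ((r00 + r11) + i sdisc) / 2, a left eigenvector of R_j. *)
Definition eigen_re j x := Num.sqrt (al j) * (r10 j x * u j x + (r11 j x - r00 j x) / 2 * v j x).
Definition eigen_im j x := Num.sqrt (al j) * (sdisc j x / 2 * v j x).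
Definition angle_arg j x := (2 * sigma + (r00 j x + r11 j x) / al j.+1) / (2 * Num.sqrt (al j / al j.+1)).
Definition angle j x := acos (angle_arg j x).

Let Jpos j : (J <= j)%N -> (0 < j)%N.
Proof. by case: UD => _ _ [_ _ J0] _ _; exact: leq_trans. Qed.

Lemma sdisc_gt0 j x : (J <= j)%N -> K x -> 0 < sdisc j x /\ sdisc j x ^+ 2 = - disc_seq j x.
Proof.
case: UD => _ _ [c0 _ _] _ h Jj Kx; have [h1 _ _] := h j x Jj Kx.
have p : 0 < - disc_seq j x by lra.
by rewrite /sdisc sqrtr_gt0 sqr_sqrtr// ltW.
Qed.

Lemma angle_facts j x : (J <= j)%N -> K x ->
  [/\ -1 < angle_arg j x < 1,
      Num.sqrt (al j) * cos (angle j x) = Num.sqrt (al j.+1) * (sigma + (r00 j x + r11 j x) / (2 * al j.+1)) &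
      Num.sqrt (al j) * sin (angle j x) = Num.sqrt (al j.+1) * (sdisc j x / (2 * al j.+1))].
Proof.
move=> Jj Kx; have [w0 w2] := sdisc_gt0 Jj Kx.
have a1 := al0 j.+1; have a0 := al0 j.
have hd := hdet (Jpos Jj) Kx.
have D0 : 0 < al j / al j.+1 by rewrite divr_gt0.
have W0 : 0 < sdisc j x / al j.+1 by rewrite divr_gt0.
have [|h1 h2 h3] := @acos_trace _ (2 * sigma + (r00 j x + r11 j x) / al j.+1) _ (sdisc j x / al j.+1) D0 W0.
  rewrite -hd expr_div_n w2 /disc_seq /disc2; field; rewrite gt_eqF//.
have e : Num.sqrt (al j) = Num.sqrt (al j.+1) * Num.sqrt (al j / al j.+1).
  by rewrite -sqrtrM ?ltW// mulrC divfK// gt_eqF.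
split => //.
  by rewrite e -mulrA h2; congr (_ * _); field; rewrite gt_eqF.
by rewrite e -mulrA h3; congr (_ * _); field; rewrite gt_eqF.
Qed.

(** ell_j is a left eigenvector of X_j as well, with eigenvalue
    (al_j / al_(j+1))^(1/2) exp(i theta_j). *)
Lemma eigen_step j x : (J <= j)%N -> K x ->
  Num.sqrt (al j.+1) * (r10 j x * u j.+1 x + (r11 j x - r00 j x) / 2 * v j.+1 x) =
    cos (angle j x) * eigen_re j x - sin (angle j x) * eigen_im j x /\
  Num.sqrt (al j.+1) * (sdisc j x / 2 * v j.+1 x) =
    sin (angle j x) * eigen_re j x + cos (angle j x) * eigen_im j x.
Proof.
move=> Jj Kx; have [_ w2] := sdisc_gt0 Jj Kx; have [_ hc hs] := angle_facts Jj Kx.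
have a1 := al0 j.+1.
have a1n : al j.+1 != 0 by rewrite gt_eqF.
rewrite /eigen_re /eigen_im !(mulrA (cos _)) !(mulrA (sin _)) ![cos _ * _]mulrC ![sin _ * _]mulrC hc hs.
rewrite rec_u ?rec_v ?Jpos//.
split; rewrite -!mulrA -?mulrBr -?mulrDr; congr (_ * _).
  have -> : sdisc j x * ((2 * al j.+1)^-1 * (sdisc j x * (2^-1 * v j x))) =
     sdisc j x ^+ 2 * (2 * al j.+1)^-1 * 2^-1 * v j x by ring.
  by rewrite w2 /disc_seq /disc2; field.
by field.
Qed.

Lemma entries_bounded : exists C4 J4, [/\ 0 <= C4, (J <= J4)%N & forall j x, (J4 <= j)%N -> K x ->
  [/\ `|r00 j x| <= C4, `|r01 j x| <= C4, `|r10 j x| <= C4 & `|r11 j x| <= C4]].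
Proof.
have [[u0 u1 u2 u3] [k0 k1 k2 k3] _ _ _] := UD.
have bd r q : unif_cvg K r q -> {within K, continuous q} ->
    exists (A : R) (n : nat), forall j x, (n <= j)%N -> K x -> `|r j x| <= `|A| + 1.
  move=> hu kq; have [A hA] := bounded_continuous kq; have [n hn] := hu 1 ltr01.
  exists A, n => j x nj Kx; have h1 := hA x Kx; have h2 := hn j x nj Kx.
  have := ler_normD (r j x - q x) (q x); rewrite subrK; have := ler_norm A; lra.
have [A0 [n0 h0]] := bd _ _ u0 k0; have [A1 [n1 h1]] := bd _ _ u1 k1.
have [A2 [n2 h2]] := bd _ _ u2 k2; have [A3 [n3 h3]] := bd _ _ u3 k3.
have a0 := normr_ge0 A0; have a1 := normr_ge0 A1; have a2 := normr_ge0 A2; have a3 := normr_ge0 A3.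
exists (`|A0| + `|A1| + `|A2| + `|A3| + 1), (maxn J (maxn (maxn n0 n1) (maxn n2 n3))).
split; [lra|by rewrite leq_maxl|].
move=> j x; rewrite !geq_max => /and3P[_ /andP[j0 j1] /andP[j2 j3]] Kx.
have := h0 j x j0 Kx; have := h1 j x j1 Kx; have := h2 j x j2 Kx; have := h3 j x j3 Kx.
by move=> *; split; lra.
Qed.

Variables (g : R -> R) (J' : nat) (B : R).
Hypothesis JJ' : (J <= J')%N.
Hypothesis ug : unif_cvg K turan_seq g.
Hypothesis kg : {within K, continuous g}.
Hypothesis gn0 : forall x, K x -> g x != 0.
Hypothesis hB : forall j x, (J' <= j)%N -> K x -> al j * ((u j x) ^+ 2 + (v j x) ^+ 2) <= B.

Let Bge0 : 0 <= B.
Proof.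
have [x Kx] := K0; apply: le_trans (hB (leqnn _) Kx).
by apply: mulr_ge0; [exact: ltW|rewrite addr_ge0 ?sqr_ge0].
Qed.

Lemma scaled_bounded j x : (J' <= j)%N -> K x ->
  Num.sqrt (al j) * `|u j x| <= Num.sqrt B /\ Num.sqrt (al j) * `|v j x| <= Num.sqrt B.
Proof.
move=> Jj Kx; have h := hB Jj Kx; have a0 := ltW (al0 j).
rewrite -!sqrtr_sqr -!sqrtrM ?ler_wsqrtr//.
  by apply: le_trans h; rewrite ler_wpM2l// lerDr sqr_ge0.
by apply: le_trans h; rewrite ler_wpM2l// lerDl sqr_ge0.
Qed.

(** Passing from ell_j to ell_(j+1) costs O(d_j), because al_(j+1)^(1/2) v_(j+1) is bounded
    and the square root of the discriminants stays away from 0. *)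
Lemma eigen_perturbation : exists E J4, [/\ (J' <= J4)%N, 0 <= E & forall j x, (J4 <= j)%N -> K x ->
  `|eigen_re j.+1 x - (cos (angle j x) * eigen_re j x - sin (angle j x) * eigen_im j x)| <= E * d j /\
  `|eigen_im j.+1 x - (sin (angle j x) * eigen_re j x + cos (angle j x) * eigen_im j x)| <= E * d j].
Proof.
have [C4 [J4 [C40 JJ4 h4]]] := entries_bounded.
have [_ _ [c0 _ _] _ hc] := UD.
have sc0 : 0 < Num.sqrt c by rewrite sqrtr_gt0.
have sB := sqrtr_ge0 B.
have [d0 _] := sd.
have F0 : 0 <= C4 / Num.sqrt c * Num.sqrt B by rewrite mulr_ge0// divr_ge0// ltW.
exists (2 * Num.sqrt B + 4 * (C4 / Num.sqrt c * Num.sqrt B)), (maxn J' J4); split; first by rewrite leq_maxl.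
  by rewrite addr_ge0// mulr_ge0.
move=> j x; rewrite geq_max => /andP[J'j J4j] Kx.
have Jj : (J <= j)%N by exact: leq_trans J'j.
have j0 := Jpos Jj.
have [e1 e2] := eigen_step Jj Kx; rewrite -e1 -e2 {e1 e2}.
have [bu bv] := scaled_bounded (leqW J'j) Kx.
have dj := d0 j.
have D00 := d00 j0 Kx; have D01 := d01 j0 Kx; have D10 := d10 j0 Kx; have D11 := d11 j0 Kx.
have FD : 0 <= C4 / Num.sqrt c * Num.sqrt B * d j by rewrite mulr_ge0.
have GD : 0 <= Num.sqrt B * d j by rewrite mulr_ge0.
split.
  have -> : eigen_re j.+1 x - Num.sqrt (al j.+1) * (r10 j x * u j.+1 x + (r11 j x - r00 j x) / 2 * v j.+1 x) =
     (r10 j.+1 x - r10 j x) * (Num.sqrt (al j.+1) * u j.+1 x) +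
     ((r11 j.+1 x - r11 j x) - (r00 j.+1 x - r00 j x)) / 2 * (Num.sqrt (al j.+1) * v j.+1 x).
    by rewrite /eigen_re; field.
  have h1 : `|(r10 j.+1 x - r10 j x) * (Num.sqrt (al j.+1) * u j.+1 x)| <= d j * Num.sqrt B.
    by rewrite normrM ler_pM// normrM ger0_norm ?sqrtr_ge0.
  have h2 : `|((r11 j.+1 x - r11 j x) - (r00 j.+1 x - r00 j x)) / 2 * (Num.sqrt (al j.+1) * v j.+1 x)| <= d j * Num.sqrt B.
    rewrite normrM ler_pM//; last by rewrite normrM ger0_norm ?sqrtr_ge0.
    rewrite normrM normfV (ger0_norm (ler0n _ 2)) ler_pdivrMr//.
    by apply: (le_trans (ler_normB _ _)); lra.
  apply: (le_trans (ler_normD _ _)); lra.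
have -> : eigen_im j.+1 x - Num.sqrt (al j.+1) * (sdisc j x / 2 * v j.+1 x) =
  (sdisc j.+1 x - sdisc j x) / 2 * (Num.sqrt (al j.+1) * v j.+1 x).
  by rewrite /eigen_im; field.
have [w0 w2] := sdisc_gt0 Jj Kx; have [w0' w2'] := sdisc_gt0 (leqW Jj) Kx.
have wc k : (J <= k)%N -> Num.sqrt c <= sdisc k x.
  by move=> Jk; apply: ler_wsqrtr; have [h _ _] := hc k x Jk Kx; lra.
have wd : `|sdisc j.+1 x - sdisc j x| * (2 * Num.sqrt c) <= 16 * C4 * d j.
  have p0 : 0 <= sdisc j.+1 x + sdisc j x by lra.
  apply: (@le_trans _ _ (`|sdisc j.+1 x - sdisc j x| * (sdisc j.+1 x + sdisc j x))).
    by rewrite ler_wpM2l// mulr2n mulrDl mul1r lerD ?wc// leqW.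
  rewrite -(ger0_norm p0) -normrM -subr_sqr w2 w2'.
  have [b0 b1 b2 b3] := h4 j x J4j Kx; have [b0' b1' b2' b3'] := h4 j.+1 x (leqW J4j) Kx.
  have -> : - disc_seq j.+1 x - - disc_seq j x =
    ((r00 j x - r00 j.+1 x) - (r11 j x - r11 j.+1 x)) * ((r00 j.+1 x - r11 j.+1 x) + (r00 j x - r11 j x))
    - 4 * ((r01 j.+1 x - r01 j x) * r10 j.+1 x + r01 j x * (r10 j.+1 x - r10 j x)).
    by rewrite /disc_seq /disc2; ring.
  have t1 : `|((r00 j x - r00 j.+1 x) - (r11 j x - r11 j.+1 x)) * ((r00 j.+1 x - r11 j.+1 x) + (r00 j x - r11 j x))| <= (2 * d j) * (4 * C4).
    rewrite normrM ler_pM//.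
      by apply: (le_trans (ler_normB _ _)); rewrite ![`|_ j x - _ j.+1 x|]distrC; lra.
    have := ler_normD (r00 j.+1 x - r11 j.+1 x) (r00 j x - r11 j x).
    have := ler_normB (r00 j.+1 x) (r11 j.+1 x); have := ler_normB (r00 j x) (r11 j x); lra.
  have t2 : `|(r01 j.+1 x - r01 j x) * r10 j.+1 x| <= d j * C4 by rewrite normrM ler_pM.
  have t3 : `|r01 j x * (r10 j.+1 x - r10 j x)| <= C4 * d j by rewrite normrM ler_pM.
  apply: (le_trans (ler_normB _ _)); rewrite [`|4 * _|]normrM (ger0_norm (ler0n _ 4)).
  have := ler_normD ((r01 j.+1 x - r01 j x) * r10 j.+1 x) (r01 j x * (r10 j.+1 x - r10 j x)).
  lra.
have h2 : `|sdisc j.+1 x - sdisc j x| / 2 <= 4 * (C4 / Num.sqrt c) * d j.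
  have -> : 4 * (C4 / Num.sqrt c) * d j = (4 * C4 * d j) / Num.sqrt c by ring.
  by rewrite ler_pdivlMr//; lra.
rewrite normrM normrM normfV (ger0_norm (ler0n _ 2)).
apply: (@le_trans _ _ (4 * (C4 / Num.sqrt c) * d j * Num.sqrt B)).
  by rewrite ler_pM// ?divr_ge0// normrM ger0_norm ?sqrtr_ge0.
have -> : 4 * (C4 / Num.sqrt c) * d j * Num.sqrt B = 4 * (C4 / Num.sqrt c * Num.sqrt B * d j) by ring.
lra.
Qed.


Definition phase M n x := \sum_(M.+1 <= k < n) angle k x.
(** The product of exp(- i phase) and eigen_re + i eigen_im: the rotations accumulated so
    far are undone. *)
Definition unwound_re M n x :=
  cos (phase M n x) * eigen_re n x + sin (phase M n x) * eigen_im n x.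
Definition unwound_im M n x :=
  cos (phase M n x) * eigen_im n x - sin (phase M n x) * eigen_re n x.

Lemma continuous_cmp_within (f h : R -> R) : continuous h -> {within K, continuous f} ->
  {within K, continuous (fun x => h (f x))}.
Proof. by move=> ch cf x; apply: continuous_comp; [exact: cf|exact: ch]. Qed.

Lemma continuous_cst_within (y : R) : {within K, continuous (fun=> y)}.
Proof. by move=> x; exact: cvg_cst. Qed.

Lemma continuous_sdisc j : {within K, continuous (sdisc j)}.
Proof.
have -> : sdisc j = fun x => Num.sqrt (4 * (r00 j x * r11 j x - r01 j x * r10 j x)
    - (r00 j x + r11 j x) * (r00 j x + r11 j x)).
  by apply/funext => x; rewrite /sdisc /disc_seq /disc2 opprB expr2.
apply: (continuous_cmp_within (h := Num.sqrt)); first by move=> x; exact: sqrt_continuous.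
apply: continuousB_within; last by apply: continuousM_within; exact: continuousD_within.
by apply: continuousZ_within; apply: continuousB_within; exact: continuousM_within.
Qed.

Lemma continuous_eigen_re j : {within K, continuous (eigen_re j)}.
Proof.
apply: continuousZ_within; apply: continuousD_within; first exact: continuousM_within.
apply: continuousM_within => //; apply: continuousM_within; last exact: continuous_cst_within.
exact: continuousB_within.
Qed.

Lemma continuous_eigen_im j : {within K, continuous (eigen_im j)}.
Proof.
apply: continuousZ_within; apply: continuousM_within => //.
by apply: continuousM_within; [exact: continuous_sdisc|exact: continuous_cst_within].
Qed.

Lemma continuous_angle j : (J <= j)%N -> {within K, continuous (angle j)}.
Proof.
move=> Jj; apply/subspace_continuousP => x Kx.
have ca : {within K, continuous (angle_arg j)}.
  apply: continuousM_within; last exact: continuous_cst_within.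
  apply: continuousD_within; first exact: continuous_cst_within.
  by apply: continuousM_within; [exact: continuousD_within|exact: continuous_cst_within].
have [b _ _] := angle_facts Jj Kx.
move/subspace_continuousP : ca => /(_ x Kx) ca.
exact: (continuous_cvg _ (continuous_acos b) ca).
Qed.

Lemma continuous_phase M n : (J <= M)%N -> {within K, continuous (phase M n)}.
Proof.
move=> JM; rewrite /phase; elim: n => [|n IH].
  have -> : (fun x => \sum_(M.+1 <= k < 0) angle k x) = fun=> 0.
    by apply/funext => x; rewrite big_geq.
  exact: continuous_cst_within.
have [Mn|nM] := leqP M.+1 n; last first.
  have -> : (fun x => \sum_(M.+1 <= k < n.+1) angle k x) = fun=> 0.
    by apply/funext => x; rewrite big_geq.
  exact: continuous_cst_within.
have -> : (fun x => \sum_(M.+1 <= k < n.+1) angle k x) =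
    fun x => \sum_(M.+1 <= k < n) angle k x + angle n x.
  by apply/funext => x; rewrite big_nat_recr.
by apply: continuousD_within => //; apply: continuous_angle; exact: leq_trans (ltnW Mn).
Qed.

Lemma continuous_unwound M n : (J <= M)%N ->
  {within K, continuous (unwound_re M n)} /\ {within K, continuous (unwound_im M n)}.
Proof.
move=> JM; have cp := @continuous_phase M n JM.
have cc := continuous_cmp_within (@continuous_cos R) cp.
have cs := continuous_cmp_within (@continuous_sin R) cp.
have cr := @continuous_eigen_re n; have ci := @continuous_eigen_im n.
by split; [apply: continuousD_within|apply: continuousB_within]; exact: continuousM_within.
Qed.

Lemma unwound_limit : exists M Wr Wi, [/\ (J' <= M)%N, {within K, continuous Wr},
  {within K, continuous Wi}, unif_cvg K (unwound_re M) Wr & unif_cvg K (unwound_im M) Wi].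
Proof.
have [E [M [JM E0 hE]]] := eigen_perturbation.
have step j x : (M.+1 <= j)%N -> K x ->
    `|unwound_re M j.+1 x - unwound_re M j x| <= 2 * E * d j /\
    `|unwound_im M j.+1 x - unwound_im M j x| <= 2 * E * d j.
  move=> Mj Kx; have [] := hE j x (ltnW Mj) Kx.
  have le1 (y z m : R) : `|y| <= 1 -> `|z| <= m -> `|y| * `|z| <= m.
    by move=> y1 zm; rewrite -[m]mul1r ler_pM.
  have pE : phase M j.+1 x = phase M j x + angle j x by rewrite /phase big_nat_recr.
  rewrite /unwound_re /unwound_im pE cosD sinD.
  have := cos2Dsin2 (angle j x).
  have c1 := cos_max (phase M j x); have s1 := sin_max (phase M j x).
  have := cos_max (phase M j.+1 x); have := sin_max (phase M j.+1 x); rewrite pE cosD sinD.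
  move: (cos (phase M j x)) (sin (phase M j x)) (cos (angle j x)) (sin (angle j x)) => P Q ct st hQ hP h1.
  move: (eigen_re j x) (eigen_im j x) (eigen_re j.+1 x) (eigen_im j.+1 x) => X Y X' Y' hX hY.
  split.
    have -> : (P * ct - Q * st) * X' + (Q * ct + P * st) * Y' - (P * X + Q * Y) =
      (P * ct - Q * st) * (X' - (ct * X - st * Y)) + (Q * ct + P * st) * (Y' - (st * X + ct * Y)) +
      (ct ^+ 2 + st ^+ 2 - 1) * (P * X + Q * Y) by ring.
    rewrite h1 subrr mul0r addr0; apply: (le_trans (ler_normD _ _)).
    by rewrite !normrM -mulrA mulr2n mulrDl mul1r lerD// le1.
  have -> : (P * ct - Q * st) * Y' - (Q * ct + P * st) * X' - (P * Y - Q * X) =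
      (P * ct - Q * st) * (Y' - (st * X + ct * Y)) - (Q * ct + P * st) * (X' - (ct * X - st * Y)) +
      (ct ^+ 2 + st ^+ 2 - 1) * (P * Y - Q * X) by ring.
  rewrite h1 subrr mul0r addr0; apply: (le_trans (ler_normB _ _)).
  by rewrite !normrM -mulrA mulr2n mulrDl mul1r lerD// le1.
have [|Wr hr] := @unif_cvg_summable _ K (unwound_re M) d (2 * E) sd.
  by exists M.+1 => j x Mj Kx; have [] := step j x Mj Kx.
have [|Wi hi] := @unif_cvg_summable _ K (unwound_im M) d (2 * E) sd.
  by exists M.+1 => j x Mj Kx; have [] := step j x Mj Kx.
have J_M : (J <= M)%N by exact: leq_trans JM.
exists M, Wr, Wi; split => //.
  by apply: unif_cvg_continuous hr => j; have [] := continuous_unwound j J_M.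
by apply: unif_cvg_continuous hi => j; have [] := continuous_unwound j J_M.
Qed.

Let h x := disc2 (q00 x) (q01 x) (q10 x) (q11 x).

(** |ell(v)|^2 = r10 Q(v), which is the completed square behind wedge_form_lower. *)
Lemma unwound_sqr M n x : (J <= n)%N -> K x ->
  unwound_re M n x ^+ 2 + unwound_im M n x ^+ 2 = r10 n x * turan_seq n x.
Proof.
move=> Jn Kx; have [w0 w2] := sdisc_gt0 Jn Kx.
have c1 := cos2Dsin2 (phase M n x).
transitivity ((cos (phase M n x) ^+ 2 + sin (phase M n x) ^+ 2) * (eigen_re n x ^+ 2 + eigen_im n x ^+ 2)).
  by rewrite /unwound_re /unwound_im; ring.
rewrite c1 mul1r /eigen_re /eigen_im !exprMn sqr_sqrtr ?ltW// w2.
by rewrite /turan_seq /form_seq /wedge_form /disc_seq /disc2; field.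
Qed.

Lemma limit_sqr M Wr Wi : unif_cvg K (unwound_re M) Wr -> unif_cvg K (unwound_im M) Wi ->
  forall x, K x -> Wr x ^+ 2 + Wi x ^+ 2 = q10 x * g x /\ 0 < q10 x * g x.
Proof.
move=> hr hi x Kx.
have e : Wr x ^+ 2 + Wi x ^+ 2 = q10 x * g x.
  have c1 : unwound_re M n x ^+ 2 + unwound_im M n x ^+ 2 @[n --> \oo] --> Wr x ^+ 2 + Wi x ^+ 2.
    rewrite !expr2; under eq_fun do rewrite !expr2.
    have a1 := unif_cvg_cvg hr Kx; have a2 := unif_cvg_cvg hi Kx.
    by apply: cvgD; exact: cvgM.
  have [[_ _ u10 _] _ _ _ _] := UD.
  have c2 : r10 n x * turan_seq n x @[n --> \oo] --> q10 x * g x.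
    by apply: cvgM; [exact: unif_cvg_cvg u10 Kx|exact: unif_cvg_cvg ug Kx].
  apply: (cvg_unique _ c1); first exact: norm_hausdorff.
  apply: cvg_trans c2; apply: near_eq_cvg; exists J => // n /= Jn.
  by rewrite unwound_sqr.
split => //; rewrite lt_neqAle -e addr_ge0 ?sqr_ge0// andbT e eq_sym mulf_neq0 ?gn0//.
have [_ _ [c0 _ _] hq _] := UD; have [hd _ _] := hq x Kx.
apply/negP => /eqP z; move: hd; rewrite z /disc2 mulr0 subr0.
have := sqr_ge0 (q00 x - q11 x); lra.
Qed.

Lemma sine_form M Wr Wi : unif_cvg K (unwound_re M) Wr -> unif_cvg K (unwound_im M) Wi ->
  unif_cvg K (fun n x => Num.sqrt (al n) * v n x -
     2 / Num.sqrt (- h x) * (sin (phase M n x) * Wr x + cos (phase M n x) * Wi x)) (fun=> 0).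
Proof.
move=> hr hi.
have [[u00 u01 u10 u11] [k00 k01 k10 k11] [c0 C0 J0] hq hj] := UD.
have [uh kh] := disc_unif_cvg u00 u01 u10 u11 k00 k01 k10 k11.
have sc0 : 0 < Num.sqrt c by rewrite sqrtr_gt0.
have hc x : K x -> Num.sqrt c <= Num.sqrt (- h x).
  by move=> Kx; apply: ler_wsqrtr; have [hd _ _] := hq x Kx; rewrite /h; lra.
have us := unif_cvgZ 2 (unif_cvg_inv sc0 hc (unif_cvg_sqrt (unif_cvgN uh))).
have Wb x : K x -> `|Wr x| + `|Wi x| <= 2 * Num.sqrt (q10 x * g x).
  move=> Kx; have [e _] := limit_sqr hr hi Kx.
  have h1 : `|Wr x| <= Num.sqrt (q10 x * g x) by rewrite -sqrtr_sqr ler_wsqrtr// -e lerDl sqr_ge0.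
  have h2 : `|Wi x| <= Num.sqrt (q10 x * g x) by rewrite -sqrtr_sqr ler_wsqrtr// -e lerDr sqr_ge0.
  lra.
have [A hA] : bounded_fun_on K (fun x => q10 x * g x).
  by apply: bounded_continuous; exact: continuousM_within.
have Wb2 x : K x -> `|Wr x| + `|Wi x| <= 2 * Num.sqrt `|A|.
  move=> Kx; apply: (le_trans (Wb x Kx)); rewrite ler_wpM2l// ler_wsqrtr//.
  by apply: le_trans (ler_norm A); apply: le_trans (hA x Kx); exact: ler_norm.
have sA := sqrtr_ge0 `|A|.
move=> e e0.
pose e1 := e / 2 * (Num.sqrt c / 4).
have e10 : 0 < e1 by rewrite mulr_gt0// divr_gt0.
pose e2 := e / 2 / (2 * Num.sqrt `|A| + 1).
have e20 : 0 < e2 by rewrite divr_gt0 ?divr_gt0//; lra.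
have [J1 h1] := hr _ e10; have [J2 h2] := hi _ e10; have [J3 h3] := us _ e20.
exists (maxn J (maxn J1 (maxn J2 J3))) => n x; rewrite !geq_max => /and4P[Jn n1 n2 n3] Kx.
have a1 := h1 n x n1 Kx; have a2 := h2 n x n2 Kx; have a3 := h3 n x n3 Kx.
have {Wb hA} aw := Wb2 x Kx.
have [w0 w2] := sdisc_gt0 Jn Kx.
have cw : Num.sqrt c <= sdisc n x.
  by apply: ler_wsqrtr; have [hd _ _] := hj n x Jn Kx; lra.
have vE : Num.sqrt (al n) * v n x =
    2 / sdisc n x * (sin (phase M n x) * unwound_re M n x + cos (phase M n x) * unwound_im M n x).
  transitivity (2 / sdisc n x * ((cos (phase M n x) ^+ 2 + sin (phase M n x) ^+ 2) * eigen_im n x)).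
    rewrite cos2Dsin2 mul1r /eigen_im.
    have := w0; move: (sdisc n x) (Num.sqrt (al n)) => w S w_0; field; exact: lt0r_neq0.
  by rewrite /unwound_re /unwound_im; ring.
have cm := cos_max (phase M n x); have sm := sin_max (phase M n x).
rewrite subr0 vE.
have -> : 2 / sdisc n x * (sin (phase M n x) * unwound_re M n x + cos (phase M n x) * unwound_im M n x) -
  2 / Num.sqrt (- h x) * (sin (phase M n x) * Wr x + cos (phase M n x) * Wi x) =
  2 / sdisc n x * (sin (phase M n x) * (unwound_re M n x - Wr x) + cos (phase M n x) * (unwound_im M n x - Wi x))
  + (2 / sdisc n x - 2 / Num.sqrt (- h x)) * (sin (phase M n x) * Wr x + cos (phase M n x) * Wi x) by ring.
have p1 : `|sin (phase M n x) * (unwound_re M n x - Wr x) + cos (phase M n x) * (unwound_im M n x - Wi x)| <= 2 * e1.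
  apply: (le_trans (ler_normD _ _)); rewrite !normrM mulr2n mulrDl mul1r lerD//.
    by rewrite -[leRHS]mul1r ler_pM.
  by rewrite -[leRHS]mul1r ler_pM.
have p2 : `|sin (phase M n x) * Wr x + cos (phase M n x) * Wi x| <= 2 * Num.sqrt `|A|.
  apply: le_trans aw; apply: (le_trans (ler_normD _ _)); rewrite !normrM lerD//.
    by rewrite -[leRHS]mul1r ler_pM.
  by rewrite -[leRHS]mul1r ler_pM.
have p3 : `|2 / sdisc n x| <= 2 / Num.sqrt c.
  rewrite ger0_norm; last by rewrite divr_ge0// ltW.
  by rewrite ler_pM2l// lef_pV2.
apply: (le_trans (ler_normD _ _)); rewrite [e]splitr; apply: lerD.
  rewrite normrM; apply: (@le_trans _ _ (2 / Num.sqrt c * (2 * e1))); first by rewrite ler_pM.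
  have -> : 2 / Num.sqrt c * (2 * e1) = e / 2.
    by rewrite /e1; move: (Num.sqrt c) sc0 => S S0; field; rewrite gt_eqF.
  by [].
rewrite normrM; apply: (@le_trans _ _ (e2 * (2 * Num.sqrt `|A| + 1))).
  by rewrite ler_pM//; lra.
by rewrite /e2 divfK// gt_eqF//; lra.
Qed.

(** The form with the entries frozen at their limits in x0 still approximates g(x0),
    uniformly near x0 and for large j. *)
Lemma local_form x0 : K x0 -> forall e, 0 < e -> exists delta j0, 0 < delta /\
  forall j x, (j0 <= j)%N -> K x -> `|x - x0| < delta ->
  `|al j * wedge_form (q00 x0) (q01 x0) (q10 x0) (q11 x0) (u j x) (v j x) - g x0| <= e.
Proof.
move=> Kx0 e e0.
have [[u00 u01 u10 u11] [k00 k01 k10 k11] _ _ _] := UD.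
pose e1 := e / 2 / (4 * B + 1).
have e10 : 0 < e1 by rewrite /e1 divr_gt0 ?divr_gt0//; have := Bge0; lra.
have e20 : 0 < e1 / 2 by rewrite divr_gt0.
have e40 : 0 < e / 4 by rewrite divr_gt0.
have near_q r q : unif_cvg K r q -> {within K, continuous q} ->
    exists (dl : R) j0, 0 < dl /\ forall j x, (j0 <= j)%N -> K x -> `|x - x0| < dl -> `|q x0 - r j x| <= e1.
  move=> hu /subspace_continuousP /(_ x0 Kx0) /cvgrPdist_le /(_ _ e20).
  rewrite /prop_near1 /nbhs /= /within /= => -[dl /= dl0 hdl].
  have [j0 hj0] := hu _ e20; exists dl, j0; split => // j x jj Kx xd.
  have h1 := hj0 j x jj Kx; have h2 : `|q x0 - q x| <= e1 / 2 by apply: hdl => //; rewrite /ball_ /= distrC.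
  have := ler_distD (q x) (q x0) (r j x); rewrite [`|q x - _|]distrC; lra.
have [d1 [j1 [d10' h1]]] := near_q _ _ u00 k00; have [d2 [j2 [d20' h2]]] := near_q _ _ u01 k01.
have [d3 [j3 [d30' h3]]] := near_q _ _ u10 k10; have [d4 [j4 [d40' h4]]] := near_q _ _ u11 k11.
move/subspace_continuousP : kg => /(_ x0 Kx0) /cvgrPdist_le /(_ _ e40).
rewrite /prop_near1 /nbhs /= /within /= => -[d5 /= d50 h5].
have [j6 h6] := ug e40.
exists (Num.min (Num.min (Num.min d1 d2) (Num.min d3 d4)) d5), (maxn J' (maxn j6 (maxn (maxn j1 j2) (maxn j3 j4)))).
split; first by rewrite !lt_min d10' d20' d30' d40'.
move=> j x; rewrite !geq_max !lt_min => /and3P[jJ' jj6 /andP[/andP[jj1 jj2] /andP[jj3 jj4]]] Kx.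
move=> /andP[/andP[/andP[x1 x2] /andP[x3 x4]] x5].
have a1 := h1 j x jj1 Kx x1; have a2 := h2 j x jj2 Kx x2; have a3 := h3 j x jj3 Kx x3; have a4 := h4 j x jj4 Kx x4.
have a5 : `|g x0 - g x| <= e / 4 by apply: h5 => //; rewrite /ball_ /= distrC.
have a6 := h6 j x jj6 Kx; have bB := hB jJ' Kx.
have W := wedge_form_diff (u j x) (v j x) a1 a2 a3 a4.
have {}W : `|al j * wedge_form (q00 x0) (q01 x0) (q10 x0) (q11 x0) (u j x) (v j x) - turan_seq j x| <= e / 2.
  rewrite /turan_seq -mulrBr normrM (gtr0_norm (al0 j)).
  apply: (@le_trans _ _ (2 * e1 * (al j * (u j x ^+ 2 + v j x ^+ 2)))).
    by rewrite mulrCA ler_wpM2l// ltW.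
  apply: (@le_trans _ _ (e1 * (4 * B + 1))).
    have : e1 * (al j * (u j x ^+ 2 + v j x ^+ 2)) <= e1 * B by rewrite ler_wpM2l// ltW.
    have : 0 <= e1 * B by rewrite mulr_ge0// ltW.
    lra.
  by rewrite /e1 divfK// gt_eqF//; have := Bge0; lra.
rewrite distrC in a5.
have := ler_distD (turan_seq j x) (al j * wedge_form (q00 x0) (q01 x0) (q10 x0) (q11 x0) (u j x) (v j x)) (g x0).
have := ler_distD (g x) (turan_seq j x) (g x0).
lra.
Qed.

Lemma norm_lower x : K x -> exists m j0, 0 < m /\
  forall j, (j0 <= j)%N -> m / al j <= u j x ^+ 2 + v j x ^+ 2.
Proof.
move=> Kx; have [C4 [J4 [C40 _ h4]]] := entries_bounded.
have g0 : 0 < `|g x| by rewrite normr_gt0 gn0.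
have g20 : 0 < `|g x| / 2 by rewrite divr_gt0.
have [J1 h1] := ug g20.
have D0 : 0 < 2 * C4 + 1 by lra.
exists (`|g x| / 2 / (2 * C4 + 1)), (maxn J1 J4); split; first by rewrite divr_gt0.
move=> j; rewrite geq_max => /andP[j1 j4].
have a1 := h1 j x j1 Kx; have [b0 b1 b2 b3] := h4 j x j4 Kx.
have z (y : R) : `|y| <= C4 -> `|y - 0| <= C4 by rewrite subr0.
have W := wedge_form_diff (u j x) (v j x) (z _ b0) (z _ b1) (z _ b2) (z _ b3).
have t1 : `|g x| / 2 <= `|turan_seq j x|.
  have := ler_distD (turan_seq j x) (g x) 0; rewrite !subr0 [`|g x - _|]distrC; lra.
have n0 : 0 <= u j x ^+ 2 + v j x ^+ 2 by rewrite addr_ge0 ?sqr_ge0.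
rewrite ler_pdivrMr// ler_pdivrMr//; apply: (le_trans t1).
rewrite /turan_seq normrM (gtr0_norm (al0 j)) [leRHS]mulrAC [leRHS]mulrC ler_pM2l//.
have w0 : wedge_form 0 0 0 0 (u j x) (v j x) = 0 by rewrite /wedge_form; ring.
rewrite w0 subr0 in W; apply: (le_trans W); lra.
Qed.

Hypothesis hsigma : sigma ^+ 2 = 1.
Hypothesis al_oo : al j @[j --> \oo] --> +oo.
Hypothesis al_diff : al j.+1 - al j @[j --> \oo] --> (0 : R).

(** v_(j+1) - sigma v_j is R_j v_j / al_(j+1), where v_j is O(al_j^(-1/2)); moreover
    al_(j+1)^(1/2) - al_j^(1/2) tends to 0. *)
Lemma next_almost_equal :
  unif_cvg K (fun n x => Num.sqrt (al n) * v n x - sigma * (Num.sqrt (al n.+1) * v n.+1 x)) (fun=> 0).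
Proof.
have [C4 [J4 [C40 JJ4 h4]]] := entries_bounded.
have sB := sqrtr_ge0 B; have B1 : 0 < Num.sqrt B + 1 by lra.
move=> e e0.
have e10 : 0 < e / 2 / (Num.sqrt B + 1) by rewrite !divr_gt0.
have /cvgrPdist_le /(_ _ e10) [J1 _ h1] := al_diff.
(* A lower bound for al^(1/2) that makes the term with R_j at most e / 2. *)
pose L := 2 * C4 * Num.sqrt B / (e / 2) + 1.
have L1 : 1 <= L.
  rewrite lerDr; apply: divr_ge0; last by rewrite divr_ge0// ltW.
  by rewrite !mulr_ge0.
have L0 : 0 < L by apply: lt_le_trans L1.
have /cvgryPge /(_ (L ^+ 2)) [J2 _ h2] := al_oo.
exists (maxn J4 (maxn J' (maxn J1 J2))) => n x; rewrite !geq_max => /and4P[n4 nJ' n1 n2] Kx.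
have L2 : 1 <= L ^+ 2 by rewrite expr_ge1// ltW.
have aL : L ^+ 2 <= al n by apply: h2.
have aL' : L ^+ 2 <= al n.+1 by apply: h2 => /=; exact: leqW.
have sL k : L ^+ 2 <= al k -> L <= Num.sqrt (al k).
  by move=> hk; rewrite -[L]gtr0_norm// -sqrtr_sqr ler_wsqrtr.
have s1 := sL _ aL; have s2 := sL _ aL'.
have S1 : Num.sqrt (al n) ^+ 2 = al n by rewrite sqr_sqrtr// ltW.
have S2 : Num.sqrt (al n.+1) ^+ 2 = al n.+1 by rewrite sqr_sqrtr// ltW.
have [bu bv] := scaled_bounded nJ' Kx.
have [b0 b1 b2 b3] := h4 n x n4 Kx.
have Jn : (J <= n)%N by exact: leq_trans n4.
have ad := h1 n n1; rewrite sub0r normrN in ad.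
rewrite subr0 rec_v ?Jpos//.
have uB : `|u n x| <= Num.sqrt B by apply: le_trans bu; rewrite ler_peMl//; lra.
have vB : `|v n x| <= Num.sqrt B by apply: le_trans bv; rewrite ler_peMl//; lra.
have S20 : Num.sqrt (al n.+1) != 0 by rewrite gt_eqF//; lra.
have e1 : Num.sqrt (al n) * v n x - sigma * (Num.sqrt (al n.+1) * (r10 n x / al n.+1 * u n x +
   (sigma + r11 n x / al n.+1) * v n x)) =
  (Num.sqrt (al n) - Num.sqrt (al n.+1)) * v n x - sigma * ((r10 n x * u n x + r11 n x * v n x) / Num.sqrt (al n.+1))
   - (sigma ^+ 2 - 1) * Num.sqrt (al n.+1) * v n x.
  move: S20 S2; move: (Num.sqrt (al n.+1)) => T T0 S2; rewrite -S2; field.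
  exact: T0.
rewrite e1 hsigma subrr !mul0r subr0.
have p1 : `|Num.sqrt (al n) - Num.sqrt (al n.+1)| <= e / 2 / (Num.sqrt B + 1).
  have e2 : al n.+1 - al n = (Num.sqrt (al n.+1) - Num.sqrt (al n)) * (Num.sqrt (al n.+1) + Num.sqrt (al n)).
    by rewrite -subr_sqr S1 S2.
  apply: le_trans ad; rewrite e2 normrM distrC ler_peMr//.
  by rewrite (le_trans _ (ler_norm _))//; lra.
have ns : `|sigma| = 1.
  by apply/eqP; rewrite -sqrp_eq1// real_normK ?num_real// hsigma.
apply: (le_trans (ler_normB _ _)); rewrite [e]splitr; apply: lerD.
  rewrite normrM; apply: (@le_trans _ _ (e / 2 / (Num.sqrt B + 1) * (Num.sqrt B + 1))).
    by rewrite ler_pM//; lra.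
  by rewrite divfK// gt_eqF.
rewrite normrM ns mul1r normrM normfV (gtr0_norm (lt_le_trans L0 s2)) ler_pdivrMr; last by lra.
have p2 : `|r10 n x * u n x + r11 n x * v n x| <= 2 * C4 * Num.sqrt B.
  apply: (le_trans (ler_normD _ _)); rewrite !normrM -mulrA mulr2n mulrDl mul1r lerD//; exact: ler_pM.
apply: (le_trans p2); apply: (@le_trans _ _ (e / 2 * L)).
  have -> : e / 2 * L = 2 * C4 * Num.sqrt B + e / 2.
    by rewrite /L mulrDr mulr1 [_ * (_ / _)]mulrC divfK// gt_eqF// divr_gt0.
  by rewrite lerDl ltW// divr_gt0.
by rewrite ler_pM2l// divr_gt0.
Qed.

Lemma phase_shift : exists z : R, forall s y : R, sigma * sin (s + y) = sin (s + (y + z)).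
Proof.
have /eqP := hsigma; rewrite sqrf_eq1 => /orP[/eqP ->|/eqP ->].
  by exists 0 => s y; rewrite mul1r addr0.
by exists pi => s y; rewrite addrA sinDpi mulN1r.
Qed.

Lemma sine_asymptotics (lo hi : R) : lo <= hi -> K = `[lo, hi]%classic ->
  exists M eta, [/\ (J' <= M)%N, {within K, continuous eta} &
    unif_cvg K (fun n x => Num.sqrt (al n) * v n x -
      2 * Num.sqrt (q10 x * g x) / Num.sqrt (- h x) * sin (phase M n.+1 x + eta x)) (fun=> 0)].
Proof.
move=> lohi KE.
have [M [Wr [Wi [JM kr ki hr hi']]]] := unwound_limit.
have Kin x : K x <-> lo <= x <= hi by rewrite KE /= in_itv.
have [eta0 ce he] : exists2 eta, {within K, continuous eta} & forall x, K x -> polar Wr Wi eta x.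
  have [||x /Kin Kx|eta ce he] := @argument_lift _ Wr Wi lo hi lohi; rewrite -?KE//.
    by have [-> ?] := limit_sqr hr hi' Kx.
  by exists eta; [rewrite KE|move=> x /Kin; exact: he].
have [z hz] := phase_shift.
exists M, (fun x => eta0 x + z); split => //.
  by apply: continuousD_within => //; exact: continuous_cst_within.
move=> e e0; have e20 : 0 < e / 2 by rewrite divr_gt0.
have [J1 h1] := next_almost_equal e20; have [J2 h2] := sine_form hr hi' e20.
exists (maxn J1 J2) => n x; rewrite geq_max => /andP[n1 n2] Kx.
have a1 := h1 n x n1 Kx; have a2 := h2 n.+1 x (leqW n2) Kx.
have [p1 p2] := he x Kx; have [sq _] := limit_sqr hr hi' Kx; rewrite sq in p1 p2.
rewrite !subr0 in a1 a2 *.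
have ns : `|sigma| = 1.
  by apply/eqP; rewrite -sqrp_eq1// real_normK ?num_real// hsigma.
have -> : Num.sqrt (al n) * v n x - 2 * Num.sqrt (q10 x * g x) / Num.sqrt (- h x) * sin (phase M n.+1 x + (eta0 x + z)) =
  (Num.sqrt (al n) * v n x - sigma * (Num.sqrt (al n.+1) * v n.+1 x)) +
  sigma * (Num.sqrt (al n.+1) * v n.+1 x - 2 / Num.sqrt (- h x) * (sin (phase M n.+1 x) * Wr x + cos (phase M n.+1 x) * Wi x)).
  rewrite -hz sinD p1 p2; ring.
apply: (le_trans (ler_normD _ _)); rewrite normrM ns mul1r [e]splitr; exact: lerD.
Qed.

End Turan.

(** * Transfer matrices, matrix limits and sums over subsequences *)

Section TransferMatrices.
Variable R : realType.
Variables (a b : nat -> R) (N : nat) (sigma : R).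
Hypothesis ha : forall n, 0 < a n.
Implicit Types (A B : 'M[R]_2) (n i j : nat) (x : R).
Local Notation p := (jacobi_poly a b).

Lemma mulmx2E A B k l : (A * B) k l = A k 0 * B 0 l + A k 1 * B 1 l.
Proof. by rewrite mxE !big_ord_recl big_ord0 addr0; congr (_ * _ + A k _ * B _ l); exact: val_inj. Qed.

Lemma mxtrace2 A : \tr A = A 0 0 + A 1 1.
Proof. by rewrite /mxtrace !big_ord_recl big_ord0 addr0; congr (_ + A _ _); exact: val_inj. Qed.

Lemma det2 A : \det A = A 0 0 * A 1 1 - A 0 1 * A 1 0.
Proof.
rewrite (expand_det_row _ 0) !big_ord_recl big_ord0 addr0 /cofactor !det_mx11 !mxE /=.
rewrite expr0 expr1 mul1r mulN1r mulrN.
by congr (_ * A _ _ - A _ _ * A _ _); exact: val_inj.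
Qed.

Lemma discr2 A : discr A = disc2 (A 0 0) (A 0 1) (A 1 0) (A 1 1).
Proof. by rewrite /discr mxtrace2 det2. Qed.

Lemma Nstep_mxS m n x : Nstep_mx a b m.+1 n x = transfer_mx a b (n + m) x * Nstep_mx a b m n x.
Proof.
have e : rev (iota n m.+1) = (n + m)%N :: rev (iota n m) by rewrite -addn1 iotaD rev_cat.
by rewrite /Nstep_mx e big_cons.
Qed.

Lemma transfer_mxE n x : [/\ transfer_mx a b n x 0 0 = 0, transfer_mx a b n x 0 1 = 1,
  transfer_mx a b n x 1 0 = - (a n.-1 / a n) & transfer_mx a b n x 1 1 = (x - b n) / a n].
Proof. by rewrite !mxE. Qed.

Lemma jacobi_poly_step n x : (0 < n)%N ->
  (p n.+1).[x] = - (a n.-1 / a n) * (p n.-1).[x] + (x - b n) / a n * (p n).[x].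
Proof.
case: n => // n _; have a0 : a n.+1 != 0 by rewrite gt_eqF.
have e : a n.+1 * (p n.+2).[x] = (x - b n.+1) * (p n.+1).[x] - a n * (p n).[x].
  by rewrite -hornerZ jacobi_polySS// !hornerE.
apply: (mulfI a0); rewrite e; field.
exact: a0.
Qed.

Lemma Nstep_recurrence n m x : (0 < n)%N ->
  (p (n + m).-1).[x] = Nstep_mx a b m n x 0 0 * (p n.-1).[x] + Nstep_mx a b m n x 0 1 * (p n).[x] /\
  (p (n + m)).[x] = Nstep_mx a b m n x 1 0 * (p n.-1).[x] + Nstep_mx a b m n x 1 1 * (p n).[x].
Proof.
move=> n0; elim: m => [|m [IH1 IH2]].
  by rewrite /Nstep_mx big_nil addn0 !mxE /= !mul1r !mul0r addr0 add0r.
have [t00 t01 t10 t11] := transfer_mxE (n + m) x.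
rewrite Nstep_mxS !mulmx2E t00 t01 t10 t11 addnS /=; split; first by rewrite IH2; ring.
rewrite jacobi_poly_step ?addn_gt0 ?n0// {1}IH1 {1}IH2; ring.
Qed.

Lemma det_Nstep n m x : (0 < n)%N -> \det (Nstep_mx a b m n x) = a n.-1 / a (n + m).-1.
Proof.
move=> n0; elim: m => [|m IH].
  by rewrite /Nstep_mx big_nil addn0 det1 divff// gt_eqF.
have [t00 t01 t10 t11] := transfer_mxE (n + m) x.
rewrite Nstep_mxS det_mulmx IH det2 t00 t01 t10 t11 mul0r mul1r sub0r opprK addnS /=.
by field; rewrite !gt_eqF.
Qed.

Lemma continuous_Nstep n m k l : continuous (fun x => Nstep_mx a b m n x k l).
Proof.
elim: m k l => [|m IH] k l.
  rewrite (_ : (fun x => _) = fun=> (1 : 'M[R]_2) k l); first by move=> x; exact: cvg_cst.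
  by apply/funext => x; rewrite /Nstep_mx big_nil.
have tc k' l' : continuous (fun x => transfer_mx a b (n + m) x k' l').
  move=> x; rewrite (_ : (fun x => _) = fun x => if k' == 0 then (if l' == 0 then 0 else 1)
     else (if l' == 0 then - (a (n + m).-1 / a (n + m)) else (x - b (n + m)) / a (n + m))); last first.
    by apply/funext => y; rewrite mxE.
  case: (k' == 0); case: (l' == 0); try exact: cvg_cst.
  by apply: cvgM; [apply: cvgB; [exact: cvg_id|exact: cvg_cst]|exact: cvg_cst].
rewrite (_ : (fun x => _) = fun x => transfer_mx a b (n + m) x k 0 * Nstep_mx a b m n x 0 l +
    transfer_mx a b (n + m) x k 1 * Nstep_mx a b m n x 1 l); last first.
  by apply/funext => x; rewrite Nstep_mxS mulmx2E.
by move=> x; apply: cvgD; apply: cvgM; [exact: tc|exact: IH|exact: tc|exact: IH].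
Qed.

Lemma scaled_mxE n x : let Y := scaled_mx a b N sigma n x in let X := Nstep_mx a b N n x in
  let A := a (n + N).-1 in
  [/\ X 0 0 = sigma + Y 0 0 / A, X 0 1 = Y 0 1 / A, X 1 0 = Y 1 0 / A & X 1 1 = sigma + Y 1 1 / A].
Proof.
move=> Y X A; have A0 : A != 0 by rewrite /A gt_eqF.
by rewrite /Y /scaled_mx -/A -/X !mxE /= !mulr1n !mulr0n; split; field.
Qed.

Lemma continuous_scaled n k l : continuous (fun x => scaled_mx a b N sigma n x k l).
Proof.
rewrite (_ : (fun x => _) = fun x => a (n + N).-1 * (Nstep_mx a b N n x k l - sigma *+ (k == l))); last first.
  by apply/funext => y; rewrite !mxE.
move=> x; apply: cvgM; first exact: cvg_cst.
by apply: cvgB; [exact: continuous_Nstep|exact: cvg_cst].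
Qed.

End TransferMatrices.

Section MatrixLimit.
Variable R : realType.

Lemma cvg_mx2 (Y : nat -> 'M[R]_2) (A : 'M[R]_2) :
  (forall k l, Y n k l @[n --> \oo] --> A k l) -> Y n @[n --> \oo] --> A.
Proof.
move=> h; apply/cvgrPdist_le => e e0.
have all_kl : \forall n \near \oo, forall k l, `|A k l - Y n k l| <= e.
  have kl k l : \forall n \near \oo, `|A k l - Y n k l| <= e by move/cvgrPdist_le : (h k l) => /(_ e e0).
  have P (k : 'I_2) : k = 0 \/ k = 1.
    by case: k => -[|[|//]] ?; [left|right]; exact: val_inj.
  near=> n => k l.
  by case: (P k) => ->; case: (P l) => ->; near: n; exact: kl.
apply: filterS all_kl => n hn; rewrite /Num.norm /= mx_normrE.
apply/bigmax_leP; split; first exact: ltW.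
by move=> [k l] _ /=; rewrite !mxE; exact: hn.
Unshelve. all: end_near. Qed.

End MatrixLimit.

Section Subsequences.
Variable R : realType.

Lemma sum_subsequence_le (f : nat -> R) (e : nat -> nat) J : (forall k, 0 <= f k) ->
  (forall j, (J <= j)%N -> (e j < e j.+1)%N) ->
  forall n, (J <= n)%N -> \sum_(J <= j < n) f (e j) <= \sum_(k < e n) f k.
Proof.
move=> f0 he; elim=> [|n IH].
  by rewrite leqn0 => /eqP <-; rewrite big_geq// sumr_ge0.
rewrite leq_eqVlt => /orP[/eqP <-|]; first by rewrite big_geq// sumr_ge0.
rewrite ltnS => Jn; rewrite big_nat_recr//=.
have h : \sum_(k < (e n).+1) f k <= \sum_(k < e n.+1) f k.
  rewrite -!(big_mkord xpredT f) [leRHS](@big_cat_nat _ _ _ (e n).+1)//=; last exact: he.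
  by rewrite lerDl sumr_ge0.
by apply: le_trans h; rewrite big_ord_recr lerD2r IH.
Qed.

(** Increments tending to 0 make al grow at most linearly, so the harmonic series bounds
    the sum from below. *)
Lemma inverse_sum_unbounded (al : nat -> R) : (forall j, 0 < al j) ->
  al j.+1 - al j @[j --> \oo] --> (0 : R) ->
  forall J M, exists2 n, (J <= n)%N & M <= \sum_(J <= j < n) (al j)^-1.
Proof.
move=> al0 dal J M.
have /cvgrPdist_le /(_ _ ltr01) [J1 _ h1] := dal.
pose J2 := maxn J J1.
have lin k : al (J2 + k)%N <= al J2 + k%:R.
  elim: k => [|k IH]; first by rewrite addn0 addr0.
  rewrite addnS; have := h1 (J2 + k)%N; rewrite /= sub0r normrN => h.
  have {}h := h (leq_trans (leq_maxr J J1) (leq_addr _ _)).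
  have := ler_norm (al (J2 + k).+1 - al (J2 + k)%N); rewrite -natr1; lra.
(* al j <= C (j + 1) for j >= J2. *)
pose C := al J2 + 1; have C0 : 0 < C by rewrite addr_gt0.
have bnd j : (J2 <= j)%N -> C^-1 * harmonic j <= (al j)^-1.
  move=> Jj; rewrite /harmonic /= -invfM lef_pV2 ?posrE ?mulr_gt0//.
  have := lin (j - J2)%N; rewrite subnKC// => h; apply: (le_trans h).
  have : ((j - J2)%:R : R) <= j%:R by rewrite ler_nat leq_subr.
  have : 0 <= al J2 * j%:R by rewrite mulr_ge0// ltW.
  rewrite /C -natr1; have := ler0n R j; have := al0 J2; nra.
have nd : {homo (series (harmonic : nat -> R)) : n m / (n <= m)%N >-> n <= m}.
  by apply/nondecreasing_seqP => n; rewrite seriesSr lerDl ltW// harmonic_gt0.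
have /cvgryPge /(_ (series harmonic J2 + C * (`|M| + 1))) [n0 _ hn0] := nondecreasing_dvgn_lt nd (@dvg_harmonic R).
pose n := maxn n0 J2.
have J2n : (J2 <= n)%N by rewrite leq_maxr.
exists n; first by rewrite (leq_trans _ J2n)// leq_maxl.
have hn := hn0 n (leq_maxl _ _).
have hn' : C * (`|M| + 1) <= \sum_(J2 <= j < n) harmonic j.
  by move: hn; rewrite /series /= [X in _ <= X -> _](@big_cat_nat _ _ _ J2)//= lerD2l.
rewrite [leRHS](@big_cat_nat _ _ _ J2) ?leq_maxl//=.
apply: (@le_trans _ _ (\sum_(J2 <= i < n) (al i)^-1)); last first.
  by rewrite lerDr sumr_ge0// => i _; rewrite invr_ge0 ltW.
apply: (@le_trans _ _ (C^-1 * \sum_(J2 <= j < n) harmonic j)).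
  rewrite mulrC ler_pdivlMr//; apply: le_trans hn'.
  by rewrite mulrC ler_pM2l//; have := ler_norm M; lra.
rewrite mulr_sumr; apply: ler_sum_nat => j /andP[Jj _]; exact: bnd.
Qed.

End Subsequences.

(** * Density and asymptotics on a compact interval *)

Section Interval.
Variable R : realType.

Lemma compact_interval (K : set R) : compact K -> is_interval K -> K° !=set0 ->
  exists lo hi, lo < hi /\ K = `[lo, hi]%classic.
Proof.
move=> cK iK [x0 Kx0].
have sK := @interior_subset _ K.
have K0 : K !=set0 by exists x0; exact: sK.
have cid : {within K, continuous (id : R -> R)}.
  by apply: continuous_subspaceT => x; exact: cvg_id.
have [hi hiK hmax] := compact_EVT_max K0 cK cid.
have [lo loK hmin] := compact_EVT_min K0 cK cid.
rewrite !inE in hiK loK.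
exists lo, hi; split.
  have [e /= e0 he] := Kx0.
  have K1 : K (x0 + e / 2) by apply: he; rewrite /ball_ /= opprD addrA subrr sub0r normrN gtr0_norm ?divr_gt0// ltr_pdivrMr// ltr_pMr// ltr1n.
  have h1 := hmax _ (mem_set K1); have h2 := hmin _ (mem_set (sK _ Kx0)); rewrite /= in h1 h2.
  lra.
apply/seteqP; split => x /=.
  by move=> Kx; rewrite in_itv /= (hmin _ (mem_set Kx)) (hmax _ (mem_set Kx)).
by rewrite in_itv /= => hx; exact: (iK lo hi).
Qed.

(** A definite form is a multiple of |y + tau x|^2, where - tau is the root with respect
    to y / x of the form in the lower half-plane. *)
Lemma wedge_form_boundary (p q r s : R) : disc2 p q r s < 0 ->
  exists tau : complex.complex R, [/\ 0 < complex.Im tau,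
    complex.Im tau = Num.sqrt (- disc2 p q r s) / (2 * `|q|) &
    forall x y, `|wedge_form p q r s x y| =
      `|q| * ((y + complex.Re tau * x) ^+ 2 + (complex.Im tau * x) ^+ 2)].
Proof.
move=> h.
have q0 : q != 0.
  apply/eqP => q0; move: h; rewrite /disc2 q0 mul0r subr0.
  have := sqr_ge0 (p - s); lra.
have nq : 0 < `|q| by rewrite normr_gt0.
have s0 : 0 < Num.sqrt (- disc2 p q r s) by rewrite sqrtr_gt0; lra.
have ss : Num.sqrt (- disc2 p q r s) ^+ 2 = - disc2 p q r s by rewrite sqr_sqrtr//; lra.
exists (complex.Complex (- ((s - p) / (2 * q))) (Num.sqrt (- disc2 p q r s) / (2 * `|q|))).
split => //=; first by rewrite divr_gt0// mulr_gt0.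
move=> x y.
have -> : wedge_form p q r s x y = - q * ((y + - ((s - p) / (2 * q)) * x) ^+ 2 +
    (Num.sqrt (- disc2 p q r s) / (2 * `|q|) * x) ^+ 2).
  rewrite exprMn expr_div_n exprMn ss real_normK ?num_real// /wedge_form /disc2.
  by field.
rewrite normrM normrN; congr (_ * _).
by rewrite ger0_norm// addr_ge0 ?sqr_ge0.
Qed.

End Interval.

Section Assembly.
Variables (R : realType) (N i : nat) (a b : nat -> R).
Variables (mu : probability (measurableTypeR R) R) (sigma : R) (lo hi : R).
Hypothesis hN : (0 < N)%N.
Hypothesis ha : forall n, 0 < a n.
Hypothesis hmu : orthonormality_measure a b mu.
Hypothesis ha_oo : a (j * N + i).-1 @[j --> \oo] --> +oo.
Hypothesis ha_diff : a (j.+1 * N + i).-1 - a (j * N + i).-1 @[j --> \oo] --> (0 : R).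
Hypothesis hsigma : sigma = -1 \/ sigma = 1.
Hypothesis lohi : lo < hi.
Let K : set R := `[lo, hi]%classic.
Hypothesis hLambda : K `<=` Lambda a b N sigma i.
Hypothesis hR : D1 K (fun j => scaled_mx a b N sigma (j * N + i)).
Local Notation p := (jacobi_poly a b).

Let al j := a (j * N + i).-1.
Let u j x := (p (j * N + i).-1).[x].
Let v j x := (p (j * N + i)).[x].
Let r k l j x := scaled_mx a b N sigma (j * N + i) x k l.

Let al0 j : 0 < al j. Proof. exact: ha. Qed.
Let cK : compact K. Proof. exact: segment_compact. Qed.
Let K0 : K !=set0. Proof. by exists lo; rewrite /K /= in_itv /= lexx ltW. Qed.
Let idx_gt0 j : (0 < j)%N -> (0 < j * N + i)%N.
Proof. by move=> j0; rewrite addn_gt0 muln_gt0 j0 hN. Qed.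
Let idxS j : (j.+1 * N + i)%N = (j * N + i + N)%N. Proof. by rewrite mulSn addnAC addnC addnA addnAC. Qed.
Let alS j : a (j * N + i + N).-1 = al j.+1. Proof. by rewrite /al idxS. Qed.

Let cr k l : cont_seq K (r k l).
Proof. by move=> j; apply: continuous_subspaceT; exact: continuous_scaled. Qed.
Let cu : cont_seq K u.
Proof. by move=> j; apply: continuous_subspaceT; exact: continuous_horner. Qed.
Let cv : cont_seq K v.
Proof. by move=> j; apply: continuous_subspaceT; exact: continuous_horner. Qed.

Let rec_u j x : (0 < j)%N -> K x ->
  u j.+1 x = (sigma + r 0 0 j x / al j.+1) * u j x + r 0 1 j x / al j.+1 * v j x.
Proof.
move=> j0 _; have [h _] := Nstep_recurrence b ha N x (idx_gt0 j0).
have [e1 e2 _ _] := scaled_mxE b N sigma ha (j * N + i) x.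
by rewrite /u idxS h e1 e2 alS.
Qed.
Let rec_v j x : (0 < j)%N -> K x ->
  v j.+1 x = r 1 0 j x / al j.+1 * u j x + (sigma + r 1 1 j x / al j.+1) * v j x.
Proof.
move=> j0 _; have [_ h] := Nstep_recurrence b ha N x (idx_gt0 j0).
have [_ _ e1 e2] := scaled_mxE b N sigma ha (j * N + i) x.
by rewrite /v idxS h e1 e2 alS.
Qed.
Let hdet j x : (0 < j)%N -> K x ->
  (sigma + r 0 0 j x / al j.+1) * (sigma + r 1 1 j x / al j.+1) - r 0 1 j x / al j.+1 * (r 1 0 j x / al j.+1)
  = al j / al j.+1.
Proof.
move=> j0 _; have [e1 e2 e3 e4] := scaled_mxE b N sigma ha (j * N + i) x.
by rewrite -alS -e1 -e2 -e3 -e4 -det2 det_Nstep// idx_gt0.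
Qed.
Let nz j x : (0 < j)%N -> K x -> u j x = 0 -> v j x = 0 -> False.
Proof.
move=> j0 _; rewrite /u /v; have := idx_gt0 j0; case: (j * N + i)%N => // n _ /=.
exact: jacobi_consecutive.
Qed.
Let hneg x : K x -> exists l : R, disc_seq (r 0 0) (r 0 1) (r 1 0) (r 1 1) j x @[j --> \oo] --> l /\ l < 0.
Proof.
move=> /hLambda [l [hl l0]]; exists l; split => //; apply: cvg_trans hl.
by apply: near_eq_cvg; near=> j; rewrite /disc_seq discr2.
Unshelve. all: end_near. Qed.

Let hsigma2 : sigma ^+ 2 = 1.
Proof. by case: hsigma => ->; rewrite ?sqrrN expr1n. Qed.

Lemma angle_theta j x : (0 < j)%N ->
  angle_arg al (r 0 0) (r 1 1) sigma j x = theta_arg a b N i j x.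
Proof.
move=> j0; have [e1 _ _ e4] := scaled_mxE b N sigma ha (j * N + i) x.
rewrite /angle_arg /theta_arg mxtrace2 e1 e4 det_Nstep ?idx_gt0// alS.
by rewrite -/(r 0 0 j x) -/(r 1 1 j x) -/(al j); congr (_ / _); ring.
Qed.

Definition sine_remainder (w : R -> R) M (eta : R -> R) n x :=
  Num.sqrt (a (n * N + i).-1) * (p (n * N + i)).[x]
  - Num.sqrt ((2 * `| limit_mx a b N sigma i x 1 0 |) /
              (pi * w x * Num.sqrt (- limit_discr a b N sigma i x)))
    * sin (\sum_(M.+1 <= j < n.+1) theta a b N i j x + eta x).

Section Data.
Variables (d : nat -> R) (q00 q01 q10 q11 : R -> R) (c C : R) (J : nat).
Variables (g : R -> R) (J' : nat) (B : R).
Hypothesis sd : summable_seq d.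
Hypothesis hd : forall k l, slowly_varying K d (r k l).
Hypothesis UD : uniform_data K (r 0 0) (r 0 1) (r 1 0) (r 1 1) q00 q01 q10 q11 c C J.
Hypothesis JJ' : (J <= J')%N.
Hypothesis ug : unif_cvg K (turan_seq al u v (r 0 0) (r 0 1) (r 1 0) (r 1 1)) g.
Hypothesis kg : {within K, continuous g}.
Hypothesis gn0 : forall x, K x -> g x != 0.
Hypothesis hB : forall j x, (J' <= j)%N -> K x -> al j * ((u j x) ^+ 2 + (v j x) ^+ 2) <= B.

Let h x := disc2 (q00 x) (q01 x) (q10 x) (q11 x).
Let hlt0 x : K x -> h x < 0.
Proof. by case: UD => _ _ [c0 _ _] hq _ Kx; have [? _ _] := hq x Kx; rewrite /h; lra. Qed.

Definition limit_density x := Num.sqrt (- h x) / (2 * pi * `|g x|).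

Lemma limit_density_gt0 x : K x -> 0 < limit_density x.
Proof.
move=> Kx; rewrite divr_gt0 ?sqrtr_gt0 ?oppr_gt0 ?hlt0//.
by rewrite mulr_gt0 ?normr_gt0 ?gn0// mulr_gt0// pi_gt0.
Qed.

Lemma continuous_limit_density : {within K, continuous limit_density}.
Proof.
have [[u00 u01 u10 u11] [k00 k01 k10 k11] _ _ _] := UD.
have [_ kh] := disc_unif_cvg cK K0 u00 u01 u10 u11 k00 k01 k10 k11.
apply/subspace_continuousP => x Kx.
move/subspace_continuousP : kh => /(_ x Kx) kh.
move/subspace_continuousP : (kg) => /(_ x Kx) kgx.
apply: cvgM.
  apply: (continuous_cvg _ (@sqrt_continuous R _)); exact: cvgN.
apply: cvgV.
  by rewrite gt_eqF// mulr_gt0 ?normr_gt0 ?gn0// mulr_gt0// pi_gt0.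
by apply: cvgM; [exact: cvg_cst|exact: cvg_norm].
Qed.

Lemma carleman_condition M : exists n, M <= \sum_(k < n) (a k)^-1.
Proof.
have [n n1 hn] := inverse_sum_unbounded al0 ha_diff 1 M.
exists (n * N + i).-1; apply: (le_trans hn).
apply: (@sum_subsequence_le R (fun k => (a k)^-1) (fun j => (j * N + i).-1)) => //.
  by move=> k; rewrite invr_ge0 ltW.
move=> j j1; have := idx_gt0 j1; rewrite idxS.
by case: (j * N + i)%N => // m _; rewrite addSn /= -[X in (X < _)%N]addn0 ltn_add2l.
Qed.

(** The terms p_(n_j - 1)(x)^2 + p_(n_j)(x)^2 are at least of the order of 1 / al_j, the terms
    of a divergent series. When N = 1 consecutive pairs overlap, whence the factor 2. *)
Lemma no_atom_K x : K x -> mu [set x] = 0%E.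
Proof.
move=> Kx; apply: (no_atom hmu) => M.
have [m [j0 [m0 hm]]] := norm_lower al0 cK K0 UD ug gn0 Kx.
have [n n1 hn] := inverse_sum_unbounded al0 ha_diff (maxn 1 j0) (2 * `|M| / m).
exists (n * N + i)%N.
have f0 k : 0 <= (p k).[x] ^+ 2 by exact: sqr_ge0.
have inc j : (maxn 1 j0 <= j)%N -> (j * N + i < j.+1 * N + i)%N.
  by move=> _; rewrite ltn_add2r ltn_mul2r hN /= ltnS.
have inc' j : (maxn 1 j0 <= j)%N -> ((j * N + i).-1 < (j.+1 * N + i).-1)%N.
  move=> hj; have := inc j hj; have := idx_gt0 (leq_trans (leq_maxl 1 j0) hj).
  by case: (j * N + i)%N => // k _; case: (j.+1 * N + i)%N.
have s1 := sum_subsequence_le f0 inc n1; have s2 := sum_subsequence_le f0 inc' n1.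
have mono k k' : (k <= k')%N -> \sum_(l < k) (p l).[x] ^+ 2 <= \sum_(l < k') (p l).[x] ^+ 2.
  move=> kk; rewrite -!(big_mkord xpredT (fun l => (p l).[x] ^+ 2)) [leRHS](@big_cat_nat _ _ _ k)//=.
  by rewrite lerDl sumr_ge0.
have s1' := le_trans s1 (mono _ _ (leqnSn _)).
have s2' := le_trans s2 (mono _ _ (leq_trans (leq_pred _) (leqnSn _))).
have s3 : m * (2 * `|M| / m) <= \sum_(maxn 1 j0 <= j < n) (u j x ^+ 2 + v j x ^+ 2).
  apply: (@le_trans _ _ (m * \sum_(maxn 1 j0 <= j < n) (al j)^-1)); first by rewrite ler_pM2l.
  rewrite mulr_sumr; apply: ler_sum_nat => j /andP[hj _]; apply: hm.
  exact: leq_trans (leq_maxr 1 j0) hj.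
rewrite big_split /= mulrC divfK ?gt_eqF// in s3.
move: s1' s2' s3; rewrite /u /v; have := ler_norm M; lra.
Qed.

(** With tau from the limit form at x0 the boundary density is a function of the frozen form
    of local_form alone, hence close to its value at g(x0). *)
Lemma local_density_K x0 : lo < x0 < hi -> local_density a b x0 (limit_density x0).
Proof.
move=> /andP[x0lo x0hi] eps e0.
have Kx0 : K x0 by rewrite /K /= in_itv /= !ltW.
pose F (s : R) := Num.sqrt (- h x0) / (2 * pi * `|s|).
have cF : F s @[s --> g x0] --> F (g x0).
  apply: cvgM; first exact: cvg_cst.
  apply: cvgV.
    by rewrite gt_eqF// mulr_gt0 ?normr_gt0 ?gn0// mulr_gt0// pi_gt0.
  by apply: cvgM; [exact: cvg_cst|apply: cvg_norm; exact: cvg_id].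
have /cvgrPdist_le /(_ _ e0) [e1 /= e10 he1] := cF.
have e20 : 0 < e1 / 2 by rewrite divr_gt0.
have [dl [j0 [dl0 hdl]]] := local_form al0 K0 UD ug kg hB Kx0 e20.
exists (Num.min dl (Num.min (x0 - lo) (hi - x0))); first by rewrite !lt_min dl0 !subr_gt0 x0lo.
move=> n0; pose j := maxn 1 (maxn j0 n0.+1).
have j1 : (0 < j)%N by rewrite leq_max.
have [tau [t0 tE ht]] := wedge_form_boundary (hlt0 Kx0).
exists (j * N + i).-1, tau; split => //.
  have : (n0.+1 <= j * N + i)%N.
    apply: (leq_trans _ (leq_addr _ _)); apply: (@leq_trans j); first by rewrite !leq_max leqnn !orbT.
    by rewrite leq_pmulr.
  by case: (j * N + i)%N.
move=> x; rewrite !lt_min => /and3P[xd x1 x2].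
have Kx : K x.
  move: x1 x2; rewrite !ltr_norml => /andP[x1 _] /andP[_ x2].
  by rewrite /K /= in_itv /=; apply/andP; split; lra.
have jj0 : (j0 <= j)%N by rewrite /j !leq_max leqnn !orbT.
have W := hdl j x jj0 Kx xd.
have -> : boundary_density a b (j * N + i).-1 tau x =
   F (al j * wedge_form (q00 x0) (q01 x0) (q10 x0) (q11 x0) (u j x) (v j x)).
  rewrite /boundary_density /F normrM ht (gtr0_norm (al0 j)) /boundary_sq (prednK (idx_gt0 j1)).
  rewrite -/(u j x) -/(v j x) -/(al j) {1}tE.
  have q0 : `|q01 x0| != 0.
    apply/negP => /eqP z; move: t0; rewrite tE z mulr0 invr0 mulr0; by rewrite ltxx.
  move: (_ + _ : R) (@pi_gt0 R) (al0 j) => S; move: (pi : R) (al j) => P A P0 A0.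
  have [->|S0] := eqVneq S 0; first by rewrite !mulr0 !invr0 !mulr0.
  by rewrite -/(h x0); field; rewrite q0 S0 !gt_eqF.
rewrite distrC; apply: he1; rewrite /ball_ /= distrC.
by apply: (le_lt_trans W); rewrite ltr_pdivrMr// ltr_pMr// ltr1n.
Qed.

Lemma limit_density_continuous_positive : continuous_positive_density mu K limit_density.
Proof.
split; [exact: continuous_limit_density|exact: limit_density_gt0|].
move=> A mA AK.
apply: (density_of_local_poisson lohi continuous_limit_density _ _ _ mA AK).
- by move=> x xK; apply/ltW/limit_density_gt0; rewrite /K /=.
- by move=> x xK; apply: no_atom_K; rewrite /K /=.
move=> x0; rewrite in_itv /= => x0K eps e0.
have Kx0 : K x0 by move: x0K => /andP[? ?]; rewrite /K /= in_itv /= !ltW.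
exact: (poisson_mu_local ha hmu carleman_condition (ltW (limit_density_gt0 Kx0)) (local_density_K x0K) e0).
Qed.


Lemma limit_mx10 x : K x -> limit_mx a b N sigma i x 1 0 = q10 x.
Proof.
move=> Kx; have [[u00 u01 u10 u11] _ _ _ _] := UD.
pose A : 'M[R]_2 := \matrix_(k, l) if k == 0 then (if l == 0 then q00 x else q01 x)
  else (if l == 0 then q10 x else q11 x).
have hA : scaled_mx a b N sigma (n * N + i) x @[n --> \oo] --> A.
  apply: cvg_mx2 => k l.
  have P (m : 'I_2) : m = 0 \/ m = 1.
    by case: m => -[|[|//]] ?; [left|right]; exact: val_inj.
  by case: (P k) => ->; case: (P l) => ->; rewrite mxE /=;
    [exact: unif_cvg_cvg u00 Kx|exact: unif_cvg_cvg u01 Kx|exact: unif_cvg_cvg u10 Kx|exact: unif_cvg_cvg u11 Kx].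
by rewrite /limit_mx (cvg_lim _ hA) ?mxE//; exact: norm_hausdorff.
Qed.

Lemma limit_discrE x : K x -> limit_discr a b N sigma i x = h x.
Proof.
move=> Kx; have [[u00 u01 u10 u11] [k00 k01 k10 k11] _ _ _] := UD.
have [uh _] := disc_unif_cvg cK K0 u00 u01 u10 u11 k00 k01 k10 k11.
apply: cvg_lim; first exact: norm_hausdorff.
apply: cvg_trans (unif_cvg_cvg uh Kx).
by apply: near_eq_cvg; near=> j; rewrite /disc_seq discr2.
Unshelve. all: end_near. Qed.

(** The limits of [R_j]_(2,1) and of the Turan determinants have the same sign, so the
    absolute value of their product can be dropped. *)
Lemma amplitudeE x : K x ->
  Num.sqrt ((2 * `|limit_mx a b N sigma i x 1 0|) /
     (pi * limit_density x * Num.sqrt (- limit_discr a b N sigma i x))) =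
  2 * Num.sqrt (q10 x * g x) / Num.sqrt (- h x).
Proof.
move=> Kx; rewrite limit_mx10// limit_discrE//.
have [M [Wr [Wi [_ _ _ hr hi']]]] := unwound_limit al0 cK K0 sd
  (hd 0 0) (hd 0 1) (hd 1 0) (hd 1 1) (@cr 0 0) (@cr 0 1) (@cr 1 0) (@cr 1 1) cu cv rec_u rec_v hdet UD JJ' hB.
have [_ qg] := limit_sqr al0 UD ug gn0 hr hi' Kx.
have h0 := hlt0 Kx; have sh0 : 0 < Num.sqrt (- h x) by rewrite sqrtr_gt0; lra.
have sh : Num.sqrt (- h x) ^+ 2 = - h x by rewrite sqr_sqrtr//; lra.
have g0 : 0 < `|g x| by rewrite normr_gt0 gn0.
have -> : 2 * `|q10 x| / (pi * limit_density x * Num.sqrt (- h x)) = (2 / Num.sqrt (- h x)) ^+ 2 * (q10 x * g x).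
  rewrite -(gtr0_norm qg) normrM /limit_density.
  move: (Num.sqrt (- h x)) sh0 (@pi_gt0 R) => S S0; move: (pi : R) => P P0.
  by field; rewrite !gt_eqF.
rewrite sqrtrM ?sqr_ge0// sqrtr_sqr ger0_norm ?divr_ge0 ?ltW//; ring.
Qed.

Lemma jacobi_asymptotics : exists (M : nat) (eta : R -> R),
    [/\ (1 <= M)%N,
        forall j x, (M < j)%N -> K x -> theta_well_defined a b N i j x,
        {within K, continuous eta} &
        unif_cvg K (sine_remainder limit_density M eta) (fun=> 0)].
Proof.
have [_ _ [_ _ J0] _ _] := UD.
have [M [eta [JM ce hs]]] := sine_asymptotics al0 cK K0 sd
  (hd 0 0) (hd 0 1) (hd 1 0) (hd 1 1) (@cr 0 0) (@cr 0 1) (@cr 1 0) (@cr 1 1) cu cv rec_u rec_v hdet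
  UD JJ' ug kg gn0 hB hsigma2 ha_oo ha_diff (ltW lohi) (erefl K).
have J_M := leq_trans JJ' JM.
have M0 := leq_trans J0 J_M.
exists M, eta; split => //.
  move=> j x Mj Kx; have j0 : (0 < j)%N := leq_trans M0 (ltnW Mj).
  split; first by rewrite det_Nstep ?idx_gt0// divr_gt0.
  have [/andP[b1 b2] _ _] := angle_facts al0 hdet UD (leq_trans J_M (ltnW Mj)) Kx.
  by rewrite -angle_theta// !ltW.
apply: unif_cvg_eq hs; exists 0%N => n x _ Kx; rewrite /sine_remainder amplitudeE// -/(al n) -/(v n x).
congr (_ - _ * sin (_ + _)); rewrite /phase; apply: eq_big_nat => j /andP[Mj _].
by rewrite /angle /theta angle_theta//; exact: leq_trans M0 (ltnW Mj).
Qed.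

End Data.

Lemma density_and_asymptotics : exists2 w : R -> R, continuous_positive_density mu K w &
  exists (M : nat) (eta : R -> R),
    [/\ (1 <= M)%N,
        forall j x, (M < j)%N -> K x -> theta_well_defined a b N i j x,
        {within K, continuous eta} &
        unif_cvg K (sine_remainder w M eta) (fun=> 0)].
Proof.
have [d sd hd0] := D1_entries K0 hR.
have hd k l : slowly_varying K d (r k l) by move=> j x j0 Kx; exact: hd0.
have [q00 [q01 [q10 [q11 [c [C [J UD]]]]]]] := uniform_data_exists cK K0 sd
  (hd 0 0) (hd 0 1) (hd 1 0) (hd 1 1) (@cr 0 0) (@cr 0 1) (@cr 1 0) (@cr 1 1) hneg.
have [g [J' [B [JJ' ug kg gn0 hB]]]] := turan_limit al0 cK K0 sd
  (hd 0 0) (hd 0 1) (hd 1 0) (hd 1 1) (@cr 0 0) (@cr 0 1) (@cr 1 0) (@cr 1 1) cu cv rec_u rec_v hdet nz UD.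
exists (limit_density q00 q01 q10 q11 g); first exact: limit_density_continuous_positive UD ug kg gn0 hB.
exact: jacobi_asymptotics sd hd UD JJ' ug kg gn0 hB.
Qed.

End Assembly.

Section UniformSup.
Variable R : realType.

Lemma unif_cvg0_ereal_sup (K : set R) (F : nat -> R -> R) : K !=set0 -> unif_cvg K F (fun=> 0) ->
  ereal_sup [set (`|F n x|)%:E | x in K] @[n --> \oo] --> 0%E.
Proof.
move=> [x0 Kx0] hF.
have s0 n : (0 <= ereal_sup [set (`|F n x|)%:E | x in K])%E.
  by apply: (@le_trans _ _ (`|F n x0|)%:E); [rewrite lee_fin|apply: ereal_sup_ubound; exists x0].
have sle e : 0 < e -> \forall n \near \oo, (ereal_sup [set (`|F n x|)%:E | x in K] <= e%:E)%E.
  move=> e0; have [J hJ] := hF e e0; exists J => // n /= Jn.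
  by apply: ub_ereal_sup => _ [x Kx <-]; rewrite lee_fin; have := hJ n x Jn Kx; rewrite subr0.
have sfin : \forall n \near \oo, ereal_sup [set (`|F n x|)%:E | x in K] \is a fin_num.
  apply: filterS (sle 1 ltr01) => n hn.
  by rewrite ge0_fin_numE// (le_lt_trans hn)// ltry.
apply/fine_cvgP; split => //; apply/cvgrPdist_le => e e0.
apply: filterS2 (sle e e0) sfin => n hn fn /=.
rewrite sub0r normrN ger0_norm; last exact: fine_ge0.
by rewrite -lee_fin fineK.
Qed.

End UniformSup.

Theorem theoremC (R : realType) (N i : nat) (a b : nat -> R)
    (mu : probability (measurableTypeR R) R) (sigma : R) (K : set R)
    (hN : (0 < N)%N) (hi : (i < N)%N)
    (ha : forall n, 0 < a n)
    (hmu : orthonormality_measure a b mu)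
    (ha_oo : a (j * N + i).-1 @[j --> \oo] --> +oo)
    (ha_diff : a (j.+1 * N + i).-1 - a (j * N + i).-1 @[j --> \oo] --> (0 : R))
    (hsigma : sigma = -1 \/ sigma = 1)
    (hK_compact : compact K) (hK_itv : is_interval K) (hK_int : K° !=set0)
    (hK_Lambda : K `<=` Lambda a b N sigma i)
    (hX : D1 K (fun j => Nstep_mx a b N (j * N + i)))
    (hR : D1 K (fun j => scaled_mx a b N sigma (j * N + i))) :
  exists2 mu' : R -> R, continuous_positive_density mu K mu' &
  exists (M : nat) (eta : R -> R),
    [/\ (1 <= M)%N,
        forall j x, (M < j)%N -> K x -> theta_well_defined a b N i j x,
        {within K, continuous eta} &
        ereal_sup [set
          (`| Num.sqrt (a (n * N + i).-1) * (jacobi_poly a b (n * N + i)).[x]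
              - Num.sqrt ((2 * `| limit_mx a b N sigma i x 1 0 |) /
                          (pi * mu' x *
                           Num.sqrt (- limit_discr a b N sigma i x)))
                * sin (\sum_(M.+1 <= j < n.+1) theta a b N i j x + eta x) |)%:E
          | x in K] @[n --> \oo] --> (0 : \bar R)%E].
Proof.
have [lo [hi' [lohi KE]]] := compact_interval hK_compact hK_itv hK_int.
have K0 : K !=set0 by case: hK_int => x Kx; exists x; exact: interior_subset.
rewrite {}KE in hK_Lambda hR K0 *.
have [w hw [M [eta [M1 wd ce hs]]]] :=
  density_and_asymptotics hN ha hmu ha_oo ha_diff hsigma lohi hK_Lambda hR.
exists w => //; exists M, eta; split => //.
exact: unif_cvg0_ereal_sup K0 hs.
Qed.
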